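(* Let $(M^{2n+1},\phi,\xi,\eta,g)$ be a Sasakian manifold of dimension $2n+1$ ($n\geqslant 1$) whose metric $g$ is weakly Einstein. Then the scalar curvature $s$ of $g$ satisfies $$-6\leqslant s\leqslant 6\quad\text{if } n=1,$$ $$-2n(2n+1)\,\frac{4n^2-4n+3}{4n^2-4n-1}\leqslant s\leqslant 2n(2n+1)\quad\text{if } n\geqslant 2,$$ and equality holds in the right-hand inequality (that is, $s=6$ for $n=1$, respectively $s=2n(2n+1)$ for $n\geqslant2$) if and only if $M$ is a conformally flat Einstein manifold.
   Context: Weakly Einstein: a Riemannian manifold $(M,g)$ of dimension $m$ with curvature tensor $R$ is weakly Einstein if $\breve R=\frac{|R|^2}{m}g$, where $\breve R(X,Y)=\sum_{i,j,k}R(X,e_i,e_j,e_k)R(Y,e_i,e_j,e_k)$ for a local orthonormal frame $\{e_i\}$ and $|R|^2=\sum_{i,j,k,l}R_{ijkl}^2$. Conventions: $R_{ijkl}=g(R(e_i,e_j)e_k,e_l)$, $Ric_{jk}=g^{il}R_{ijkl}$, $s=g^{ik}Ric_{ik}$. Almost contact metric structure on a $(2n+1)$-manifold: $(\phi,\xi,\eta,g)$ with $\phi$ a $(1,1)$-tensor field, $\xi$ a unit vector field (Reeb vector field), $\eta$ its dual one-form, $\phi^2=-I+\eta\otimes\xi$, $\eta\circ\phi=0$, $\phi\xi=0$, and $g$ a Riemannian metric with $g(\phi X,\phi Y)=g(X,Y)-\eta(X)\eta(Y)$, $g(X,\xi)=\eta(X)$. It is a contact metric structure if $d\eta(X,Y)=g(X,\phi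 Y)$ for all vector fields $X,Y$, with the convention $d\eta(X,Y)=\frac12\big(X\eta(Y)-Y\eta(X)-\eta([X,Y])\big)$. It is normal if the almost complex structure $J$ on $M\times\mathbb{R}$, $J(X,f\frac{d}{dt})=(\phi X-f\xi,\eta(X)\frac{d}{dt})$, is integrable. A Sasakian manifold is a normal contact metric manifold; with these conventions it satisfies $R(X,Y)\xi=\eta(Y)X-\eta(X)Y$ and $Ric(\xi,\cdot)=2n\,\eta$. *)

(* Defs.v *)
From mathcomp Require Import all_boot all_order all_algebra.
From mathcomp Require Import all_classical all_reals all_analysis.

Set Implicit Arguments.
Unset Strict Implicit.
Unset Printing Implicit Defensive.

Import Order.TTheory GRing.Theory Num.Theory.
Import numFieldNormedType.Exports.

Local Open Scope classical_set_scope.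
Local Open Scope ring_scope.

(* Intended for an open set [U] of a finite-dimensional space [E]: there, f is
   of class C^k iff its iterated directional derivatives up to order k exist
   and are continuous. *)
Fixpoint Ck_on (R : realType) (E V : normedModType R) (k : nat) (U : set E)
    (f : E -> V) : Prop :=
  (forall x, U x -> {for x, continuous f}) /\
  (if k is k'.+1 then
     forall v : E, (forall x, U x -> derivable f x v) /\
                   Ck_on k' U (fun x => 'D_v f x)
   else True).

Definition smooth_on (R : realType) (E V : normedModType R) (U : set E)
    (f : E -> V) : Prop :=
  forall k, Ck_on k U f.

(* The chart maps are total functions; only their values on [chart_dom i]
   (resp. [chart_cod i], for the inverses) are meaningful. *)
Record smooth_manifold (R : realType) (m : nat) := SmoothManifold {
  mpoint :> topologicalType ;
  mhausdorff : hausdorff_space mpoint ;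
  msecond_countable : @second_countable mpoint ;
  chart_idx : Type ;
  chart_dom : chart_idx -> set mpoint ;
  chart_cod : chart_idx -> set 'cV[R]_m ;
  chart : chart_idx -> mpoint -> 'cV[R]_m ;
  chart_inv : chart_idx -> 'cV[R]_m -> mpoint ;
  chart_cover : forall p, exists i, chart_dom i p ;
  chart_dom_open : forall i, open (chart_dom i) ;
  chart_cod_open : forall i, open (chart_cod i) ;
  chart_in : forall i p, chart_dom i p -> chart_cod i (chart i p) ;
  chart_inv_in : forall i u, chart_cod i u -> chart_dom i (chart_inv i u) ;
  chartK : forall i p, chart_dom i p -> chart_inv i (chart i p) = p ;
  chart_invK : forall i u, chart_cod i u -> chart i (chart_inv i u) = u ;
  chart_continuous : forall i p, chart_dom i p ->
    {for p, continuous (chart i)} ;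
  chart_inv_continuous : forall i u, chart_cod i u ->
    {for u, continuous (chart_inv i)} ;
  chart_smooth : forall i j,
    smooth_on (chart_cod i `&` chart_inv i @^-1` chart_dom j)
              (chart j \o chart_inv i)
}.

Section Tensors.
Variables (R : realType) (m : nat) (M : smooth_manifold R m).

(* A tensor field is given, as in classical tensor calculus, by its component
   functions in every chart, subject to the transformation law. *)
Definition components (V : Type) := chart_idx M -> 'cV[R]_m -> V.

Definition smooth_components (V : normedModType R) (T : components V) :=
  forall i, smooth_on (chart_cod i) (T i).

(* Differential of the change of coordinates from chart i to chart j at p. *)
Definition transition_diff (i j : chart_idx M) (p : M) (v : 'cV[R]_m) :
    'cV[R]_m :=
  'D_v (chart j \o chart_inv i) (chart i p).

Definition in_overlap (i j : chart_idx M) (p : M) : Prop :=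
  chart_dom i p /\ chart_dom j p.

Definition is_vector_field (xi : components 'cV[R]_m) : Prop :=
  smooth_components xi /\
  forall i j p, in_overlap i j p ->
    xi j (chart j p) = transition_diff i j p (xi i (chart i p)).

Definition is_one_form (eta : components 'rV[R]_m) : Prop :=
  smooth_components eta /\
  forall i j p, in_overlap i j p -> forall v : 'cV[R]_m,
    eta j (chart j p) *m transition_diff i j p v = eta i (chart i p) *m v.

Definition is_endomorphism_field (phi : components 'M[R]_m) : Prop :=
  smooth_components phi /\
  forall i j p, in_overlap i j p -> forall v : 'cV[R]_m,
    phi j (chart j p) *m transition_diff i j p v =
    transition_diff i j p (phi i (chart i p) *m v).

Definition bil (A : 'M[R]_m) (x y : 'cV[R]_m) : R := (x^T *m A *m y) 0 0.

Definition is_riemannian_metric (g : components 'M[R]_m) : Prop :=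
  [/\ smooth_components g,
      forall i j p, in_overlap i j p -> forall v w : 'cV[R]_m,
        bil (g j (chart j p)) (transition_diff i j p v)
                              (transition_diff i j p w) =
        bil (g i (chart i p)) v w,
      forall i u, chart_cod i u -> (g i u)^T = g i u &
      forall i u, chart_cod i u -> forall v : 'cV[R]_m,
        v != 0 -> 0 < bil (g i u) v v].

End Tensors.

Definition lie_bracket (R : realType) (E : normedModType R) (X Y : E -> E)
    (u : E) : E :=
  'D_(X u) Y u - 'D_(Y u) X u.

Section Curvature.
Variables (R : realType) (m : nat) (g : 'cV[R]_m -> 'M[R]_m).

Let E (i : 'I_m) : 'cV[R]_m := delta_mx i 0.

(* The vector Gamma^l_{ab} x^a y^b. *)
Definition christoffel (u x y : 'cV[R]_m) : 'cV[R]_m :=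
  invmx (g u) *m
  \col_l (2^-1 * (bil ('D_x g u) y (E l) + bil ('D_y g u) x (E l)
                  - bil ('D_(E l) g u) x y)).

Definition levi_civita (X Y : 'cV[R]_m -> 'cV[R]_m) (u : 'cV[R]_m) :
    'cV[R]_m :=
  'D_(X u) Y u + christoffel u (X u) (Y u).

Definition curvature_op (X Y Z : 'cV[R]_m -> 'cV[R]_m) (u : 'cV[R]_m) :
    'cV[R]_m :=
  levi_civita X (levi_civita Y Z) u - levi_civita Y (levi_civita X Z) u
  - levi_civita (lie_bracket X Y) Z u.

(* R(x,y,z,w) = g(R(x,y)z,w) at u; by tensoriality the tangent vectors x, y, z
   may be extended to vector fields with constant components. *)
Definition riemann (u x y z w : 'cV[R]_m) : R :=
  bil (g u) (curvature_op (cst x) (cst y) (cst z) u) w.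

(* Ric_{jk} = g^{il} R_{ijkl} *)
Definition ricci (u y z : 'cV[R]_m) : R :=
  \sum_i \sum_l invmx (g u) i l * riemann u (E i) y z (E l).

Definition scalar (u : 'cV[R]_m) : R :=
  \sum_i \sum_k invmx (g u) i k * ricci u (E i) (E k).

Definition orthonormal_basis (u : 'cV[R]_m) (e : 'I_m -> 'cV[R]_m) : Prop :=
  forall i j, bil (g u) (e i) (e j) = (i == j)%:R.

Definition breve_riemann (u : 'cV[R]_m) (e : 'I_m -> 'cV[R]_m)
    (x y : 'cV[R]_m) : R :=
  \sum_i \sum_j \sum_k
    riemann u x (e i) (e j) (e k) * riemann u y (e i) (e j) (e k).

Definition riemann_norm2 (u : 'cV[R]_m) (e : 'I_m -> 'cV[R]_m) : R :=
  \sum_i \sum_j \sum_k \sum_l riemann u (e i) (e j) (e k) (e l) ^+ 2.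

End Curvature.

Section RiemannianManifolds.
Variables (R : realType) (m : nat) (M : smooth_manifold R m).
Variable g : components M 'M[R]_m.

(* The value at p, computed in any chart i around p. *)
Definition scalar_curvature (i : chart_idx M) (p : M) : R :=
  scalar (g i) (chart i p).

Definition weakly_einstein : Prop :=
  forall i u, chart_cod i u ->
  forall e, orthonormal_basis (g i) u e ->
  forall x y : 'cV[R]_m,
    breve_riemann (g i) u e x y =
    riemann_norm2 (g i) u e / m%:R * bil (g i u) x y.

Definition einstein : Prop :=
  exists lambda : R, forall i u, chart_cod i u -> forall x y : 'cV[R]_m,
    ricci (g i) u x y = lambda * bil (g i u) x y.

(* Locally conformal to a flat metric; unlike vanishing of the Weyl tensor, this
   is the right notion in dimension 3 as well. *)
Definition conformally_flat : Prop :=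
  forall p : M, exists (i : chart_idx M) (W : set 'cV[R]_m)
                       (f : 'cV[R]_m -> R),
    [/\ chart_dom i p, open W /\ W (chart i p), W `<=` chart_cod i,
        smooth_on W f /\ (forall u, W u -> 0 < f u) &
        forall u, W u -> forall x y z w : 'cV[R]_m,
          riemann (fun v => f v *: g i v) u x y z w = 0].

End RiemannianManifolds.

Section ContactStructures.
Variables (R : realType) (m : nat) (M : smooth_manifold R m).
Variables (phi : components M 'M[R]_m) (xi : components M 'cV[R]_m).
Variables (eta : components M 'rV[R]_m) (g : components M 'M[R]_m).

Definition almost_contact_metric : Prop :=
  [/\ is_endomorphism_field phi, is_vector_field xi, is_one_form eta,
      is_riemannian_metric g &
      forall i u, chart_cod i u ->
      [/\ phi i u *m phi i u = - 1%:M + xi i u *m eta i u,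
          eta i u *m phi i u = 0,
          phi i u *m xi i u = 0,
          bil (g i u) (xi i u) (xi i u) = 1 &
          forall x y : 'cV[R]_m,
            bil (g i u) (phi i u *m x) (phi i u *m y) =
              bil (g i u) x y - (eta i u *m x) 0 0 * (eta i u *m y) 0 0 /\
            bil (g i u) x (xi i u) = (eta i u *m x) 0 0]].

Definition exterior_derivative (a : 'cV[R]_m -> 'rV[R]_m)
    (X Y : 'cV[R]_m -> 'cV[R]_m) (u : 'cV[R]_m) : R :=
  2^-1 * ('D_(X u) (fun v => (a v *m Y v) 0 0) u
          - 'D_(Y u) (fun v => (a v *m X v) 0 0) u
          - (a u *m lie_bracket X Y u) 0 0).

Definition contact_metric : Prop :=
  almost_contact_metric /\
  forall i (X Y : 'cV[R]_m -> 'cV[R]_m),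
    smooth_on (chart_cod i) X -> smooth_on (chart_cod i) Y ->
    forall u, chart_cod i u ->
      exterior_derivative (eta i) X Y u = bil (g i u) (X u) (phi i u *m Y u).

(* [chart_cod i `*` setT] is the image of the chart of M x R induced by i, and
   (x, f) stands for the tangent vector x + f d/dt. *)
Definition product_J (i : chart_idx M) (q : 'cV[R]_m * R)
    (Z : 'cV[R]_m * R) : 'cV[R]_m * R :=
  (phi i q.1 *m Z.1 - Z.2 *: xi i q.1, (eta i q.1 *m Z.1) 0 0).

(* Integrability of J is the vanishing of its Nijenhuis torsion [J, J]. *)
Definition normal_structure : Prop :=
  forall i (X Y : 'cV[R]_m * R -> 'cV[R]_m * R),
    let U := chart_cod i `*` [set: R] in
    let J Z := fun q => product_J i q (Z q) in
    smooth_on U X -> smooth_on U Y ->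
    forall q, U q ->
      J (J (lie_bracket X Y)) q + lie_bracket (J X) (J Y) q
      - J (lie_bracket (J X) Y) q - J (lie_bracket X (J Y)) q = 0.

Definition sasakian : Prop := contact_metric /\ normal_structure.

End ContactStructures.

(* Main.v *)
Require Import Defs.
From HB Require Import structures.
From mathcomp Require Import all_boot all_order all_algebra.
From mathcomp Require Import all_classical all_reals all_analysis.
From mathcomp Require Import ring lra.

Set Implicit Arguments.
Unset Strict Implicit.
Unset Printing Implicit Defensive.

Import Order.TTheory GRing.Theory Num.Theory.
Import numFieldNormedType.Exports.
Local Open Scope classical_set_scope.
Local Open Scope ring_scope.

(* On a Sasakian manifold nabla xi = - phi and
   (nabla_X phi) Y = g(X, Y) xi - eta(Y) X, hence
   R(xi, X) Y = g(X, Y) xi - eta(Y) X.  The weakly Einstein equation at (xi, xi)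
   then forces |R|^2 = 2 m (m - 1) with m = 2n + 1, the value on the unit
     sphere.
   If R1 is the curvature tensor of the unit sphere, |R - c R1|^2 =
   |R|^2 - 4 c s + 2 c^2 m (m - 1) is nonnegative for c = 1 and c = -1, so that
   |s| <= m (m - 1); for n >= 2 this is stronger than the stated lower bound.
   If s = m (m - 1), the case c = 1 shows that g has constant curvature 1.  Then
   the cone connection on TM + R is flat; a local parallel section (V, h) with
   V = 0 and h = 1 at a point satisfies grad h = V, Hess h = - h g and
   h^2 + |V|^2 = 1, and (1 + h)^-2 g is flat.  Parallel sections of a flat
   connection are obtained as limits of products of approximate transports along
   dyadic subdivisions of segments.  Conversely, for an Einstein metric
   Ric(xi, xi) = m - 1 determines the Einstein constant. *)

(** * Directional derivatives and functions of class C^k *)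

(** The data are smooth only in the sense of directional derivatives in charts, so linearity of the
    derivative in the direction and symmetry of second derivatives have to be recovered first; both
    come from the mean value theorem. Conformal flatness asks for an actual flat metric, so a
    differential system has to be integrated, and the theory of flat connections serves this
    purpose. On the unit sphere the solution with [h = 1] and gradient 0 at [p] is the cosine of the
    distance to [p], and [(1 + h)^-2 g] is the Euclidean metric read through stereographic
    projection from the antipode of [p]. The bounds on [s] amount to the Cauchy-Schwarz inequality
    between the curvature tensor and that of the unit sphere: the two have equal norms, so the
    extreme value forces equality of the tensors. *)

Section MatrixDerivatives.
Context {R : realType} {E : normedModType R}.

Lemma is_derive_mxP (m n : nat) (F : E -> 'M[R]_(m, n)) (x v : E)
    (dF : 'M[R]_(m, n)) :
  is_derive x v F dF <->
  forall i j, is_derive x v (fun y => F y i j) (dF i j).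
Proof.
split=> [[Fx FE] i j|Fx].
  split; first by move/derivable_mxP: Fx.
  by rewrite -FE derive_mx// mxE.
have dFx : derivable F x v by apply/derivable_mxP => i j; exact: ex_derive.
by split=> //; rewrite derive_mx//; apply/matrixP => i j; rewrite mxE
  derive_val.
Qed.

Lemma is_derive_fun_eq (W : normedModType R) (f g : E -> W) (x v : E) (df : W) :
  f =1 g -> is_derive x v f df -> is_derive x v g df.
Proof. by move=> /funext ->. Qed.

Lemma is_derive_fun_sum (I : Type) (r : seq I) (P : pred I)
    (W : normedModType R) (f : I -> E -> W) (df : I -> W) (x v : E) :
  (forall i, is_derive x v (f i) (df i)) ->
  is_derive x v (fun y => \sum_(i <- r | P i) f i y) (\sum_(i <- r | P i) df i).
Proof.
move=> fE; elim: r => [|a r IH].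
  rewrite big_nil; apply: is_derive_fun_eq (is_derive_cst 0 x v).
  by move=> y; rewrite big_nil.
rewrite big_cons; case: ifP => Pa.
  apply: is_derive_fun_eq (is_deriveD (fE a) IH) => y.
  by rewrite big_cons Pa.
by apply: is_derive_fun_eq IH => y; rewrite big_cons Pa.
Qed.

Lemma is_derive_mul (f g : E -> R) (x v : E) (df dg : R) :
  is_derive x v f df -> is_derive x v g dg ->
  is_derive x v (fun y => f y * g y) (df * g x + f x * dg).
Proof.
move=> fE gE.
have fgE : is_derive x v (fun y => f y * g y) _ := is_deriveM fE gE.
by apply: (is_derive_eq fgE); rewrite addrC [df * _]mulrC.
Qed.

Lemma is_derive_mulmx (m n p : nat) (F : E -> 'M[R]_(m, n))
    (G : E -> 'M[R]_(n, p)) (x v : E) dF dG :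
  is_derive x v F dF -> is_derive x v G dG ->
  is_derive x v (fun y => F y *m G y) (dF *m G x + F x *m dG).
Proof.
move=> /is_derive_mxP FE /is_derive_mxP GE; apply/is_derive_mxP => i j.
rewrite !mxE -big_split /=.
apply: (@is_derive_fun_eq _ (fun y => \sum_k F y i k * G y k j)).
  by move=> y; rewrite mxE.
by apply: is_derive_fun_sum => k; exact: is_derive_mul.
Qed.

Lemma is_derive_add (W : normedModType R) (f g : E -> W) (x v : E) df dg :
  is_derive x v f df -> is_derive x v g dg ->
  is_derive x v (fun y => f y + g y) (df + dg).
Proof. exact: is_deriveD. Qed.

Lemma is_derive_opp (W : normedModType R) (f : E -> W) (x v : E) df :
  is_derive x v f df -> is_derive x v (fun y => - f y) (- df).
Proof. exact: is_deriveN. Qed.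

Lemma is_derive_sub (W : normedModType R) (f g : E -> W) (x v : E) df dg :
  is_derive x v f df -> is_derive x v g dg ->
  is_derive x v (fun y => f y - g y) (df - dg).
Proof. exact: is_deriveB. Qed.

Lemma is_derive_const (W : normedModType R) (a : W) (x v : E) :
  is_derive x v (fun=> a) 0.
Proof. exact: is_derive_cst. Qed.

Lemma is_derive_trmx (m n : nat) (F : E -> 'M[R]_(m, n)) (x v : E) dF :
  is_derive x v F dF -> is_derive x v (fun y => (F y)^T) dF^T.
Proof.
move=> /is_derive_mxP FE; apply/is_derive_mxP => i j; rewrite mxE.
by apply: is_derive_fun_eq (FE j i) => y; rewrite mxE.
Qed.

Lemma is_derive_scale (m n : nat) (f : E -> R) (F : E -> 'M[R]_(m, n))
    (x v : E) df dF :
  is_derive x v f df -> is_derive x v F dF ->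
  is_derive x v (fun y => f y *: F y) (df *: F x + f x *: dF).
Proof.
move=> fE /is_derive_mxP FE; apply/is_derive_mxP => i j; rewrite !mxE.
by apply: is_derive_fun_eq (is_derive_mul fE (FE i j)) => y; rewrite mxE.
Qed.

Lemma is_derive_inv (f : E -> R) (x v : E) df :
  f x != 0 -> is_derive x v f df ->
  is_derive x v (fun y => (f y)^-1) (- (f x) ^- 2 * df).
Proof.
move=> fx [fd fE]; split; first exact: derivableV.
by rewrite deriveV// fE.
Qed.

(** Substitution of [c * h] for the increment in the difference quotient; it respects punctured
    neighbourhoods of 0 when [c != 0], so [c = 0] is treated apart. *)
Lemma is_derive_scale_dir (W : normedModType R) (f : E -> W) (x v : E) (c : R)
  df :
  is_derive x v f df -> is_derive x (c *: v) f (c *: df).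
Proof.
move=> [fd fE]; have [->|c0] := eqVneq c 0.
  by rewrite !scale0r; exact: is_derive0.
have lim : h^-1 *: (f (h *: (c *: v) + x) - f x) @[h --> 0^'] --> c *: df.
  have cv : (c * h : R) @[h --> 0^'] --> 0^'.
    move=> A [e /= e0 Ae].
    exists (e / `|c|) => /=; first by rewrite divr_gt0 ?normr_gt0.
    move=> h /=; rewrite sub0r normrN ltr_pdivlMr ?normr_gt0// => he h0.
    apply: Ae => /=; last by rewrite mulf_neq0.
    by rewrite sub0r normrN normrM mulrC.
  have fdl : k^-1 *: (f (k *: v + x) - f x) @[k --> 0^'] --> df.
    by rewrite -fE; exact: fd.
  have fdc := cvg_comp (fun h => c * h) _ cv fdl.
  apply: cvg_trans (cvgZl_tmp (k := c) fdc); apply: near_eq_cvg; apply: nearW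
    => h /=.
  by rewrite invfM !scalerA mulrA mulfV// mul1r mulrC.
split; first by apply/cvg_ex; exists (c *: df).
exact/cvg_lim.
Qed.

End MatrixDerivatives.

(** * Mean value theorem and symmetry of mixed derivatives *)

Section DirectionalCalculus.
Context {R : realType} {E : normedModType R}.

Lemma nbhs_normBP (P : set E) (x : E) :
  nbhs x P <-> exists2 d : R, 0 < d & forall y, `|y - x| < d -> P y.
Proof.
split=> [/nbhs_normP[d /= d0 dP]|[d d0 dP]].
  by exists d => // y yd; apply: dP; rewrite /= distrC.
by apply/nbhs_normP; exists d => // y /=; rewrite distrC; exact: dP.
Qed.

Lemma continuous_normBP (W : normedModType R) (f : E -> W) (x : E) :
  {for x, continuous f} <->
  forall e : R, 0 < e -> exists2 d : R, 0 < d &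
    forall y, `|y - x| < d -> `|f y - f x| < e.
Proof.
split=> [/cvgrPdist_lt fx e e0|fx].
  have /nbhs_normBP[d d0 dP] := fx e e0.
  by exists d => // y /dP; rewrite distrC.
apply/cvgrPdist_lt => e e0; apply/nbhs_normBP.
have [d d0 dP] := fx e e0.
by exists d => // y /dP; rewrite distrC.
Qed.

Lemma is_derive_line (W : normedModType R) (f : E -> W) (a v : E) (t : R) d :
  is_derive (a + t *: v) v f d -> is_derive t 1 (fun s => f (a + s *: v)) d.
Proof.
have eqf : (fun h => h^-1 *: (f (a + (h *: 1 + t) *: v) - f (a + t *: v))) =
           (fun h => h^-1 *: (f (h *: v + (a + t *: v)) - f (a + t *: v))).
  apply/funext => h; congr (_ *: (f _ - _)).
  by rewrite scalerDl [h *: 1]mulr1 addrCA.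
move=> [fd fE]; split; first by rewrite /derivable /= eqf.
by rewrite /derive /= eqf.
Qed.

Lemma is_derive_translate (W : normedModType R) (f : E -> W) (x v y : E) d :
  is_derive (x + y) v f d -> is_derive x v (fun z => f (z + y)) d.
Proof.
have eqf : (fun h => h^-1 *: (f (h *: v + x + y) - f (x + y))) =
           (fun h => h^-1 *: (f (h *: v + (x + y)) - f (x + y))).
  by apply/funext => h; rewrite addrA.
move=> [fd fE]; split; first by rewrite /derivable /= eqf.
by rewrite /derive /= eqf.
Qed.

Lemma mvt_line (f g : E -> R) (a v : E) :
  (forall t : R, 0 <= t <= 1 -> is_derive (a + t *: v) v f (g (a + t *: v))) ->
  exists2 t : R, 0 <= t <= 1 & f (a + v) - f a = g (a + t *: v).
Proof.
move=> fg.
have fgt (t : R) : 0 <= t <= 1 ->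
    is_derive t 1 (fun s => f (a + s *: v)) (g (a + t *: v)).
  by move=> /fg; exact: is_derive_line.
have [||t t01 ft] := @MVT R (fun s => f (a + s *: v))
    (fun t => g (a + t *: v)) 0 1 ltr01.
- by move=> t; rewrite in_itv /= => /andP[t0 t1]; apply: fgt; rewrite !ltW.
- apply: derivable_within_continuous => t; rewrite in_itv /= => /fgt ?.
  exact: ex_derive.
exists t; first by move: t01; rewrite in_itv /= => /andP[t0 t1]; rewrite !ltW.
by move: ft; rewrite scale1r scale0r addr0 subr0 mulr1.
Qed.

Lemma dist_line_le (x v : E) (h t : R) : 0 <= t <= 1 ->
  `|t *: (h *: v)| <= `|h| * `|v|.
Proof.
move=> /andP[t0 t1]; rewrite !normrZ (ger0_norm t0).
by rewrite ler_piMl// mulr_ge0.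
Qed.

(** [Ck_on] speaks of one direction at a time, so additivity in the direction needs a proof. The
    increment along [h (v + w)] is split at [x + h v]: the first part gives the derivative along
    [v]; by the mean value theorem the second is [h] times [g] at a nearby point, and continuity of
    [g] at [x] concludes. *)
Lemma is_derive_addv (f g : E -> R) (x v w : E) (d : R) :
  (\forall y \near x, is_derive y w f (g y)) -> {for x, continuous g} ->
  is_derive x v f d -> is_derive x (v + w) f (d + g x).
Proof.
move=> /nbhs_normBP[r r0 fg] /continuous_normBP gx [fd fE].
have lim : h^-1 *: (f (h *: (v + w) + x) - f x) @[h --> 0^'] --> d + g x.
  have fdl : h^-1 *: (f (h *: v + x) - f x) @[h --> 0^'] --> d.
    by rewrite -fE; exact: fd.
  have gl : h^-1 *: (f (h *: v + x + h *: w) - f (h *: v + x)) @[h --> 0^']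
      --> g x.
    apply/cvgrPdist_lt => e e0.
    have [s s0 gs] := gx e e0.
    pose m := Num.min r s / (`|v| + `|w| + 1).
    have den0 : 0 < `|v| + `|w| + 1 by rewrite ltr_wpDl ?addr_ge0.
    have m0 : 0 < m by rewrite divr_gt0// lt_min r0 s0.
    exists m => // h /=; rewrite sub0r normrN => hm h0.
    have hb (t : R) : 0 <= t <= 1 ->
        `|h *: v + x + t *: (h *: w) - x| < Num.min r s.
      move=> t01; rewrite addrAC addrK.
      apply: le_lt_trans (ler_normD _ _) _; rewrite normrZ.
      apply: le_lt_trans (lerD (lexx _) (dist_line_le x w h t01)) _.
      rewrite -mulrDr; move: hm; rewrite ltr_pdivlMr//; apply: le_lt_trans.
      by rewrite ler_wpM2l// lerDl.
    have [t t01 ft] : exists2 t : R, 0 <= t <= 1 &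
        f (h *: v + x + h *: w) - f (h *: v + x) =
        h * g (h *: v + x + t *: (h *: w)).
      apply: (@mvt_line f (fun y => h * g y)) => t t01.
      apply: is_derive_scale_dir; apply: fg.
      by have := hb t t01; rewrite lt_min => /andP[].
    rewrite ft [_ *: _]mulKf// distrC; apply: gs.
    by have := hb t t01; rewrite lt_min => /andP[].
  apply: cvg_trans (cvgD fdl gl); apply: near_eq_cvg; apply: nearW => h /=.
  rewrite -[LHS]/(_ *: _ + _ *: _) -scalerDr; congr (_ *: _).
  by rewrite addrC addrA subrK scalerDr addrAC.
split; first by apply/cvg_ex; exists (d + g x).
exact/cvg_lim.
Qed.

(** The second difference of [f] over the parallelogram with sides [h v] and [h w] is [h^2 fvw] at
    one point and [h^2 fwv] at another, by the mean value theorem used twice in either order.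
    Continuity brings both values close to those at [x]. *)
Lemma derive_comm (f fv fw fvw fwv : E -> R) (x v w : E) :
  (\forall y \near x, [/\ is_derive y v f (fv y), is_derive y w f (fw y),
     is_derive y w fv (fvw y) & is_derive y v fw (fwv y)]) ->
  {for x, continuous fvw} -> {for x, continuous fwv} -> fvw x = fwv x.
Proof.
move=> /nbhs_normBP[r r0 fd] /continuous_normBP cvw /continuous_normBP cwv.
apply/eqP; rewrite -subr_eq0 -normr_le0; apply/ler_addgt0Pl => e e0.
rewrite addr0.
have e20 : 0 < e / 2 by rewrite divr_gt0.
have [s1 s10 fs1] := cvw _ e20.
have [s2 s20 fs2] := cwv _ e20.
pose m := Num.min r (Num.min s1 s2).
have m0 : 0 < m by rewrite !lt_min r0 s10 s20.
have den0 : 0 < `|v| + `|w| + 1 by rewrite ltr_wpDl ?addr_ge0.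
(* The size is chosen so that the whole parallelogram lies within [m] of [x]. *)
pose h := m / (`|v| + `|w| + 1) / 2.
have h0 : 0 < h by rewrite !divr_gt0.
have hb (s t : R) : 0 <= s <= 1 -> 0 <= t <= 1 ->
    `|x + s *: (h *: v) + t *: (h *: w) - x| < m.
  move=> s01 t01; rewrite -(addrA x) (addrC x) addrK.
  apply: le_lt_trans (ler_normD _ _) _.
  apply: le_lt_trans (lerD (dist_line_le x v h s01) (dist_line_le x w h t01)) _.
  rewrite -mulrDr (gtr0_norm h0).
  apply: (@le_lt_trans _ _ (h * (`|v| + `|w| + 1))).
    by apply: ler_wpM2l; [exact: ltW | rewrite lerDl].
  by rewrite /h mulrAC divfK ?lt0r_neq0// ltr_pdivrMr// ltr_pMr// ltr1n.
(* Mean value theorem in direction [a] for the difference of the translates of [f] by [h b] and by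
   0, then in direction [b] for [fa]. *)
have step (a b : E) (fa fab : E -> R) :
    (forall s t : R, 0 <= s <= 1 -> 0 <= t <= 1 ->
      is_derive (x + s *: (h *: a) + t *: (h *: b)) a f
        (fa (x + s *: (h *: a) + t *: (h *: b))) /\
      is_derive (x + s *: (h *: a) + t *: (h *: b)) b fa
        (fab (x + s *: (h *: a) + t *: (h *: b)))) ->
    exists s t : R, [/\ 0 <= s <= 1, 0 <= t <= 1 &
      f (x + h *: a + h *: b) - f (x + h *: a) - (f (x + h *: b) - f x) =
      h * (h * fab (x + s *: (h *: a) + t *: (h *: b)))].
  move=> fab_d.
  have shift_d (t : R) y : 0 <= t <= 1 -> is_derive (x + t *: (h *: a) + y) a f
        (fa (x + t *: (h *: a) + y)) ->
      is_derive (x + t *: (h *: a)) (h *: a) (fun z => f (z + y))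
        (h * fa (x + t *: (h *: a) + y)).
    by move=> t01 fad; apply: is_derive_scale_dir; exact: is_derive_translate.
  have i0 : (0 <= 0 :> R) && (0 <= 1 :> R) by rewrite lexx ler01.
  have i1 : (0 <= 1 :> R) && (1 <= 1 :> R) by rewrite lexx ler01.
  have [s s01 fs] : exists2 s : R, 0 <= s <= 1 &
      (f (x + h *: a + h *: b) - f (x + h *: a)) - (f (x + h *: b) - f x) =
      h * (fa (x + s *: (h *: a) + h *: b) - fa (x + s *: (h *: a))).
    apply: (@mvt_line (fun z => f (z + h *: b) - f z)
      (fun z => h * (fa (z + h *: b) - fa z))) => t t01.
    rewrite mulrBr; apply: is_derive_sub.
      apply: shift_d => //.
      by have := (fab_d t 1 t01 i1).1; rewrite scale1r.
    apply: is_derive_scale_dir.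
    by have := (fab_d t 0 t01 i0).1; rewrite scale0r addr0.
  have [t t01 ft] : exists2 t : R, 0 <= t <= 1 &
      fa (x + s *: (h *: a) + h *: b) - fa (x + s *: (h *: a)) =
      h * fab (x + s *: (h *: a) + t *: (h *: b)).
    apply: (@mvt_line fa (fun z => h * fab z)) => t t01.
    by apply: is_derive_scale_dir; exact: (fab_d s t s01 t01).2.
  by exists s, t; split=> //; rewrite fs ft.
have [|s [t [s01 t01 E1]]] := step v w fv fvw.
  move=> s t s01 t01; have := hb s t s01 t01; rewrite lt_min => /andP[ltr _].
  by have [] := fd _ ltr.
have [|t' [s' [t'01 s'01 E2]]] := step w v fw fwv.
  move=> s' t' s'01 t'01; have := hb t' s' t'01 s'01.
  rewrite (addrAC x) lt_min => /andP[ltr _].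
  by have [] := fd _ ltr.
have E3 : fvw (x + s *: (h *: v) + t *: (h *: w)) =
          fwv (x + t' *: (h *: w) + s' *: (h *: v)).
  apply: (mulfI (lt0r_neq0 h0)); apply: (mulfI (lt0r_neq0 h0)).
  rewrite -E1 -E2 (addrAC x); set A := f _; set B := f _; set C := f _.
  by set D := f _; ring.
have B1 : `|fvw (x + s *: (h *: v) + t *: (h *: w)) - fvw x| < e / 2.
  by apply: fs1; have := hb s t s01 t01; rewrite !lt_min => /and3P[].
have B2 : `|fwv (x + t' *: (h *: w) + s' *: (h *: v)) - fwv x| < e / 2.
  by apply: fs2; rewrite (addrAC x); have := hb s' t' s'01 t'01;
     rewrite !lt_min => /and3P[].
rewrite (_ : fvw x - fwv x =
  (fwv (x + t' *: (h *: w) + s' *: (h *: v)) - fwv x) -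
  (fvw (x + s *: (h *: v) + t *: (h *: w)) - fvw x)); last by rewrite E3; ring.
apply: le_trans (ler_normB _ _) _; rewrite [e]splitr lerD// ltW//.
Qed.

End DirectionalCalculus.

(** * Calculus of C^k maps *)

Section Ck.
Context {R : realType} {E : normedModType R}.
Implicit Types (U : set E) (k : nat).

Lemma le_mx_norm (m n : nat) (F : 'M[R]_(m, n)) i j : `|F i j| <= `|F|.
Proof.
rewrite [leRHS]/Num.Def.normr /= mx_normrE.
exact: (le_bigmax _ (fun ij => `|F ij.1 ij.2|) (i, j)).
Qed.

Lemma mx_norm_le (m n : nat) (F : 'M[R]_(m, n)) e : 0 <= e ->
  (forall i j, `|F i j| <= e) -> `|F| <= e.
Proof.
move=> e0 Fe; rewrite [leLHS]/Num.Def.normr /= mx_normrE.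
by apply: bigmax_le => // -[i j] _; exact: Fe.
Qed.

Lemma continuous_mxP (m n : nat) (F : E -> 'M[R]_(m, n)) x :
  {for x, continuous F} <-> forall i j, {for x, continuous (fun y => F y i j)}.
Proof.
split=> [/continuous_normBP Fx i j|Fx].
  apply/continuous_normBP => e /Fx[d d0 dP]; exists d => // y /dP.
  by apply: le_lt_trans; have := le_mx_norm (F y - F x) i j; rewrite !mxE.
apply/cvgrPdist_le => e e0.
have Fe : \forall y \near x, forall ij : 'I_m * 'I_n,
    `|F x ij.1 ij.2 - F y ij.1 ij.2| <= e.
  by apply: filter_forall => -[i j]; move/cvgrPdist_le : (Fx i j) => /(_ e e0).
apply: filterS Fe => y Fe; apply: mx_norm_le (ltW e0) _ => i j.
by rewrite !mxE; exact: (Fe (i, j)).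
Qed.

Lemma near_eq_continuous (V : normedModType R) (f g : E -> V) x :
  (\forall y \near x, f y = g y) ->
  {for x, continuous f} -> {for x, continuous g}.
Proof.
move=> fg fx; have fgx := nbhs_singleton fg.
have gx : f y @[y --> x] --> g x by rewrite -fgx.
by apply: cvg_trans gx; apply: near_eq_cvg; apply: filterS fg.
Qed.

Lemma Ck_on_ext k U (V : normedModType R) (f g : E -> V) : open U ->
  (forall x, U x -> f x = g x) -> Ck_on k U f -> Ck_on k U g.
Proof.
move=> oU; elim: k f g => [|k IH] f g fg /= [fc fd];
  have fgx x : U x -> \forall y \near x, f y = g y
    by move=> Ux; apply: filterS (open_nbhs_nbhs (conj oU Ux)).
  by split=> // x Ux; exact: near_eq_continuous (fgx x Ux) (fc x Ux).
split=> [x Ux|v]; first exact: near_eq_continuous (fgx x Ux) (fc x Ux).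
have [fdv fC] := fd v; split=> [x Ux|].
  exact: near_eq_derivable (fgx x Ux) (fdv x Ux).
by apply: IH fC => x Ux; exact/near_eq_derive/fgx.
Qed.

Lemma Ck_onS k U (V : normedModType R) (f : E -> V) :
  Ck_on k.+1 U f -> Ck_on k U f.
Proof.
elim: k f => [|k IH] f /= [fc fd]; first by split.
by split=> // v; have [fdv fC] := fd v; split=> //; exact: IH.
Qed.

Lemma Ck_on_sub k U U' (V : normedModType R) (f : E -> V) :
  U' `<=` U -> Ck_on k U f -> Ck_on k U' f.
Proof.
move=> sU; elim: k f => [|k IH] f /= [fc fd].
  by split=> // x /sU; exact: fc.
split=> [x /sU|v]; first exact: fc.
by have [fdv fC] := fd v; split=> [x /sU|]; [exact: fdv|exact: IH].
Qed.

Lemma Ck_on_mxP k U (m n : nat) (F : E -> 'M[R]_(m, n)) : open U ->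
  Ck_on k U F <-> forall i j, Ck_on k U (fun x => F x i j).
Proof.
move=> oU; elim: k F => [|k IH] F.
  split=> [[Fc _] i j|FC]; first by split=> // x /Fc/continuous_mxP.
  by split=> // x Ux; apply/continuous_mxP => i j; exact: (FC i j).1.
split=> [[Fc Fd] i j|FC].
  split=> [x /Fc/continuous_mxP//|v].
  have [Fdv FC] := Fd v; split=> [x Ux|].
    by have /derivable_mxP := Fdv x Ux.
  apply: (@Ck_on_ext k U _ (fun x => 'D_v F x i j)) => //.
    by move=> x Ux; rewrite derive_mx ?mxE//; exact: Fdv.
  by have /IH := FC.
have Fdv v x : U x -> derivable F x v.
  by move=> Ux; apply/derivable_mxP => i j; exact: ((FC i j).2 v).1.
split=> [x Ux|v]; first by apply/continuous_mxP => i j; exact: (FC i j).1.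
split=> [x Ux|]; first exact: Fdv.
apply/IH => i j; apply: (@Ck_on_ext k U _ ('D_v (fun x => F x i j))) => //.
  by move=> x Ux; rewrite derive_mx ?mxE//; exact: Fdv.
exact: ((FC i j).2 v).2.
Qed.

Lemma Ck_on_cst k U (V : normedModType R) (a : V) : Ck_on k U (fun=> a).
Proof.
elim: k a => [|k IH] a; first by split=> // x _; exact: cst_continuous.
split=> [x _|v]; first exact: cst_continuous.
split=> [x _|]; first exact: derivable_cst.
have -> : (fun x => 'D_v (fun=> a) x) = (fun=> 0 : V); last exact: IH.
by apply/funext => x; exact: derive_cst.
Qed.

Lemma Ck_on_derivable k U (V : normedModType R) (f : E -> V) x v :
  Ck_on k.+1 U f -> U x -> is_derive x v f ('D_v f x).
Proof. by move=> [_ /(_ v)[fd _]] Ux; apply: derivableP; exact: fd. Qed.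

Lemma Ck_on_add k U (V : normedModType R) (f g : E -> V) : open U ->
  Ck_on k U f -> Ck_on k U g -> Ck_on k U (fun x => f x + g x).
Proof.
move=> oU; elim: k f g => [|k IH] f g fC gC.
  by split=> // x Ux; apply: cvgD; [exact: fC.1|exact: gC.1].
split=> [x Ux|v]; first by apply: cvgD; [exact: fC.1|exact: gC.1].
have D x : U x -> is_derive x v (fun x => f x + g x) ('D_v f x + 'D_v g x).
  by move=> Ux; apply: is_derive_add; [exact: (Ck_on_derivable v fC)|exact:
    (Ck_on_derivable v gC)].
split=> [x Ux|]; first by case: (D x Ux).
apply: (@Ck_on_ext k U _ (fun x => 'D_v f x + 'D_v g x)) => // [x Ux|].
  by case: (D x Ux) => _ ->.
by apply: IH; [exact: (fC.2 v).2|exact: (gC.2 v).2].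
Qed.

Lemma Ck_on_mul k U (f g : E -> R) : open U ->
  Ck_on k U f -> Ck_on k U g -> Ck_on k U (fun x => f x * g x).
Proof.
move=> oU; elim: k f g => [|k IH] f g fC gC.
  by split=> // x Ux; apply: cvgM; [exact: fC.1|exact: gC.1].
split=> [x Ux|v]; first by apply: cvgM; [exact: fC.1|exact: gC.1].
have D x : U x ->
    is_derive x v (fun x => f x * g x) ('D_v f x * g x + f x * 'D_v g x).
  by move=> Ux; apply: is_derive_mul; [exact: (Ck_on_derivable v fC)|exact:
    (Ck_on_derivable v gC)].
split=> [x Ux|]; first by case: (D x Ux).
apply: (@Ck_on_ext k U _ (fun x => 'D_v f x * g x + f x * 'D_v g x)) => //.
  by move=> x Ux; case: (D x Ux) => _ ->.
apply: Ck_on_add => //; apply: IH.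
- exact: (fC.2 v).2.
- exact: Ck_onS.
- exact: Ck_onS.
- exact: (gC.2 v).2.
Qed.

Lemma Ck_on_opp k U (V : normedModType R) (f : E -> V) : open U ->
  Ck_on k U f -> Ck_on k U (fun x => - f x).
Proof.
move=> oU; elim: k f => [|k IH] f fC.
  by split=> // x Ux; apply: cvgN; exact: fC.1.
split=> [x Ux|v]; first by apply: cvgN; exact: fC.1.
have D x : U x -> is_derive x v (fun x => - f x) (- 'D_v f x).
  by move=> Ux; apply: is_derive_opp; exact: (Ck_on_derivable v fC).
split=> [x Ux|]; first by case: (D x Ux).
apply: (@Ck_on_ext k U _ (fun x => - 'D_v f x)) => // [x Ux|].
  by case: (D x Ux) => _ ->.
by apply: IH; exact: (fC.2 v).2.
Qed.

Lemma Ck_on_inv k U (f : E -> R) : open U -> (forall x, U x -> f x != 0) ->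
  Ck_on k U f -> Ck_on k U (fun x => (f x)^-1).
Proof.
move=> oU f0; elim: k => [|k IH] fC.
  by split=> // x Ux; apply: cvgV; [exact: f0|exact: fC.1].
split=> [x Ux|v]; first by apply: cvgV; [exact: f0|exact: fC.1].
have D x : U x -> is_derive x v (fun x => (f x)^-1) (- (f x) ^- 2 * 'D_v f x).
  by move=> Ux; apply: is_derive_inv; [exact: f0|exact: (Ck_on_derivable v fC)].
split=> [x Ux|]; first by case: (D x Ux).
apply: (@Ck_on_ext k U _ (fun x => - ((f x)^-1 * (f x)^-1) * 'D_v f x)) => //.
  by move=> x Ux; case: (D x Ux) => _ ->; rewrite -exprVn expr2.
have fVC := IH (Ck_onS fC).
apply: Ck_on_mul => //; last exact: (fC.2 v).2.
by apply: Ck_on_opp => //; apply: Ck_on_mul.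
Qed.

Lemma Ck_on_sum k U (V : normedModType R) (I : Type) (r : seq I) (P : pred I)
    (f : I -> E -> V) : open U -> (forall i, Ck_on k U (f i)) ->
  Ck_on k U (fun x => \sum_(i <- r | P i) f i x).
Proof.
move=> oU fC; elim: r => [|a r IH].
  by apply: (@Ck_on_ext k U _ (fun=> 0)) => // [x _|];
     [rewrite big_nil|exact: Ck_on_cst].
case Pa : (P a).
  apply: (@Ck_on_ext k U _ (fun x => f a x + \sum_(i <- r | P i) f i x)) => //.
    by move=> x _; rewrite big_cons Pa.
  exact: Ck_on_add.
by apply: Ck_on_ext IH => // x _; rewrite big_cons Pa.
Qed.

Lemma Ck_on_prod k U (I : Type) (r : seq I) (P : pred I)
    (f : I -> E -> R) : open U -> (forall i, Ck_on k U (f i)) ->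
  Ck_on k U (fun x => \prod_(i <- r | P i) f i x).
Proof.
move=> oU fC; elim: r => [|a r IH].
  by apply: (@Ck_on_ext k U _ (fun=> (1 : R))) => // [x _|];
     [rewrite big_nil|exact: Ck_on_cst].
case Pa : (P a).
  apply: (@Ck_on_ext k U _ (fun x => f a x * \prod_(i <- r | P i) f i x)) => //.
    by move=> x _; rewrite big_cons Pa.
  exact: Ck_on_mul.
by apply: Ck_on_ext IH => // x _; rewrite big_cons Pa.
Qed.

Lemma Ck_on_mulmx k U (m n p : nat) (F : E -> 'M[R]_(m, n))
    (G : E -> 'M[R]_(n, p)) : open U ->
  Ck_on k U F -> Ck_on k U G -> Ck_on k U (fun x => F x *m G x).
Proof.
move=> oU /Ck_on_mxP FC /Ck_on_mxP GC; apply/Ck_on_mxP => // i j.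
apply: (@Ck_on_ext k U _ (fun x => \sum_l F x i l * G x l j)) => //.
  by move=> x _; rewrite mxE.
by apply: Ck_on_sum => // l; apply: Ck_on_mul => //; [exact: FC|exact: GC].
Qed.

Lemma Ck_on_scale k U (m n : nat) (f : E -> R) (F : E -> 'M[R]_(m, n)) :
  open U -> Ck_on k U f -> Ck_on k U F -> Ck_on k U (fun x => f x *: F x).
Proof.
move=> oU fC /Ck_on_mxP FC; apply/Ck_on_mxP => // i j.
apply: (@Ck_on_ext k U _ (fun x => f x * F x i j)) => //.
  by move=> x _; rewrite mxE.
by apply: Ck_on_mul => //; exact: FC.
Qed.

Lemma Ck_on_det k U (m : nat) (F : E -> 'M[R]_m) : open U ->
  Ck_on k U F -> Ck_on k U (fun x => \det (F x)).
Proof.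
move=> oU /Ck_on_mxP FC; rewrite /determinant.
apply: Ck_on_sum => // s; apply: Ck_on_mul => //; first exact: Ck_on_cst.
by apply: Ck_on_prod => // i; exact: FC.
Qed.

(** By the adjugate formula the entries of the inverse are rational functions of the entries, with
    denominator the determinant. *)
Lemma Ck_on_invmx k U (m : nat) (F : E -> 'M[R]_m) : open U ->
  (forall x, U x -> F x \in unitmx) ->
  Ck_on k U F -> Ck_on k U (fun x => invmx (F x)).
Proof.
move=> oU Fu FC.
apply: (@Ck_on_ext k U _ (fun x => (\det (F x))^-1 *: \adj (F x))) => //.
  by move=> x Ux; rewrite /invmx Fu.
apply: Ck_on_scale => //.
  apply: Ck_on_inv => //; last exact: Ck_on_det.
  by move=> x Ux; have := Fu x Ux; rewrite unitmxE unitfE.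
apply/Ck_on_mxP => // i j.
apply: (@Ck_on_ext k U _
  (fun x => (-1) ^+ (j + i) * \det (row' j (col' i (F x))))) => //.
  by move=> x _; rewrite mxE.
apply: Ck_on_mul => //; first exact: Ck_on_cst.
apply: Ck_on_det => //; apply/Ck_on_mxP => // a b.
apply: (@Ck_on_ext k U _ (fun x => F x (lift j a) (lift i b))) => //.
  by move=> x _; rewrite !mxE.
by move/Ck_on_mxP : FC; exact.
Qed.

Lemma smooth_onD U (V : normedModType R) (f : E -> V) v :
  smooth_on U f -> smooth_on U ('D_v f).
Proof. by move=> fC k; exact: ((fC k.+1).2 v).2. Qed.

Lemma smooth_on_derivable U (V : normedModType R) (f : E -> V) x v :
  smooth_on U f -> U x -> is_derive x v f ('D_v f x).
Proof. by move=> fC; exact: (Ck_on_derivable v (fC 1%N)). Qed.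

Lemma smooth_on_continuous U (V : normedModType R) (f : E -> V) x :
  smooth_on U f -> U x -> {for x, continuous f}.
Proof. by move=> fC; exact: (fC 0%N).1. Qed.

End Ck.
Section SmoothDerivatives.
Context {R : realType} {E : normedModType R}.
Implicit Types (U : set E).

Lemma smooth_on_ext U (V : normedModType R) (f g : E -> V) : open U ->
  (forall x, U x -> f x = g x) -> smooth_on U f -> smooth_on U g.
Proof. by move=> oU fg fC k; exact: Ck_on_ext fg (fC k). Qed.

Lemma smooth_on_coord U (m n : nat) (F : E -> 'M[R]_(m, n)) i j : open U ->
  smooth_on U F -> smooth_on U (fun x => F x i j).
Proof. by move=> oU FC k; have /Ck_on_mxP := FC k; exact. Qed.

Lemma derive_on_ext U (V : normedModType R) (f g : E -> V) x v : open U ->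
  (forall x, U x -> f x = g x) -> U x -> 'D_v f x = 'D_v g x.
Proof.
move=> oU fg Ux; apply: near_eq_derive.
by apply: filterS (open_nbhs_nbhs (conj oU Ux)).
Qed.

Lemma is_derive_on_ext U (V : normedModType R) (f g : E -> V) x v df : open U ->
  (forall x, U x -> f x = g x) -> U x -> is_derive x v f df ->
  is_derive x v g df.
Proof.
move=> oU fg Ux; apply: near_eq_is_derive.
by apply: filterS (open_nbhs_nbhs (conj oU Ux)).
Qed.

(** Entrywise [is_derive_addv]: continuity of the directional derivatives takes the place of a total
    derivative. *)
Lemma smooth_derive_linear U (m n : nat) (F : E -> 'M[R]_(m, n)) x a v w :
  open U -> smooth_on U F -> U x ->
  'D_(a *: v + w) F x = a *: 'D_v F x + 'D_w F x.
Proof.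
move=> oU FC Ux.
pose d z : 'M[R]_(m, n) := 'D_z F x.
suff [] : is_derive x (a *: v + w) F (a *: d v + d w) by [].
apply/is_derive_mxP => i j.
have fC := smooth_on_coord i j oU FC.
have FE z : d z i j = 'D_z (fun x => F x i j) x.
  by rewrite /d derive_mx ?mxE//; case: (smooth_on_derivable z FC Ux).
rewrite !mxE !FE; set f := fun x => F x i j.
apply: (@is_derive_addv _ _ f ('D_w f)).
- apply: filterS (open_nbhs_nbhs (conj oU Ux)) => y Uy.
  exact: smooth_on_derivable fC Uy.
- exact: smooth_on_continuous (smooth_onD w fC) Ux.
- by apply: is_derive_scale_dir; exact: smooth_on_derivable fC Ux.
Qed.

Lemma smooth_derive_comm U (m n : nat) (F : E -> 'M[R]_(m, n)) x v w :
  open U -> smooth_on U F -> U x ->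
  'D_v ('D_w F) x = 'D_w ('D_v F) x.
Proof.
move=> oU FC Ux; apply/matrixP => i j.
have fC := smooth_on_coord i j oU FC.
have FE z y : U y -> 'D_z F y i j = 'D_z (fun x => F x i j) y.
  by move=> Uy; rewrite derive_mx ?mxE//; case: (smooth_on_derivable z FC Uy).
have FEE z1 z2 : 'D_z1 ('D_z2 F) x i j = 'D_z1 ('D_z2 (fun x => F x i j)) x.
  rewrite derive_mx; last by case: (smooth_on_derivable z1 (smooth_onD z2 FC)
    Ux).
  rewrite mxE.
  apply: (@derive_on_ext U _ (fun y => 'D_z2 F y i j)
    ('D_z2 (fun x => F x i j))) => // y Uy.
  exact: FE.
apply: (etrans (FEE v w)); apply: (etrans _ (esym (FEE w v))); set f := fun x
  => F x i j.
apply: (@derive_comm _ _ f ('D_w f) ('D_v f) ('D_v ('D_w f)) ('D_w ('D_v f)) x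
  w v).
- apply: filterS (open_nbhs_nbhs (conj oU Ux)) => y Uy.
  by split; [| | |]; apply: smooth_on_derivable Uy => //; exact: smooth_onD.
- by apply: smooth_on_continuous Ux; do 2!apply: smooth_onD.
- by apply: smooth_on_continuous Ux; do 2!apply: smooth_onD.
Qed.

Lemma derive_eq0_ball (m n : nat) (F : E -> 'M[R]_(m, n)) x r :
  (forall y v, `|y - x| < r -> is_derive y v F 0) ->
  forall y, `|y - x| < r -> F y = F x.
Proof.
move=> F0 y yr; apply/matrixP => i j; apply/eqP; rewrite -subr_eq0.
have [|t _] := @mvt_line _ _ (fun z => F z i j) (fun=> 0) x (y - x).
  move=> t /andP[t0 t1].
  have /is_derive_mxP/(_ i j) : is_derive (x + t *: (y - x)) (y - x) F 0.
    apply: F0; rewrite addrC addrA addNr add0r normrZ ger0_norm//.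
    by apply: le_lt_trans yr; rewrite ler_piMl.
  by rewrite mxE.
by rewrite (addrC x) subrK => ->.
Qed.

End SmoothDerivatives.

(** * Parallel sections of flat connections *)

Section MatrixNorm.
Context {R : realType} {N : nat}.
Implicit Types X Y : 'M[R]_N.

(* The factor makes the sup norm submultiplicative. *)
Definition submul_norm X : R := N%:R * `|X|.
Local Notation nu := submul_norm.

Lemma submul_norm_ge0 X : 0 <= nu X.
Proof. by rewrite mulr_ge0. Qed.

Lemma submul_normD X Y : nu (X + Y) <= nu X + nu Y.
Proof. by rewrite /nu -mulrDr ler_wpM2l// ler_normD. Qed.

Lemma submul_normN X : nu (- X) = nu X.
Proof. by rewrite /nu normrN. Qed.

Lemma submul_normB X Y : nu (X - Y) <= nu X + nu Y.
Proof. by rewrite -(submul_normN Y) submul_normD. Qed.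

Lemma submul_normZ (c : R) X : nu (c *: X) = `|c| * nu X.
Proof. by rewrite /nu normrZ mulrCA. Qed.

Lemma submul_normM X Y : nu (X *m Y) <= nu X * nu Y.
Proof.
rewrite /nu -mulrA ler_wpM2l// mulrCA; apply: mx_norm_le => [|i j].
  by rewrite !mulr_ge0.
rewrite mxE; apply: le_trans (ler_norm_sum _ _ _) _.
rewrite mulr_natl -[X in _ *+ X]card_ord -sumr_const ler_sum// => k _.
by rewrite normrM ler_pM// le_mx_norm.
Qed.

Lemma submul_norm_le0 X : nu X <= 0 -> X = 0.
Proof.
rewrite /nu; case: N X => [X _|n X]; first by apply/matrixP => -[].
by rewrite pmulr_rle0 ?ltr0n// normr_le0 => /eqP.
Qed.

Lemma submul_norm_mull X Y e : nu (X - 1%:M) <= e - 1 ->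
  nu (X *m Y) <= e * nu Y.
Proof.
move=> Xe; rewrite -(subrK 1%:M X) mulmxDl mul1mx.
apply: le_trans (submul_normD _ _) _.
have := submul_normM (X - 1%:M) Y.
have := ler_wpM2r (submul_norm_ge0 Y) Xe; rewrite mulrBl mul1r; lra.
Qed.

Lemma submul_norm_mulr X Y e : nu (X - 1%:M) <= e - 1 ->
  nu (Y *m X) <= e * nu Y.
Proof.
move=> Xe; rewrite -(subrK 1%:M X) mulmxDr mulmx1.
apply: le_trans (submul_normD _ _) _.
have := submul_normM Y (X - 1%:M).
have := ler_wpM2l (submul_norm_ge0 Y) Xe; rewrite mulrBr mulr1.
by rewrite mulrC; lra.
Qed.

End MatrixNorm.

(** * Geometric convergence *)

Section GeometricLimits.
Context {R : realType}.

Lemma exp2_gt (M : R) : exists k : nat, M < 2 ^+ k.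
Proof.
exists (Num.truncn M).+1; apply: (@lt_trans _ _ (Num.truncn M).+1%:R).
  exact: truncnS_gt.
by rewrite -natrX ltr_nat ltn_expl.
Qed.

Lemma le0_geometric (x M : R) : (forall k : nat, x <= M * 2^-1 ^+ k) -> x <= 0.
Proof.
move=> xM; rewrite leNgt; apply/negP => x0.
have [k Mk] := exp2_gt (M / x).
have := xM k; rewrite exprVn ler_pdivlMr ?exprn_gt0//.
by rewrite leNgt mulrC -ltr_pdivrMr// Mk.
Qed.

Lemma geometric_limit (u : nat -> R) (M : R) :
  (forall k, `|u k.+1 - u k| <= M * 2^-1 ^+ k) ->
  exists l : R, forall k, `|u k - l| <= 2 * M * 2^-1 ^+ k.
Proof.
(* [2 M 2^-k] is the tail of the geometric series from [k] on, which makes [v] nondecreasing and [w]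
   nonincreasing. The limit is the supremum of [v], which lies below every [w k]. *)
move=> uM; pose v k := u k - 2 * M * 2^-1 ^+ k; pose w k := u k + 2 * M * 2^-1
  ^+ k.
have vS k : v k <= v k.+1.
  rewrite /v exprS; have := uM k; rewrite ler_norml => /andP[].
  by set q := 2^-1 ^+ k; lra.
have wS k : w k.+1 <= w k.
  rewrite /w exprS; have := uM k; rewrite ler_norml => /andP[].
  by set q := 2^-1 ^+ k; lra.
have v_mono : nondecreasing_seq v by apply/nondecreasing_seqP.
have w_mono : nonincreasing_seq w by apply/nonincreasing_seqP.
have vw k : v k <= w k.
  have : 0 <= M * 2^-1 ^+ k by apply: le_trans (uM k).
  by rewrite /v /w; set q := 2^-1 ^+ k; lra.
have vjw j k : v j <= w k.
  apply: (@le_trans _ _ (v (maxn j k))); first by apply: v_mono; exact: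
    leq_maxl.
  apply: le_trans (vw _) _; apply: w_mono; exact: leq_maxr.
pose S := [set v k | k in [set: nat]].
have S0 : S !=set0 by exists (v 0%N); exists 0%N.
have Sub k : ubound S (w k) by move=> _ [j _ <-].
have hS : has_sup S by split=> //; exists (w 0%N).
exists (sup S) => k; rewrite ler_norml.
have h1 : v k <= sup S by apply: sup_upper_bound => //; exists k.
have h2 : sup S <= w k by apply: ge_sup.
by move: h1 h2; rewrite /v /w => h1 h2; apply/andP; split; lra.
Qed.

End GeometricLimits.
(* Proves an identity between sums of matrix products, treating each product as
   an atom. *)
Ltac matrix_sum_ring :=
  apply/matrixP => ? ?; repeat match goal with
  | |- context [@mulmx ?R ?m ?n ?p ?A ?B] => move: (@mulmx R m n p A B) => ?
  | |- context [@scalar_mx ?R ?n ?a] => move: (@scalar_mx R n a) => ?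
  end; rewrite !mxE; by field.

(** * Limits of approximate parallel transports *)

Section Frobenius.
Context {R : realType} {E : normedModType R} {N : nat}.
Variables (A : E -> E -> 'M[R]_N) (p : E) (r K : R).
Local Notation nu := (@submul_norm R N).
Hypothesis r0 : 0 < r.
(** Points of the ball are then at distance at most 1, so higher powers of a distance are bounded by
    lower ones. *)
Hypothesis r_le : r <= 2^-1.
Hypothesis K0 : 0 <= K.
Local Notation B x := (`|x - p| < r).
Hypothesis AD : forall h k x, B x -> A (h + k) x = A h x + A k x.
Hypothesis AZ : forall c h x, B x -> A (c *: h) x = c *: A h x.
Hypothesis A_bound : forall h x, B x -> nu (A h x) <= K * `|h|.
Hypothesis A_lip : forall h x y, B x -> B y ->
  nu (A h y - A h x) <= K * `|h| * `|y - x|.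
(** The finite-difference form, with a cubic remainder, of the integrability condition of
    [dY = A Y]: with [h = b - a] and [k = c - b] the sum approximates [D_h A_k - D_k A_h +
    [A_k, A_h]] at [a]. *)
Hypothesis A_flat : forall a b c d, B a -> B b -> B c ->
  `|b - a| <= d -> `|c - b| <= d -> `|c - a| <= d ->
  nu (A (c - b) b - A (c - b) a - (A (b - a) c - A (b - a) b)
      + (A (c - b) a *m A (b - a) a - A (b - a) a *m A (c - b) a))
  <= K * d ^+ 3.

Definition mid (a b : E) : E := 2^-1 *: (a + b).

Lemma midBl a b : mid a b - a = 2^-1 *: (b - a).
Proof.
rewrite /mid -[in X in _ - X](scale1r a) [1 in X in _ - X](splitr 1).
by rewrite mul1r scalerDl -!scalerDr -scalerBr opprD addrACA subrr add0r.
Qed.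

Lemma midBr a b : b - mid a b = 2^-1 *: (b - a).
Proof.
rewrite /mid -[in X in X - _](scale1r b) [1 in X in X - _](splitr 1).
by rewrite mul1r scalerDl -!scalerDr -scalerBr (addrC a) opprD addrACA subrr
  add0r.
Qed.

Lemma midBB a b c : mid c b - mid c a = 2^-1 *: (b - a).
Proof. by rewrite /mid -scalerBr opprD addrACA subrr add0r. Qed.

Lemma midC a b : mid a b = mid b a.
Proof. by rewrite /mid addrC. Qed.

Lemma mid_ball a b : B a -> B b -> B (mid a b).
Proof.
move=> Ba Bb.
have -> : mid a b - p = 2^-1 *: (a - p) + 2^-1 *: (b - p).
  rewrite -scalerDr addrACA -opprD scalerBr; congr (_ - _).
  by rewrite scalerDr -scalerDl -[2^-1]mul1r -splitr scale1r.
apply: le_lt_trans (ler_normD _ _) _; rewrite !normrZ gtr0_norm//.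
by move: Ba Bb; set x := `|_|; set y := `|_|; lra.
Qed.

Lemma norm_half (x : E) : `|2^-1 *: x| = 2^-1 * `|x|.
Proof. by rewrite normrZ gtr0_norm. Qed.

(* Approximates the parallel transport from a to b up to O(|b - a|^3), so that
  by
   flatness it is multiplicative on triangles up to O(d^3). *)
Definition transport0 (a b : E) : 'M[R]_N :=
  1%:M + 2^-1 *: (A (b - a) a + A (b - a) b)
  + 2^-1 *: (A (b - a) a *m A (b - a) a).

Fixpoint transport (k : nat) (a b : E) : 'M[R]_N :=
  if k is k'.+1 then transport k' (mid a b) b *m transport k' a (mid a b)
  else transport0 a b.

Let L := K + K ^+ 2.
Let L0 : 0 <= L. Proof. by rewrite addr_ge0// exprn_ge0. Qed.

Lemma ball_dist a b : B a -> B b -> `|b - a| <= 1.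
Proof.
move=> Ba Bb; rewrite -(subrKA p); apply: le_trans (ler_normD _ _) _.
by rewrite (distrC p); move: Ba Bb r_le; set x := `|_|; set y := `|_|; lra.
Qed.

Lemma transport0_near1 a b : B a -> B b ->
  nu (transport0 a b - 1%:M) <= L * `|b - a|.
Proof.
move=> Ba Bb; rewrite /transport0 -(addrA 1%:M) (addrC 1%:M) addrK.
apply: le_trans (submul_normD _ _) _; rewrite !submul_normZ gtr0_norm//.
have h1 := le_trans (submul_normD _ _)
  (lerD (A_bound (b - a) Ba) (A_bound (b - a) Bb)).
have h2 : nu (A (b - a) a *m A (b - a) a) <= K ^+ 2 * `|b - a|.
  apply: le_trans (submul_normM _ _) _.
  have bb := A_bound (b - a) Ba.
  apply: le_trans (ler_pM (submul_norm_ge0 _) (submul_norm_ge0 _) bb bb) _.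
  rewrite mulrACA expr2 ler_wpM2l ?mulr_ge0// ler_piMr//.
  exact: ball_dist.
have h3 : 0 <= K ^+ 2 * `|b - a| by rewrite mulr_ge0// exprn_ge0.
by rewrite /L mulrDl; lra.
Qed.

(** The form [exp(L d) - 1] is stable under concatenation: each half contributes [exp(L d / 2)] and
    the product is [exp(L d)]. Hence the same bound at every depth [k]. *)
Lemma transport_near1 k a b : B a -> B b ->
  nu (transport k a b - 1%:M) <= expR (L * `|b - a|) - 1.
Proof.
elim: k a b => [|k IH] a b Ba Bb /=.
  apply: le_trans (transport0_near1 Ba Bb) _.
  by rewrite lerBrDl; exact: expR_ge1Dx.
have Bm := mid_ball Ba Bb.
have := IH _ _ Ba Bm; rewrite midBl norm_half.
have := IH _ _ Bm Bb; rewrite midBr norm_half.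
set X := transport k _ _; set Y := transport k _ _ => hX hY.
have -> : expR (L * `|b - a|) =
    expR (L * (2^-1 * `|b - a|)) * expR (L * (2^-1 * `|b - a|)).
  by rewrite -expRD; congr expR; field.
move: hX hY; set e := expR _ => hX hY.
have -> : X *m Y - 1%:M = X *m (Y - 1%:M) + (X - 1%:M).
  by rewrite mulmxBr mulmx1 addrA subrK.
apply: le_trans (submul_normD _ _) _.
have h1 := submul_norm_mull (Y - 1%:M) hX.
have e0 : 0 <= e by rewrite expR_ge0.
have h2 := ler_wpM2l e0 hY.
by lra.
Qed.

(** Majorizes the coefficients [K / 2], [5 K^2 / 2], [K^3] and [K^4 / 4] produced by the nine terms
    of [transport0_defect]. *)
Let C := K + 3 * K ^+ 2 + K ^+ 3 + K ^+ 4.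
Let C0 : 0 <= C.
Proof. by rewrite /C !addr_ge0// ?mulr_ge0// ?exprn_ge0. Qed.

(** Here [a], [a'], [a''] stand for [A] along the first side of a triangle, taken at its three
    vertices, and [b], [b'], [b''] for [A] along the second side. Every term on the right is at
    least cubic in the diameter: half of the flatness expression, products of values of [A] with a
    difference of two values, and products of three or four values. *)
Lemma transport0_defect (a a' a'' b b' b'' : 'M[R]_N) :
  (1%:M + 2^-1 *: (b' + b'') + 2^-1 *: (b' *m b')) *m
  (1%:M + 2^-1 *: (a + a') + 2^-1 *: (a *m a)) -
  (1%:M + 2^-1 *: (b + a + (b'' + a'')) + 2^-1 *: ((b + a) *m (b + a))) =
  2^-1 *: (b' - b - (a'' - a') + (b *m a - a *m b)) +
  2^-1 *: (b' *m (b' - b)) + 2^-1 *: ((b' - b) *m b) +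
  4^-1 *: ((b' - b) *m (a + a')) + 4^-1 *: ((b'' - b) *m (a + a')) +
  2^-1 *: (b *m (a' - a)) + 4^-1 *: ((b' + b'') *m (a *m a)) +
  4^-1 *: ((b' *m b') *m (a + a')) + 4^-1 *: ((b' *m b') *m (a *m a)).
Proof.
rewrite !(mulmxDl, mulmxDr, mulNmx, mulmxN, mul1mx, mulmx1, scalerDr).
rewrite -!(scalemxAl, scalemxAr).
rewrite !mulmxA; matrix_sum_ring.
Qed.

Lemma transport0_triangle a b c d : B a -> B b -> B c ->
  `|b - a| <= d -> `|c - b| <= d -> `|c - a| <= d -> d <= 1 ->
  nu (transport0 b c *m transport0 a b - transport0 a c) <= C * d ^+ 3.
Proof.
move=> Ba Bb Bc h1 h2 h3 d1.
have d0 : 0 <= d by apply: le_trans h1.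
have A_flat' := A_flat Ba Bb Bc h1 h2 h3.
have bound h x : B x -> `|h| <= d -> nu (A h x) <= K * d.
  by move=> Bx hd; apply: le_trans (A_bound h Bx) _; rewrite ler_wpM2l.
have lip h x y : B x -> B y -> `|h| <= d -> `|y - x| <= d ->
    nu (A h y - A h x) <= K * d ^+ 2.
  move=> Bx By hd xyd; apply: le_trans (A_lip h Bx By) _.
  by rewrite -mulrA ler_wpM2l// expr2 ler_pM.
rewrite /transport0 -(subrKA b c (- a)) (AD (c - b) (b - a) Ba) (AD (c - b) (b
  - a) Bc).
have al := bound _ _ Ba h1; have al' := bound _ _ Bb h1.
have be := bound _ _ Ba h2; have be' := bound _ _ Bb h2.
have be'' := bound _ _ Bc h2.
have al_l := lip _ _ _ Ba Bb h1 h1.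
have be_l := lip _ _ _ Ba Bb h2 h1.
have be_l' := lip _ _ _ Ba Bc h2 h3.
move: A_flat' al al' be be' be'' al_l be_l be_l'.
move: (A (b - a) a) (A (b - a) b) (A (b - a) c) (A (c - b) a) (A (c - b) b)
  (A (c - b) c) => a0 a1 a2 b0 b1 b2.
rewrite (transport0_defect a0 a1 a2 b0 b1 b2).
move=> F ha0 ha1 hb0 hb1 hb2 la lb lb'.
have Kd0 : 0 <= K * d by rewrite mulr_ge0.
have Kdd0 : 0 <= K * d ^+ 2 by rewrite mulr_ge0// exprn_ge0.
have nM X Y x y : nu X <= x -> nu Y <= y -> nu (X *m Y) <= x * y.
  move=> hX hY; apply: le_trans (submul_normM _ _) _.
  by apply: ler_pM => //; exact: submul_norm_ge0.
have nD X Y x y : nu X <= x -> nu Y <= y -> nu (X + Y) <= x + y.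
  by move=> hX hY; apply: le_trans (submul_normD _ _) (lerD hX hY).
have nZ (t : R) X x : 0 <= t -> nu X <= x -> nu (t *: X) <= t * x.
  by move=> t0 hX; rewrite submul_normZ ger0_norm// ler_wpM2l.
have i2 : 0 <= 2^-1 :> R by [].
have i4 : 0 <= 4^-1 :> R by [].
have haa := nM _ _ _ _ ha0 ha0; have hbb := nM _ _ _ _ hb1 hb1.
have saa := nD _ _ _ _ ha0 ha1; have sbb := nD _ _ _ _ hb1 hb2.
apply: le_trans (nD _ _ _ _ (nD _ _ _ _ (nD _ _ _ _ (nD _ _ _ _ (nD _ _ _ _
  (nD _ _ _ _ (nD _ _ _ _ (nD _ _ _ _ (nZ _ _ _ i2 F)
  (nZ _ _ _ i2 (nM _ _ _ _ hb1 lb))) (nZ _ _ _ i2 (nM _ _ _ _ lb hb0)))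
  (nZ _ _ _ i4 (nM _ _ _ _ lb saa))) (nZ _ _ _ i4 (nM _ _ _ _ lb' saa)))
  (nZ _ _ _ i2 (nM _ _ _ _ hb0 la))) (nZ _ _ _ i4 (nM _ _ _ _ sbb haa)))
  (nZ _ _ _ i4 (nM _ _ _ _ hbb saa))) (nZ _ _ _ i4 (nM _ _ _ _ hbb haa))) _.
have d30 : 0 <= d ^+ 3 by rewrite exprn_ge0.
have d43 : K ^+ 4 * d ^+ 4 <= K ^+ 4 * d ^+ 3.
  by rewrite ler_wpM2l ?exprn_ge0// exprS ler_piMl.
have p1 : 0 <= K * d ^+ 3 by rewrite mulr_ge0.
have p2 : 0 <= K ^+ 2 * d ^+ 3 by rewrite mulr_ge0 ?exprn_ge0.
have p4 : 0 <= K ^+ 4 * d ^+ 3 by rewrite mulr_ge0 ?exprn_ge0.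
rewrite /C.
rewrite [leLHS](_ : _ = 2^-1 * (K * d ^+ 3) + 5 / 2 * (K ^+ 2 * d ^+ 3) +
  (K ^+ 3 * d ^+ 3) + 4^-1 * (K ^+ 4 * d ^+ 4)); last by field.
by rewrite !mulrDl; lra.
Qed.

(* The midpoints cut the triangle into four triangles of half the diameter: each
   step divides the defect by 2, whence convergence and multiplicativity. *)
Lemma transport_triangle k a b c d : B a -> B b -> B c ->
  `|b - a| <= d -> `|c - b| <= d -> `|c - a| <= d -> d <= 1 ->
  nu (transport k b c *m transport k a b - transport k a c)
  <= C * d ^+ 3 * 2^-1 ^+ k * expR (4 * L * d).
Proof.
elim: k a b c d => [|k IH] a b c d Ba Bb Bc h1 h2 h3 d1.
  have d0 : 0 <= d by apply: le_trans h1.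
  apply: le_trans (transport0_triangle Ba Bb Bc h1 h2 h3 d1) _.
  rewrite expr0 mulr1 ler_peMr ?mulr_ge0 ?exprn_ge0//.
  by apply: le_trans (expR_ge1Dx _); rewrite lerDl !mulr_ge0.
have d0 : 0 <= d by apply: le_trans h1.
pose e := 2^-1 * d.
have e1 : e <= 1 by rewrite /e; lra.
have half (x : E) : `|x| <= d -> `|2^-1 *: x| <= e.
  by move=> xd; rewrite norm_half ler_wpM2l.
have [Bx By Bz] := And3 (mid_ball Ba Bb) (mid_ball Bb Bc) (mid_ball Ba Bc).
have ax : `|mid a b - a| <= e by rewrite midBl; exact: half.
have xb : `|b - mid a b| <= e by rewrite midBr; exact: half.
have by_ : `|mid b c - b| <= e by rewrite midBl; exact: half.
have yc : `|c - mid b c| <= e by rewrite midBr; exact: half.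
have az : `|mid a c - a| <= e by rewrite midBl; exact: half.
have zc : `|c - mid a c| <= e by rewrite midBr; exact: half.
have xy : `|mid b c - mid a b| <= e by rewrite (midC a) midBB; exact: half.
have zx : `|mid a b - mid a c| <= e.
  by rewrite midBB -normrN -scalerN opprB; exact: half.
have zy : `|mid b c - mid a c| <= e by rewrite !(midC _ c) midBB; exact: half.
have near1 u v : B u -> B v -> `|v - u| <= e ->
    nu (transport k u v - 1%:M) <= expR (L * e) - 1.
  move=> Bu Bv uv; apply: le_trans (transport_near1 k Bu Bv) _.
  by rewrite lerB// ler_expR ler_wpM2l.
have t1 := IH _ _ _ _ Bx Bb By xb by_ xy e1.
have t2 := IH _ _ _ _ Ba Bz Bx az zx ax e1.
have t3 := IH _ _ _ _ Bz Bx By zx xy zy e1.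
have t4 := IH _ _ _ _ Bz By Bc zy yc zc e1.
rewrite /=.
have nyc := near1 _ _ By Bc yc; have nax := near1 _ _ Ba Bx ax.
have nxy := near1 _ _ Bx By xy; have naz := near1 _ _ Ba Bz az.
move: t1 t2 t3 t4 nyc nax nxy naz.
set x := mid a b; set y := mid b c; set z := mid a c.
set bnd := C * _ * _ * _.
set P1 := transport k x b; set P2 := transport k b y.
set P3 := transport k x y; set P4 := transport k a z.
set P5 := transport k z x; set P6 := transport k a x.
set P7 := transport k z y; set P8 := transport k y c.
set P9 := transport k z c => t1 t2 t3 t4 nyc nax nxy naz.
(* The path [a x b y c] is deformed into [a z c] across one small triangle at a time: [x b y], then
   [a z x], then [z x y], then [z y c]. *)
have -> : P8 *m P2 *m (P1 *m P6) - P9 *m P4 =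
    P8 *m ((P2 *m P1 - P3) *m P6) - P8 *m (P3 *m (P5 *m P4 - P6)) +
    P8 *m ((P3 *m P5 - P7) *m P4) + (P8 *m P7 - P9) *m P4.
  by rewrite !(mulmxBl, mulmxBr) !mulmxA; matrix_sum_ring.
have q1 : 1 <= expR (L * e).
  by apply: le_trans (expR_ge1Dx _); rewrite lerDl mulr_ge0// /e mulr_ge0.
have bnd0 : 0 <= bnd by apply: le_trans t1; exact: submul_norm_ge0.
have mulB X Y Z w : nu (X - 1%:M) <= expR (L * e) - 1 ->
    nu (Y - 1%:M) <= expR (L * e) - 1 -> nu Z <= w -> 0 <= w ->
    [/\ nu (X *m (Z *m Y)) <= expR (L * e) ^+ 2 * w,
       nu (X *m (Y *m Z)) <= expR (L * e) ^+ 2 * w &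
       nu (Z *m Y) <= expR (L * e) ^+ 2 * w].
  move=> hX hY hZ w0; have q0 : 0 <= expR (L * e) by rewrite expR_ge0.
  have s1 := le_trans (submul_norm_mulr Z hY) (ler_wpM2l q0 hZ).
  have s2 := le_trans (submul_norm_mull Z hY) (ler_wpM2l q0 hZ).
  rewrite expr2 -mulrA; split.
  - exact: le_trans (submul_norm_mull _ hX) (ler_wpM2l q0 s1).
  - exact: le_trans (submul_norm_mull _ hX) (ler_wpM2l q0 s2).
  - by apply: le_trans s1 _; rewrite ler_peMl// mulr_ge0.
have [b1 _ _] := mulB _ _ _ _ nyc nax t1 bnd0.
have [_ b2 _] := mulB _ _ _ _ nyc nxy t2 bnd0.
have [b3 _ _] := mulB _ _ _ _ nyc naz t3 bnd0.
have [_ _ b4] := mulB _ _ _ _ nyc naz t4 bnd0.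
apply: le_trans (submul_normD _ _) _.
apply: le_trans (lerD (submul_normD _ _) (lexx _)) _.
apply: le_trans (lerD (lerD (submul_normB _ _) (lexx _)) (lexx _)) _.
apply: le_trans (lerD (lerD (lerD b1 b2) b3) b4) _.
(* The two flanking transports contribute [exp(L d)] and the induction hypothesis at [d / 2]
   contributes [exp(2 L d)]; the constant 4 in [exp(4 L d)] leaves room for both. *)
have -> : expR (L * e) ^+ 2 = expR (L * d).
  by rewrite expr2 -expRD; congr expR; rewrite /e; field.
rewrite /bnd /e.
have -> : 4 * L * (2^-1 * d) = 2 * L * d by field.
have -> : expR (4 * L * d) = expR (L * d) * expR (2 * L * d) * expR (L * d).
  by rewrite -!expRD; congr expR; ring.
have g1 : 1 <= expR (L * d).
  by apply: le_trans (expR_ge1Dx _); rewrite lerDl mulr_ge0.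
have w0 : 0 <= expR (L * d) * (C * d ^+ 3 * 2^-1 ^+ k.+1 * expR (2 * L * d)).
  by rewrite !mulr_ge0 ?expR_ge0 ?exprn_ge0.
have hh := ler_peMr w0 g1.
apply: (le_trans _ (le_trans hh _)); rewrite le_eqVlt; apply/orP; left;
  apply/eqP; rewrite (exprS 2^-1 k);
  move: (expR _) (expR _) (2^-1 ^+ k) => E1 E2 q; by field.
Qed.

(** The factor 2 sums the geometric series of the increments bounded in [transport_cauchy]. *)
Let D := 2 * (C * expR (4 * L)).
Let D0 : 0 <= D.
Proof. by rewrite mulr_ge0// mulr_ge0// expR_ge0. Qed.

(** The degenerate triangle [a], [mid a b], [b]: its two short sides at depth [k] compose to the
    transport from [a] to [b] at depth [k.+1]. *)
Lemma transport_cauchy k a b : B a -> B b ->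
  nu (transport k.+1 a b - transport k a b)
  <= C * expR (4 * L) * `|b - a| ^+ 3 * 2^-1 ^+ k.
Proof.
move=> Ba Bb; have dab := ball_dist Ba Bb.
have Bm := mid_ball Ba Bb.
have h (x : E) : `|2^-1 *: x| <= `|x|.
  by rewrite norm_half ler_piMl// invf_le1// ler1n.
have := @transport_triangle k a (mid a b) b `|b - a| Ba Bm Bb.
rewrite midBl midBr => /(_ (h _) (h _) (lexx _) dab) hT.
apply: le_trans hT _.
rewrite [leRHS]mulrAC [C * expR _]mulrC -[leRHS]mulrA -[leRHS]mulrA
  [leRHS]mulrC.
rewrite [X in _ <= X * _]mulrA [X in _ <= X * _]mulrAC.
rewrite ler_wpM2l ?mulr_ge0 ?exprn_ge0//.
by rewrite ler_expR ler_piMr// mulr_ge0.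
Qed.

Lemma transport_limit : exists Pl : E -> E -> 'M[R]_N,
  forall a b, B a -> B b -> forall k,
    nu (transport k a b - Pl a b) <= D * `|b - a| ^+ 3 * 2^-1 ^+ k.
Proof.
have lim1 (a b : E) : exists l : 'M[R]_N, B a -> B b -> forall k,
    nu (transport k a b - l) <= D * `|b - a| ^+ 3 * 2^-1 ^+ k.
  have [Ba|] := pselect (B a); last by exists 0.
  have [Bb|] := pselect (B b); last by exists 0.
  (* The entrywise bounds are obtained by dividing by [N]; for [N = 0] the norm is identically 0. *)
  have [N0|N0] := posnP N.
    have NR0 : N%:R = 0 :> R by rewrite N0.
    by exists 0 => _ _ k; rewrite /submul_norm NR0 mul0r !mulr_ge0 ?exprn_ge0.
  have N1 : 0 < N%:R :> R by rewrite ltr0n.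
  set M := C * expR (4 * L) * `|b - a| ^+ 3.
  have lij i j : exists l : R, forall k,
      `|transport k a b i j - l| <= 2 * (M / N%:R) * 2^-1 ^+ k.
    apply: geometric_limit => k; have := transport_cauchy k Ba Bb.
    rewrite /submul_norm -/M => h; rewrite mulrAC ler_pdivlMr// mulrC.
    apply: le_trans h; rewrite ler_wpM2l//.
    by have := le_mx_norm (transport k.+1 a b - transport k a b) i j; rewrite
      !mxE.
  exists (\matrix_(i, j) sval (cid (lij i j))) => _ _ k.
  rewrite /submul_norm mulrC -ler_pdivlMr//; apply: mx_norm_le => [|i j].
    by rewrite divr_ge0// !mulr_ge0 ?exprn_ge0.
  rewrite !mxE; apply: le_trans (svalP (cid (lij i j)) k) _.
  by rewrite /M /D le_eqVlt; apply/orP; left; apply/eqP; field; rewrite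
    lt0r_neq0.
have [f fP] := choice (fun ab : E * E => lim1 ab.1 ab.2).
by exists (fun a b => f (a, b)) => a b; exact: (fP (a, b)).
Qed.

(** The triangle defect at depth [k] and the distance of each transport to its limit are all of
    order [2^-k], so the defect of the limit is bounded by a constant times every power of 1/2. *)
Lemma transport_limit_mul (Pl : E -> E -> 'M[R]_N) :
  (forall a b, B a -> B b -> forall k,
    nu (transport k a b - Pl a b) <= D * `|b - a| ^+ 3 * 2^-1 ^+ k) ->
  forall a b c, B a -> B b -> B c -> Pl b c *m Pl a b = Pl a c.
Proof.
move=> PlP a b c Ba Bb Bc; apply/eqP; rewrite -subr_eq0; apply/eqP.
have PlP1 x y k : B x -> B y -> nu (transport k x y - Pl x y) <= D * 2^-1 ^+ k.
  move=> Bx By; apply: le_trans (PlP _ _ Bx By k) _.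
  rewrite ler_wpM2r ?exprn_ge0// ler_piMr// exprn_ile1//.
  exact: ball_dist.
pose e1 := expR L.
have near1 x y k : B x -> B y -> nu (transport k x y - 1%:M) <= e1 - 1.
  move=> Bx By; apply: le_trans (transport_near1 k Bx By) _.
  by rewrite lerB// ler_expR ler_piMr//; exact: ball_dist.
have Pl1 : nu (Pl a b - 1%:M) <= (e1 + D) - 1.
  have -> : Pl a b - 1%:M =
      (transport 0 a b - 1%:M) - (transport 0 a b - Pl a b).
    by rewrite opprB [RHS]addrC subrKA.
  apply: le_trans (submul_normB _ _) _.
  have := PlP1 _ _ 0%N Ba Bb; rewrite expr0 mulr1.
  by have := near1 _ _ 0%N Ba Bb; lra.
apply: submul_norm_le0.
apply: (@le0_geometric _ _ (C * expR (4 * L) + D + e1 * D + (e1 + D) * D)) => k.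
have hT := transport_triangle k Ba Bb Bc (ball_dist Ba Bb)
  (ball_dist Bb Bc) (ball_dist Ba Bc) (lexx 1).
have hac := PlP1 _ _ k Ba Bc; have hab := PlP1 _ _ k Ba Bb.
have hbc := PlP1 _ _ k Bb Bc.
have -> : Pl b c *m Pl a b - Pl a c =
    (transport k b c *m transport k a b - transport k a c)
    + (transport k a c - Pl a c)
    - transport k b c *m (transport k a b - Pl a b)
    - (transport k b c - Pl b c) *m Pl a b.
  by rewrite !(mulmxBl, mulmxBr); matrix_sum_ring.
have s1 := submul_norm_mull (transport k a b - Pl a b) (near1 _ _ k Bb Bc).
have s2 := submul_norm_mulr (transport k b c - Pl b c) Pl1.
have e10 : 0 <= e1 by rewrite expR_ge0.
have e1D : 0 <= e1 + D by rewrite addr_ge0.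
have s1' := le_trans s1 (ler_wpM2l e10 hab).
have s2' := le_trans s2 (ler_wpM2l e1D hbc).
apply: le_trans (submul_normB _ _) _.
apply: le_trans (lerD (submul_normB _ _) (lexx _)) _.
apply: le_trans (lerD (lerD (submul_normD _ _) (lexx _)) (lexx _)) _.
apply: le_trans (lerD (lerD (lerD hT hac) s1') s2') _.
rewrite !expr1n !mulr1 le_eqVlt; apply/orP; left; apply/eqP; ring.
Qed.

(** [Y] is the limit transport from [p]. Multiplicativity turns its increment from [x] to [y] into
    [(Pl x y - 1) Y x], and [Pl x y] differs from [transport0 x y], hence from [1 + A (y - x) x], by
    terms of order at least two. *)
Theorem frobenius_local : exists Y : E -> 'M[R]_N, [/\ Y p = 1%:M,
  forall x, B x -> {for x, continuous Y} &
  forall x v, B x -> is_derive x v Y (A v x *m Y x)].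
Proof.
have [Pl PlP] := transport_limit.
have PlM := transport_limit_mul PlP.
have Bp : B p by rewrite subrr normr0.
have A0 x : B x -> A 0 x = 0.
  by move=> Bx; rewrite -(scale0r 0) AZ// scale0r.
exists (Pl p); split.
  have := PlP _ _ Bp Bp 0%N; rewrite subrr normr0 expr0n mulr0 mul0r.
  move/submul_norm_le0/eqP; rewrite subr_eq0 => /eqP <-.
  by rewrite /= /transport0 subrr !A0// mul0mx !addr0 scaler0 !addr0.
  move=> x Bx; apply/continuous_normBP => e e0.
  pose c := (L + D) * nu (Pl p x) + 1.
  have LD0 : 0 <= L + D := addr_ge0 L0 D0.
  have c0 : 0 < c by rewrite ltr_wpDl// mulr_ge0// submul_norm_ge0.
  exists (Num.min (r - `|x - p|) (e / c)) => [|y].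
    by rewrite lt_min subr_gt0 Bx divr_gt0.
  rewrite lt_min => /andP[yr ye].
  have By : B y.
    rewrite -(subrKA x); apply: le_lt_trans (ler_normD _ _) _.
    by rewrite -ltrBrDr.
  have [N0|N0] := posnP N.
    apply: le_lt_trans e0; apply: mx_norm_le => // i; exfalso.
    by case: i => i; rewrite N0.
  have nu_ge (X : 'M[R]_N) : `|X| <= nu X.
    by rewrite /submul_norm ler_peMl// ler1n.
  apply: le_lt_trans (nu_ge _) _.
  rewrite -(PlM _ _ _ Bp Bx By) -[X in _ - X]mul1mx -mulmxBl.
  apply: le_lt_trans (submul_normM _ _) _.
  have hP : nu (Pl x y - 1%:M) <= (L + D) * `|y - x|.
    have -> : Pl x y - 1%:M = (transport0 x y - 1%:M) - (transport0 x y - Pl x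
      y).
      by matrix_sum_ring.
    apply: le_trans (submul_normB _ _) _; rewrite mulrDl.
    apply: lerD; first exact: transport0_near1.
    apply: le_trans (PlP _ _ Bx By 0%N) _; rewrite expr0 mulr1 ler_wpM2l//.
    by rewrite exprS ler_piMr// exprn_ile1//; exact: ball_dist.
  apply: le_lt_trans (ler_wpM2r (submul_norm_ge0 _) hP) _.
  move: ye; rewrite ltr_pdivlMr//; apply: le_lt_trans.
  by rewrite mulrAC mulrC ler_wpM2l// lerDl.
move=> x v Bx.
suff lim : h^-1 *: (Pl p (h *: v + x) - Pl p x) @[h --> 0^'] --> A v x *m Pl p
  x.
  by split; [apply/cvg_ex; exists (A v x *m Pl p x)|exact/cvg_lim].
have [N0|N0] := posnP N.
  apply/cvgrPdist_le => e e0; apply: nearW => h.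
  apply: mx_norm_le (ltW e0) _ => i; exfalso.
  by case: i => i; rewrite N0.
have N1 : 0 < N%:R :> R by rewrite ltr0n.
(* The first two terms bound the deviation of [transport0] from its linear part, the last one its
   distance to the limit. *)
pose q := K * `|v| ^+ 2 + K ^+ 2 * `|v| ^+ 2 + D * `|v| ^+ 3.
have q0 : 0 <= q by rewrite !addr_ge0// ?mulr_ge0// ?exprn_ge0.
have est h : B (h *: v + x) -> `|h| <= 1 -> h != 0 ->
    nu (h^-1 *: (Pl p (h *: v + x) - Pl p x) - A v x *m Pl p x)
    <= `|h| * (q * nu (Pl p x)).
  move=> Bh h1 h0.
  have hn0 : 0 < `|h| by rewrite normr_gt0.
  rewrite -(PlM _ _ _ Bp Bx Bh).
  have -> : h^-1 *: (Pl x (h *: v + x) *m Pl p x - Pl p x) - A v x *m Pl p x =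
      (h^-1 *: (Pl x (h *: v + x) - 1%:M) - A v x) *m Pl p x.
    by rewrite mulmxBl -scalemxAl mulmxBl mul1mx.
  apply: le_trans (submul_normM _ _) _.
  rewrite [leRHS]mulrA ler_wpM2r ?submul_norm_ge0//.
  set y := h *: v + x.
  have yx : y - x = h *: v by rewrite /y addrK.
  have -> : h^-1 *: (Pl x y - 1%:M) - A v x =
      h^-1 *: ((transport0 x y - 1%:M - h *: A v x) - (transport0 x y - Pl x
        y)).
    rewrite -[A v x in LHS](scalerK h0) -scalerBr; congr (_ *: _).
    matrix_sum_ring.
  rewrite submul_normZ normfV ler_pdivrMl//.
  apply: le_trans (submul_normB _ _) _.
  have := PlP _ _ Bx Bh 0%N; rewrite -/y yx expr0 mulr1 normrZ => hP.
  have hT : nu (transport0 x y - 1%:M - h *: A v x) <=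
      `|h| ^+ 2 * (K * `|v| ^+ 2 + K ^+ 2 * `|v| ^+ 2).
    rewrite /transport0 yx (AZ _ _ Bx) (AZ _ _ Bh).
    have -> : 1%:M + 2^-1 *: (h *: A v x + h *: A v y) +
        2^-1 *: (h *: A v x *m (h *: A v x)) - 1%:M - h *: A v x =
        (2^-1 * h) *: (A v y - A v x) +
        (2^-1 * h ^+ 2) *: (A v x *m A v x).
      by rewrite -scalemxAl -scalemxAr; matrix_sum_ring.
    apply: le_trans (submul_normD _ _) _; rewrite !submul_normZ.
    have l1 := A_lip v Bx Bh; rewrite yx normrZ in l1.
    have l2 := submul_normM (A v x) (A v x).
    have l3 := A_bound v Bx.
    have l4 := ler_pM (submul_norm_ge0 _) (submul_norm_ge0 _) l3 l3.
    rewrite !normrM gtr0_norm//.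
    have c1 : 0 <= 2^-1 * `|h| by rewrite mulr_ge0.
    have c2 : 0 <= 2^-1 * `|h| ^+ 2 by rewrite mulr_ge0 ?exprn_ge0.
    have z1 := ler_wpM2l c1 l1.
    have z2 := ler_wpM2l c2 (le_trans l2 l4).
    apply: le_trans (lerD z1 z2) _.
    have p1 : 0 <= `|h| ^+ 2 * (K * `|v| ^+ 2).
      by rewrite mulr_ge0 ?exprn_ge0// mulr_ge0 ?exprn_ge0.
    have p2 : 0 <= `|h| ^+ 2 * (K ^+ 2 * `|v| ^+ 2).
      by rewrite mulr_ge0 ?exprn_ge0// mulr_ge0 ?exprn_ge0.
    rewrite [leLHS](_ : _ = 2^-1 * (`|h| ^+ 2 * (K * `|v| ^+ 2)) +
      2^-1 * (`|h| ^+ 2 * (K ^+ 2 * `|v| ^+ 2))); last by ring.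
    by rewrite mulrDr; lra.
  apply: le_trans (lerD hT hP) _.
  have z3 : `|h| ^+ 3 * (D * `|v| ^+ 3) <= `|h| ^+ 2 * (D * `|v| ^+ 3).
    rewrite ler_wpM2r ?mulr_ge0 ?exprn_ge0//.
    by rewrite exprS ler_piMl ?exprn_ge0.
  rewrite (exprMn _ `|h| `|v|) (mulrCA D) [leRHS](_ : _ =
    `|h| ^+ 2 * (K * `|v| ^+ 2 + K ^+ 2 * `|v| ^+ 2) +
    `|h| ^+ 2 * (D * `|v| ^+ 3)); last by rewrite /q; ring.
  by rewrite lerD2l.
apply/cvgrPdist_le => e e0.
pose m := Num.min 1 (Num.min ((r - `|x - p|) / (`|v| + 1))
   (e * N%:R / (q * nu (Pl p x) + 1))).
have v1 : 0 < `|v| + 1 by rewrite ltr_wpDl.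
have qn0 : 0 <= q * nu (Pl p x) by rewrite mulr_ge0// submul_norm_ge0.
have qn1 : 0 < q * nu (Pl p x) + 1 by rewrite ltr_wpDl.
have m0 : 0 < m by rewrite !lt_min ltr01 !divr_gt0// ?subr_gt0// mulr_gt0.
exists m => // h /=; rewrite sub0r normrN !lt_min => /and3P[h1 h2 h3] h0.
have Bh : B (h *: v + x).
  rewrite -addrA; apply: le_lt_trans (ler_normD _ _) _; rewrite normrZ.
  rewrite -ltrBrDr; apply: le_lt_trans (_ : `|h| * (`|v| + 1) < _).
    by rewrite ler_wpM2l// lerDl.
  by rewrite -ltr_pdivlMr.
have hE := est h Bh (ltW h1) h0.
rewrite distrC -(ler_pM2l N1); apply: le_trans hE _.
apply: (@le_trans _ _ (`|h| * (q * submul_norm (Pl p x) + 1))).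
  by rewrite ler_wpM2l// lerDl.
by rewrite [N%:R * e]mulrC -ler_pdivlMr// ltW.
Qed.

End Frobenius.

(** * Local solutions of integrable linear systems *)

Section SmoothFrobenius.
Context {R : realType} {m N : nat}.
Local Notation E := 'cV[R]_m.
Local Notation basis i := (delta_mx i 0 : E).

Lemma linear_sum_basis (V : lmodType R) (L : E -> V) (h : E) :
  (forall a v w, L (a *: v + w) = a *: L v + L w) ->
  L h = \sum_i h i 0 *: L (basis i).
Proof.
move=> Llin.
have L0 : L 0 = 0.
  by have /eqP := Llin 1 0 0; rewrite !scale1r addr0 eq_sym -subr_eq0 addrK =>
    /eqP.
have Lsum (r : seq 'I_m) : L (\sum_(i <- r) h i 0 *: basis i) =
    \sum_(i <- r) h i 0 *: L (basis i).
  elim: r => [|i r IH]; first by rewrite !big_nil.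
  by rewrite !big_cons Llin IH.
rewrite -Lsum; congr L; apply/matrixP => i j; rewrite ord1 summxE.
rewrite (bigD1 i)//= !mxE !eqxx mulr1 big1 ?addr0// => k ki.
by rewrite !mxE eq_sym (negbTE ki) mulr0.
Qed.

Lemma linear_bound (V : normedModType R) (L : E -> V) (M : R) (h : E) :
  (forall a v w, L (a *: v + w) = a *: L v + L w) ->
  (forall i, `|L (basis i)| <= M) -> `|L h| <= m%:R * M * `|h|.
Proof.
move=> Llin LM; rewrite (linear_sum_basis _ Llin).
apply: le_trans (ler_norm_sum _ _ _) _.
rewrite -mulrA mulr_natl -[X in _ *+ X]card_ord -sumr_const ler_sum// => i _.
by rewrite normrZ mulrC ler_pM// le_mx_norm.
Qed.

Lemma mvt_mx (V : normedModType R) (n q : nat) (F G : V -> 'M[R]_(n, q))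
    (x v : V) (c : R) : 0 <= c ->
  (forall t : R, 0 <= t <= 1 -> is_derive (x + t *: v) v F (G (x + t *: v))) ->
  (forall t : R, 0 <= t <= 1 -> `|G (x + t *: v)| <= c) ->
  `|F (x + v) - F x| <= c.
Proof.
move=> c0 FG Gc; apply: mx_norm_le => // i j.
have [|t t01] := @mvt_line R V (fun y => F y i j) (fun y => G y i j) x v.
  by move=> t /FG/is_derive_mxP; exact.
by rewrite !mxE => ->; apply: le_trans (Gc t t01); exact: le_mx_norm.
Qed.

(** The mean value theorem for [F (x + s v) - s G x], whose derivative [G (x + s v) - G x] is
    bounded by a first application of that theorem to [G]. *)
Lemma taylor2_mx (V : normedModType R) (n q : nat) (F G H : V -> 'M[R]_(n, q))
    (x v : V) (c : R) : 0 <= c ->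
  (forall t : R, 0 <= t <= 1 -> is_derive (x + t *: v) v F (G (x + t *: v))) ->
  (forall t : R, 0 <= t <= 1 -> is_derive (x + t *: v) v G (H (x + t *: v))) ->
  (forall t : R, 0 <= t <= 1 -> `|H (x + t *: v)| <= c) ->
  `|F (x + v) - F x - G x| <= c.
Proof.
move=> c0 FG GH Hc.
have Gx (t : R) : 0 <= t <= 1 -> `|G (x + t *: v) - G x| <= c.
  move=> /andP[t0 t1].
  have ts (s : R) : 0 <= s <= 1 -> 0 <= s * t <= 1.
    by move=> /andP[s0 s1]; rewrite mulr_ge0// mulr_ile1.
  apply: (@mvt_mx _ _ _ _ (fun y => t *: H y)) => // s /ts s01.
    by rewrite scalerA; apply: is_derive_scale_dir; exact: GH.
  rewrite scalerA normrZ ger0_norm//; apply: le_trans (Hc _ s01).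
  by rewrite ler_piMl.
pose f (s : R) := F (x + s *: v) - s *: G x.
have -> : F (x + v) - F x - G x = f (0 + 1) - f 0.
  by rewrite /f add0r !scale1r !scale0r subr0 addr0 addrAC.
apply: (@mvt_mx R^o _ _ f (fun s => G (x + s *: v) - G x) 0 1 c c0).
  move=> t t01; rewrite add0r [t *: 1]mulr1; apply: is_derive_sub.
    exact/is_derive_line/FG.
  have := is_derive_scale (is_derive_id t (1 : R^o)) (is_derive_const (G x) t
    1).
  by rewrite scale1r scaler0 addr0.
by move=> t t01; rewrite add0r [t *: 1]mulr1; exact: Gx.
Qed.

Lemma locally_bounded (I : finType) (W V : normedModType R) (F : I -> W -> V)
    (p : W) : (forall i, {for p, continuous (F i)}) ->
  exists M, 0 <= M /\ exists2 r : R, 0 < r &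
    forall i x, `|x - p| < r -> `|F i x| <= M.
Proof.
move=> Fc; exists (\sum_i (`|F i p| + 1)).
have ge0 i : 0 <= `|F i p| + 1 by rewrite addr_ge0.
split; first exact: sumr_ge0.
have /nbhs_normBP[r r0 rP] : \forall x \near p, forall i, `|F i x - F i p| < 1.
  apply: (@filter_forall W I (fun i x => `|F i x - F i p| < 1)) => i.
  have /continuous_normBP/(_ 1 ltr01)[d d0 dP] := Fc i.
  by apply/nbhs_normBP; exists d.
exists r => // i x /rP/(_ i) Fx.
apply: (@le_trans _ _ (`|F i p| + 1)).
  by rewrite -[F i x](subrK (F i p)) addrC; apply: le_trans (ler_normD _ _) _;
     rewrite lerD2l ltW.
by rewrite (bigD1 i)//= lerDl sumr_ge0.
Qed.

Lemma open_norm_ball (V : normedModType R) (p : V) (r : R) :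
  open [set x | `|x - p| < r].
Proof.
rewrite openE => x /= xr; apply/nbhs_normBP.
exists (r - `|x - p|); first by rewrite subr_gt0.
move=> y yr /=; rewrite -(subrKA x); apply: le_lt_trans (ler_normD _ _) _.
by rewrite -ltrBrDr.
Qed.

(** Taylor bounds in a small ball turn the pointwise integrability condition into the
    finite-difference hypothesis of [frobenius_local]. Smoothness is a bootstrap: [Y] is continuous,
    and its derivative [A v Y] is as regular as [Y] itself. *)
Theorem frobenius_smooth (U : set E) (A : E -> E -> 'M[R]_N) (p : E) :
  open U -> U p -> (forall h, smooth_on U (A h)) ->
  (forall a h k x, U x -> A (a *: h + k) x = a *: A h x + A k x) ->
  (forall h k x, U x -> 'D_h (A k) x + A k x *m A h x =
                        'D_k (A h) x + A h x *m A k x) ->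
  exists r : R, [/\ 0 < r, forall x, `|x - p| < r -> U x &
    exists Y : E -> 'M[R]_N,
    [/\ Y p = 1%:M, smooth_on [set x | `|x - p| < r] Y &
    forall x v, `|x - p| < r -> is_derive x v Y (A v x *m Y x)]].
Proof.
move=> oU Up As Alin Aflat.
have /nbhs_normBP[r1 r10 r1U] : nbhs p U by apply: open_nbhs_nbhs.
have DA v h : smooth_on U ('D_v (A h)) by exact: smooth_onD.
have DDA w v h : smooth_on U ('D_w ('D_v (A h))) by exact: smooth_onD.
(* Continuity at [p] bounds the finitely many derivatives in basis directions near [p]; linearity in
   each slot extends the bounds to all vectors. *)
pose F0 (i : 'I_m) := A (basis i).
pose F1 (ij : 'I_m * 'I_m) := 'D_(basis ij.1) (A (basis ij.2)).
pose F2 (ijk : 'I_m * 'I_m * 'I_m) :=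
  'D_(basis ijk.1.1) ('D_(basis ijk.1.2) (A (basis ijk.2))).
have [|M0 [M00 [s0 s00 b0]]] := @locally_bounded _ _ _ F0 p.
  by move=> i; exact: smooth_on_continuous (As _) Up.
have [|M1 [M10 [s1 s10 b1]]] := @locally_bounded _ _ _ F1 p.
  by move=> i; exact: smooth_on_continuous (DA _ _) Up.
have [|M2 [M20 [s2 s20 b2]]] := @locally_bounded _ _ _ F2 p.
  by move=> i; exact: smooth_on_continuous (DDA _ _ _) Up.
pose r := Num.min 2^-1 (Num.min r1 (Num.min s0 (Num.min s1 s2))).
have r0 : 0 < r by rewrite !lt_min r10 s00 s10 s20 invr_gt0 ltr0n.
have rP x : `|x - p| < r ->
    [/\ U x, `|x - p| < s0, `|x - p| < s1 & `|x - p| < s2].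
  by rewrite !lt_min => /and5P[_ /r1U ? ? ? ?].
have rU x : `|x - p| < r -> U x by case/rP.
have D1lin v x : U x -> forall a h k,
    'D_v (A (a *: h + k)) x = a *: 'D_v (A h) x + 'D_v (A k) x.
  move=> Ux a h k.
  rewrite (derive_on_ext _ oU (fun y Uy => Alin a h k y Uy) Ux).
  have D := is_derive_add
    (is_derive_scale (is_derive_const a x v) (smooth_on_derivable v (As h) Ux))
    (smooth_on_derivable v (As k) Ux).
  by case: D => _ ->; rewrite scale0r add0r.
have D2lin w v x : U x -> forall a h k, 'D_w ('D_v (A (a *: h + k))) x =
    a *: 'D_w ('D_v (A h)) x + 'D_w ('D_v (A k)) x.
  move=> Ux a h k.
  rewrite (derive_on_ext _ oU (fun y Uy => D1lin v y Uy a h k) Ux).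
  have D := is_derive_add
    (is_derive_scale (is_derive_const a x w) (smooth_on_derivable w (DA v h)
      Ux))
    (smooth_on_derivable w (DA v k) Ux).
  by case: D => _ ->; rewrite scale0r add0r.
have D2lin2 w h x : U x -> forall a v k, 'D_w ('D_(a *: v + k) (A h)) x =
    a *: 'D_w ('D_v (A h)) x + 'D_w ('D_k (A h)) x.
  move=> Ux a v k.
  rewrite (derive_on_ext _ oU
    (fun y Uy => smooth_derive_linear a v k oU (As h) Uy) Ux).
  have D := is_derive_add
    (is_derive_scale (is_derive_const a x w) (smooth_on_derivable w (DA v h)
      Ux))
    (smooth_on_derivable w (DA k h) Ux).
  by case: D => _ ->; rewrite scale0r add0r.
pose c : R := m%:R.
have c0 : 0 <= c by rewrite ler0n.
have B0 h x : `|x - p| < r -> `|A h x| <= c * M0 * `|h|.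
  move=> /rP[Ux x0 _ _]; apply: (linear_bound (L := fun h => A h x)) => [a v
    w|i].
    exact: Alin.
  exact: b0 i x x0.
have B1 v h x : `|x - p| < r -> `|'D_v (A h) x| <= c * (c * M1 * `|h|) * `|v|.
  move=> /rP[Ux _ x1 _].
  apply: (linear_bound (L := fun v => 'D_v (A h) x)) => [a v' w|i].
    exact: smooth_derive_linear oU (As h) Ux.
  apply: (linear_bound (L := fun h => 'D_(basis i) (A h) x)) => [a v' w|j].
    exact: D1lin.
  exact: b1 (i, j) x x1.
have B2 w v h x : `|x - p| < r ->
    `|'D_w ('D_v (A h)) x| <= c * (c * (c * M2 * `|h|) * `|v|) * `|w|.
  move=> /rP[Ux _ _ x2].
  apply: (linear_bound (L := fun w => 'D_w ('D_v (A h)) x)) => [a v' w'|i].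
    exact: smooth_derive_linear oU (DA v h) Ux.
  apply: (linear_bound (L := fun v => 'D_(basis i) ('D_v (A h)) x)) => [a v'
    w'|j].
    exact: D2lin2.
  apply: (linear_bound
    (L := fun h => 'D_(basis i) ('D_(basis j) (A h)) x)) => [a v' w'|k].
    exact: D2lin.
  exact: b2 (i, j, k) x x2.
have seg x y (t : R) : `|x - p| < r -> `|y - p| < r -> 0 <= t <= 1 ->
    `|x + t *: (y - x) - p| < r.
  move=> xr yr /andP[t0 t1].
  have -> : x + t *: (y - x) - p = (1 - t) *: (x - p) + t *: (y - p).
    by apply/matrixP => i j; rewrite !mxE; ring.
  apply: le_lt_trans (ler_normD _ _) _; rewrite !normrZ !ger0_norm ?subr_ge0//.
  have [->|tn0] := eqVneq t 0; first by rewrite subr0 mul1r mul0r addr0.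
  have tpos : 0 < t by rewrite lt_def tn0.
  have u1 : t * `|y - p| < t * r by rewrite ltr_pM2l.
  have u2 : (1 - t) * `|x - p| <= (1 - t) * r by rewrite ler_wpM2l ?subr_ge0//
    ltW.
  by lra.
have lip h x y : `|x - p| < r -> `|y - p| < r ->
    `|A h y - A h x| <= c * (c * M1 * `|h|) * `|y - x|.
  move=> xr yr; rewrite -[in A h y](subrK x y) [y - x + x]addrC.
  apply: (@mvt_mx _ _ _ _ ('D_(y - x) (A h))) => [|t t01|t t01].
  - by rewrite !mulr_ge0.
  - by apply: smooth_on_derivable (As h) _; exact/rU/seg.
  - by apply: B1; exact: seg.
have tay k x y : `|x - p| < r -> `|y - p| < r ->
    `|A k y - A k x - 'D_(y - x) (A k) x|
    <= c * (c * (c * M2 * `|k|) * `|y - x|) * `|y - x|.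
  move=> xr yr; rewrite -[in A k y](subrK x y) [y - x + x]addrC.
  apply: (@taylor2_mx _ _ _ (A k) ('D_(y - x) (A k)) ('D_(y - x) ('D_(y - x) (A
    k)))) => [|t t01|t t01|t t01].
  - by rewrite !mulr_ge0.
  - by apply: smooth_on_derivable (As k) _; exact/rU/seg.
  - by apply: smooth_on_derivable (DA _ k) _; exact/rU/seg.
  - by apply: B2; exact: seg.
pose n : R := N%:R.
have n0 : 0 <= n by rewrite ler0n.
(* The weight 3 accounts for the three Taylor remainders in the flatness estimate. *)
pose K := n * (c * M0) + n * (c * (c * M1)) + 3 * (n * (c * (c * (c * M2)))).
have k0 : 0 <= n * (c * M0) by rewrite !mulr_ge0.
have k1 : 0 <= n * (c * (c * M1)) by rewrite !mulr_ge0.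
have k2 : 0 <= n * (c * (c * (c * M2))) by rewrite !mulr_ge0.
exists r; split=> //.
suff [Y [Yp Yc Yd]] : exists Y : E -> 'M[R]_N, [/\ Y p = 1%:M,
    forall x, `|x - p| < r -> {for x, continuous Y} &
    forall x v, `|x - p| < r -> is_derive x v Y (A v x *m Y x)].
  exists Y; split=> // q; elim: q => [|q IH].
    by split=> // x; exact: Yc.
  have oB : open [set x | `|x - p| < r] by exact: open_norm_ball.
  split=> [x|v]; first exact: Yc.
  split=> [x xr|]; first by case: (Yd x v xr).
  apply: (@Ck_on_ext _ _ q _ _ (fun x => A v x *m Y x)) => // [x xr|].
    by case: (Yd x v xr).
  by apply: Ck_on_mulmx => //; apply: Ck_on_sub (As v q).
apply: (@frobenius_local _ _ _ A p r K) => //.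
- by rewrite ge_min lexx.
- by rewrite !addr_ge0// mulr_ge0.
- by move=> h k x /rU Ux; have := Alin 1 h k x Ux; rewrite !scale1r.
- move=> a h x /rU Ux; have := Alin a h 0 x Ux; rewrite addr0 => ->.
  have := Alin 1 0 0 x Ux; rewrite !scale1r addr0 => /eqP.
  by rewrite eq_sym -subr_eq0 addrK => /eqP ->; rewrite addr0.
- move=> h x xr; rewrite /submul_norm.
  apply: le_trans (ler_wpM2l n0 (B0 h x xr)) _.
  by rewrite mulrA ler_wpM2r// /K -addrA lerDl addr_ge0// mulr_ge0.
- move=> h x y xr yr; rewrite /submul_norm.
  apply: le_trans (ler_wpM2l n0 (lip h x y xr yr)) _.
  rewrite [leLHS](_ : _ = n * (c * (c * M1)) * `|h| * `|y - x|); last by ring.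
  do 2!rewrite ler_wpM2r//.
  by rewrite /K -addrA addrCA lerDl addr_ge0// mulr_ge0.
- move=> a b e d ar br er hd kd hkd.
  have d0 : 0 <= d by apply: le_trans hd.
  set h := b - a; set k := e - b.
  have ea : e - a = k + h by rewrite /k /h subrKA.
  have Ua := rU _ ar.
  (* All increments are referred to the base point [a], with [A h e - A h b] written as a difference
     of two increments from [a]. The integrability condition at [a] absorbs the commutator, and
     three Taylor remainders are left. *)
  have -> : A k b - A k a - (A h e - A h b) + (A k a *m A h a - A h a *m A k a)
    =
      (A k b - A k a - 'D_h (A k) a) - (A h e - A h a - 'D_(k + h) (A h) a)
      + (A h b - A h a - 'D_h (A h) a).
    have := smooth_derive_linear 1 k h oU (As h) Ua; rewrite !scale1r => ->.
    have := Aflat h k a Ua.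
    move: ('D_h (A k) a) ('D_k (A h) a) ('D_h (A h) a) => X Y Z.
    move=> /eqP; rewrite eq_sym -subr_eq => /eqP <-.
    matrix_sum_ring.
  have T (f g : E) (z : E) : `|z - p| < r -> `|f| <= d -> z - a = g -> `|g| <=
    d ->
      submul_norm (A f z - A f a - 'D_g (A f) a)
      <= n * (c * (c * (c * M2))) * d ^+ 3.
    move=> zr fd <- gd; rewrite /submul_norm.
    apply: le_trans (ler_wpM2l n0 (tay f a z ar zr)) _.
    rewrite [leLHS](_ : _ = n * (c * (c * (c * M2))) *
      (`|f| * (`|z - a| * `|z - a|))); last by ring.
    rewrite ler_wpM2l// exprS expr2.
    by rewrite !ler_pM ?mulr_ge0.
  apply: le_trans (submul_normD _ _) _.
  apply: le_trans (lerD (submul_normB _ _) (lexx _)) _.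
  have t1 := T k h b br kd erefl hd.
  have t2 := T h (k + h) e er hd ea; rewrite -ea in t2; move: t2 => /(_ hkd) t2.
  have t3 := T h h b br hd erefl hd.
  rewrite -ea; apply: le_trans (lerD (lerD t1 t2) t3) _.
  have d30 : 0 <= d ^+ 3 by rewrite exprn_ge0.
  have e0 := mulr_ge0 k0 d30; have e1 := mulr_ge0 k1 d30.
  move: e0 e1; rewrite /K; move: (n * (c * M0)) (n * (c * (c * M1))) => x y.
  move: (n * (c * (c * (c * M2)))) (d ^+ 3) => z w e0 e1.
  rewrite [leRHS](_ : _ = x * w + y * w + (z * w + z * w + z * w)); last by
    ring.
  by rewrite lerDr addr_ge0.
Qed.

End SmoothFrobenius.

(** * Riemannian geometry in a chart *)

Lemma trmx_add (V : zmodType) (p q : nat) (A B : 'M[V]_(p, q)) :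
  (A + B)^T = A^T + B^T.
Proof. by apply/matrixP => i j; rewrite !mxE. Qed.

Lemma trmx_opp (V : zmodType) (p q : nat) (A : 'M[V]_(p, q)) :
  (- A)^T = - A^T.
Proof. by apply/matrixP => i j; rewrite !mxE. Qed.

Section BilinearForm.
Context {R : realType} {m : nat}.
Implicit Types (A B X : 'M[R]_m) (x y z : 'cV[R]_m).

Lemma bilDl A x y z : bil A (x + y) z = bil A x z + bil A y z.
Proof. by rewrite /bil raddfD /= !mulmxDl mxE. Qed.

Lemma bilDr A x y z : bil A x (y + z) = bil A x y + bil A x z.
Proof. by rewrite /bil mulmxDr mxE. Qed.

Lemma bilZl A (a : R) x y : bil A (a *: x) y = a * bil A x y.
Proof. by rewrite /bil linearZ /= -!scalemxAl mxE. Qed.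

Lemma bilZr A (a : R) x y : bil A x (a *: y) = a * bil A x y.
Proof. by rewrite /bil -scalemxAr mxE. Qed.

Lemma bilNl A x y : bil A (- x) y = - bil A x y.
Proof. by rewrite -scaleN1r bilZl mulN1r. Qed.

Lemma bilNr A x y : bil A x (- y) = - bil A x y.
Proof. by rewrite -scaleN1r bilZr mulN1r. Qed.

Lemma bilBl A x y z : bil A (x - y) z = bil A x z - bil A y z.
Proof. by rewrite bilDl bilNl. Qed.

Lemma bilBr A x y z : bil A x (y - z) = bil A x y - bil A x z.
Proof. by rewrite bilDr bilNr. Qed.

Lemma bil0l A x : bil A 0 x = 0.
Proof. by rewrite -(scale0r 0) bilZl mul0r. Qed.

Lemma bil0r A x : bil A x 0 = 0.
Proof. by rewrite -(scale0r 0) bilZr mul0r. Qed.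

Lemma bil_mxD A B x y : bil (A + B) x y = bil A x y + bil B x y.
Proof. by rewrite /bil mulmxDr mulmxDl mxE. Qed.

Lemma bil_mxZ (a : R) A x y : bil (a *: A) x y = a * bil A x y.
Proof. by rewrite /bil -scalemxAr -scalemxAl mxE. Qed.

Lemma bil_mxN A x y : bil (- A) x y = - bil A x y.
Proof. by rewrite -scaleN1r bil_mxZ mulN1r. Qed.

Lemma bil_mulr A X x y : bil A x (X *m y) = bil (A *m X) x y.
Proof. by rewrite /bil !mulmxA. Qed.

Lemma bil_mull A X x y : bil A (X *m x) y = bil (X^T *m A) x y.
Proof. by rewrite /bil trmx_mul !mulmxA. Qed.

Lemma bilC A x y : A^T = A -> bil A x y = bil A y x.
Proof.
move=> sA; have -> : bil A x y = (x^T *m A *m y)^T 0 0 by rewrite mxE.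
by rewrite !trmx_mul trmxK sA mulmxA.
Qed.

Lemma bil_suml A (I : Type) (r : seq I) (P : pred I) (f : I -> 'cV[R]_m) y :
  bil A (\sum_(i <- r | P i) f i) y = \sum_(i <- r | P i) bil A (f i) y.
Proof.
elim: r => [|i r IH]; first by rewrite !big_nil bil0l.
by rewrite !big_cons; case: (P i) => //; rewrite bilDl IH.
Qed.

Lemma bil_sumr A (I : Type) (r : seq I) (P : pred I) (f : I -> 'cV[R]_m) y :
  bil A y (\sum_(i <- r | P i) f i) = \sum_(i <- r | P i) bil A y (f i).
Proof.
elim: r => [|i r IH]; first by rewrite !big_nil bil0r.
by rewrite !big_cons; case: (P i) => //; rewrite bilDr IH.
Qed.

Lemma bil_nondeg A x y : A \in unitmx -> (forall z, bil A x z = bil A y z) ->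
  x = y.
Proof.
move=> Au xy; have : x^T *m A = y^T *m A.
  apply/matrixP => i j; rewrite ord1.
  by have := xy (delta_mx j 0); rewrite /bil -!colE [LHS]mxE [RHS]mxE.
move/(congr1 (mulmxr (invmx A))); rewrite /= !mulmxK// => /(congr1 trmx).
by rewrite !trmxK.
Qed.

Lemma posdef_unitmx A : A^T = A -> (forall x, x != 0 -> 0 < bil A x x) ->
  A \in unitmx.
Proof.
move=> sA Apos; rewrite -row_free_unit -kermx_eq0; apply/eqP/row_matrixP => i.
rewrite row0; apply/eqP; apply: contraT => ri.
have /Apos : (row i (kermx A))^T != 0 by rewrite -trmx0 (inj_eq trmx_inj).
rewrite /bil trmxK; have /sub_kermxP -> : (row i (kermx A) <= kermx A)%MS.
  exact: row_sub.
by rewrite mul0mx mxE ltxx.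
Qed.

Lemma is_derive_bil (E : normedModType R) (A : E -> 'M[R]_m)
    (f h : E -> 'cV[R]_m) (u v : E) dA df dh :
  is_derive u v A dA -> is_derive u v f df -> is_derive u v h dh ->
  is_derive u v (fun u => bil (A u) (f u) (h u))
    (bil dA (f u) (h u) + bil (A u) df (h u) + bil (A u) (f u) dh).
Proof.
move=> DA Df Dh.
have := is_derive_mulmx (is_derive_mulmx (is_derive_trmx Df) DA) Dh.
move=> /is_derive_mxP/(_ 0 0) D; apply: (is_derive_eq D).
rewrite mulmxDl [LHS]mxE [X in X + _]mxE; congr (_ + _); exact: addrC.
Qed.

End BilinearForm.

(* Sealed: conversion tests between distinct derivatives or curvature terms
   unfold to limits and do not terminate in practice. *)
HB.lock Definition dirder (R : realType) (E : normedModType R) (p q : nat)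
    (F : E -> 'M[R]_(p, q)) (v u : E) : 'M[R]_(p, q) :=
  'D_v F u.

Lemma dirderE (R : realType) (E : normedModType R) (p q : nat)
    (F : E -> 'M[R]_(p, q)) (v u : E) : dirder F v u = 'D_v F u.
Proof. by rewrite dirder.unlock. Qed.

Section SealedDerivative.
Context {R : realType} {E : normedModType R}.
Variables (U : set E) (p q : nat) (F : E -> 'M[R]_(p, q)).
Hypothesis oU : open U.

Lemma dirder_eq u v d : is_derive u v F d -> dirder F v u = d.
Proof. by rewrite dirderE => -[]. Qed.

Lemma dirder_ext (G : E -> 'M[R]_(p, q)) u v : (forall x, U x -> F x = G x) ->
  U u -> dirder F v u = dirder G v u.
Proof. by move=> FG Uu; rewrite !dirderE; exact: derive_on_ext oU FG Uu. Qed.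

Hypothesis Fs : smooth_on U F.

Lemma dirder_smooth v : smooth_on U (dirder F v).
Proof. by rewrite dirder.unlock; exact: smooth_onD. Qed.

Lemma is_derive_dirder u v : U u -> is_derive u v F (dirder F v u).
Proof. by rewrite dirderE; exact: smooth_on_derivable. Qed.

Lemma dirder_linear a v w u : U u ->
  dirder F (a *: v + w) u = a *: dirder F v u + dirder F w u.
Proof. by rewrite !dirderE; exact: smooth_derive_linear. Qed.

Lemma dirderC v w u : U u -> dirder (dirder F v) w u = dirder (dirder F w) v u.
Proof. by rewrite dirder.unlock; exact: smooth_derive_comm. Qed.

End SealedDerivative.

HB.lock Definition connection (R : realType) (m : nat)
    (g : 'cV[R]_m -> 'M[R]_m) (u x y : 'cV[R]_m) : 'cV[R]_m :=
  christoffel g u x y.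

(** For fixed [x] the connection is a matrix acting on the second argument, so it is differentiated
    by the product rule for matrices and the curvature takes the form [d Gamma + [Gamma, Gamma]]. *)
HB.lock Definition christoffel_mx (R : realType) (m : nat)
    (g : 'cV[R]_m -> 'M[R]_m) (x u : 'cV[R]_m) : 'M[R]_m :=
  \matrix_(l, j) connection g u x (delta_mx j 0) l 0.

HB.lock Definition curvature_mx (R : realType) (m : nat)
    (g : 'cV[R]_m -> 'M[R]_m) (x y u : 'cV[R]_m) : 'M[R]_m :=
  dirder (christoffel_mx g y) x u - dirder (christoffel_mx g x) y u +
  (christoffel_mx g x u *m christoffel_mx g y u
   - christoffel_mx g y u *m christoffel_mx g x u).

HB.lock Definition riemann_form (R : realType) (m : nat)
    (g : 'cV[R]_m -> 'M[R]_m) (u x y z w : 'cV[R]_m) : R :=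
  riemann g u x y z w.

(** * The Levi-Civita connection and the symmetries of its curvature *)

Section LocalGeometry.
Context {R : realType} {m : nat}.
Local Notation E := 'cV[R]_m.
Variables (U : set E) (g : E -> 'M[R]_m).
Hypothesis oU : open U.
Hypothesis gs : smooth_on U g.
Hypothesis gsym : forall u, U u -> (g u)^T = g u.
Hypothesis gpos : forall u, U u -> forall v : E, v != 0 -> 0 < bil (g u) v v.

Lemma metric_unit u : U u -> g u \in unitmx.
Proof. by move=> Uu; apply: posdef_unitmx; [exact: gsym|exact: gpos]. Qed.

Lemma metricC u x y : U u -> bil (g u) x y = bil (g u) y x.
Proof. by move=> Uu; apply: bilC; exact: gsym. Qed.

Lemma metric_inj u x y : U u -> (forall z, bil (g u) x z = bil (g u) y z) ->
  x = y.
Proof. by move=> /metric_unit; exact: bil_nondeg. Qed.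

Local Notation dmetric := (dirder g).

Lemma dmetric_smooth v : smooth_on U (dmetric v).
Proof. exact: dirder_smooth. Qed.

Lemma dmetric_linear a v w u : U u ->
  dmetric (a *: v + w) u = a *: dmetric v u + dmetric w u.
Proof. exact: dirder_linear. Qed.

Lemma is_derive_metric v u : U u -> is_derive u v g (dmetric v u).
Proof. exact: is_derive_dirder. Qed.

Lemma dmetric_sym v u : U u -> (dmetric v u)^T = dmetric v u.
Proof.
move=> Uu; rewrite -(dirder_eq (is_derive_trmx (is_derive_metric v Uu))).
by apply: (dirder_ext oU _ _ Uu) => y; exact: gsym.
Qed.

(** Christoffel symbols of the first kind; an arbitrary vector [w] replaces the basis vectors that
    occur in [christoffel]. *)
Definition koszul (u x y w : E) : R :=
  2^-1 * (bil (dmetric x u) y w + bil (dmetric y u) x w - bil (dmetric w u) x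
    y).

Lemma koszul_linear u x y a v z : U u ->
  koszul u x y (a *: v + z) = a * koszul u x y v + koszul u x y z.
Proof.
move=> Uu; rewrite /koszul (dmetric_linear a v z Uu).
rewrite bil_mxD bil_mxZ !(bilDr, bilZr).
by ring.
Qed.

Lemma christoffelP u x y w : U u ->
  bil (g u) (connection g u x y) w = koszul u x y w.
Proof.
move=> Uu; rewrite connection.unlock /christoffel; set c := \col_l _.
rewrite bil_mull trmx_inv gsym// mulVmx ?metric_unit//.
have -> : bil 1%:M c w = \sum_l w l 0 * koszul u x y (delta_mx l 0).
  rewrite /bil mulmx1 mxE; apply: eq_bigr => l _.
  by rewrite !mxE /koszul !dirderE mulrC.
rewrite -(@linear_sum_basis _ _ R^o (fun w => koszul u x y w))// => a v z.
exact: koszul_linear.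
Qed.

(** This is [nabla g = 0], read on fields with constant components. *)
Lemma christoffel_metric u x y z : U u ->
  bil (dmetric x u) y z =
  bil (g u) (connection g u x y) z + bil (g u) y (connection g u x z).
Proof.
move=> Uu; rewrite (metricC y)// !christoffelP// /koszul.
by rewrite (bilC z y (dmetric_sym x Uu)); field.
Qed.

Lemma christoffelC u x y : U u -> connection g u x y = connection g u y x.
Proof.
move=> Uu; apply: (metric_inj Uu) => z; rewrite !christoffelP// /koszul.
by rewrite (bilC x y (dmetric_sym z Uu)); ring.
Qed.

Lemma christoffel_linearr u x a y z : U u ->
  connection g u x (a *: y + z) =
  a *: connection g u x y + connection g u x z.
Proof.
move=> Uu; apply: (metric_inj Uu) => w.
rewrite bilDl bilZl !christoffelP// /koszul (dmetric_linear a y z Uu).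
by rewrite !(bilDl, bilZl, bilDr, bilZr) bil_mxD bil_mxZ; ring.
Qed.

Lemma christoffel_linearl u a x y z : U u ->
  connection g u (a *: x + y) z =
  a *: connection g u x z + connection g u y z.
Proof. by move=> Uu; rewrite !(christoffelC _ z)// christoffel_linearr. Qed.

Lemma christoffel0l u z : U u -> connection g u 0 z = 0.
Proof.
move=> Uu; have := christoffel_linearl 1 0 0 z Uu.
by rewrite !scale1r addr0 => /eqP; rewrite eq_sym -subr_eq0 addrK => /eqP.
Qed.

Lemma christoffel_mx_entry x u l j :
  christoffel_mx g x u l j = connection g u x (delta_mx j 0) l 0.
Proof. by rewrite christoffel_mx.unlock mxE. Qed.

Lemma christoffel_mxE x u y : U u ->
  christoffel_mx g x u *m y = connection g u x y.
Proof.
move=> Uu; rewrite (linear_sum_basis (L := connection g u x))//; last first.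
  by move=> a v w; exact: christoffel_linearr.
apply/matrixP => l j; rewrite ord1 mxE summxE; apply: eq_bigr => i _.
by rewrite christoffel_mx_entry mxE mulrC.
Qed.

Lemma christoffel_mxC x y u : U u ->
  christoffel_mx g x u *m y = christoffel_mx g y u *m x.
Proof. by move=> Uu; rewrite !christoffel_mxE// christoffelC. Qed.

Lemma christoffel_mx_linear a x y u : U u ->
  christoffel_mx g (a *: x + y) u = a *: christoffel_mx g x u + christoffel_mx
    g y u.
Proof.
move=> Uu; apply/matrixP => l j; rewrite christoffel_mx_entry.
by rewrite (christoffel_linearl a x y _ Uu) !mxE !christoffel_mx_entry.
Qed.

Lemma smooth_bil (A : E -> 'M[R]_m) x y : smooth_on U A ->
  smooth_on U (fun u => bil (A u) x y).
Proof.
move=> As; apply: smooth_on_coord => // k.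
apply: Ck_on_mulmx => //; last exact: Ck_on_cst.
by apply: Ck_on_mulmx => //; exact: Ck_on_cst.
Qed.

Lemma christoffel_mx_smooth x : smooth_on U (christoffel_mx g x).
Proof.
move=> k; apply/Ck_on_mxP => // l j.
apply: (@Ck_on_ext _ _ k U _ (fun u => (invmx (g u) *m
  \col_l koszul u x (delta_mx j 0) (delta_mx l 0)) l 0)) => //.
  move=> u _; rewrite christoffel_mx_entry connection.unlock /christoffel.
  by congr ((_ *m _) _ _); apply/matrixP => a b; rewrite !mxE /koszul !dirderE.
apply: (proj1 (Ck_on_mxP k (fun u => invmx (g u) *m
  \col_l koszul u x (delta_mx j 0) (delta_mx l 0)) oU)).
apply: Ck_on_mulmx => //.
  by apply: Ck_on_invmx => //; exact: metric_unit.
apply/Ck_on_mxP => // i i'.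
apply: (@Ck_on_ext _ _ k U _
  (fun u => koszul u x (delta_mx j 0) (delta_mx i 0))) => //.
  by move=> u _; rewrite mxE.
apply: Ck_on_mul => //; first exact: Ck_on_cst.
apply: Ck_on_add => //.
  by apply: Ck_on_add => //; apply: smooth_bil; exact: dmetric_smooth.
by apply: Ck_on_opp => //; apply: smooth_bil; exact: dmetric_smooth.
Qed.

Local Notation dchristoffel v x := (dirder (christoffel_mx g x) v).

Lemma is_derive_christoffel_mx v x u : U u ->
  is_derive u v (christoffel_mx g x) (dchristoffel v x u).
Proof. by apply: is_derive_dirder; exact: christoffel_mx_smooth. Qed.

Lemma dchristoffelC v x y u : U u ->
  dchristoffel v x u *m y = dchristoffel v y u *m x.
Proof.
move=> Uu.
have D z (w : E) := is_derive_mulmx (is_derive_christoffel_mx v z Uu)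
  (is_derive_const w u v).
have := dirder_eq (D x y); have := dirder_eq (D y x).
rewrite !mulmx0 !addr0 => <- <-.
by apply: (dirder_ext oU _ _ Uu) => w Uw; exact: christoffel_mxC.
Qed.

Lemma dchristoffel_linearl a v w x u : U u ->
  dchristoffel (a *: v + w) x u = a *: dchristoffel v x u + dchristoffel w x u.
Proof.
by move=> Uu; exact: (dirder_linear oU (christoffel_mx_smooth x)).
Qed.

Lemma dchristoffel_linearr a v x y u : U u ->
  dchristoffel v (a *: x + y) u = a *: dchristoffel v x u + dchristoffel v y u.
Proof.
move=> Uu.
have D := is_derive_add (is_derive_scale (is_derive_const a u v)
  (is_derive_christoffel_mx v x Uu)) (is_derive_christoffel_mx v y Uu).
have := dirder_eq D; rewrite scale0r add0r => <-.
by apply: (dirder_ext oU _ _ Uu) => w Uw; exact: christoffel_mx_linear.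
Qed.

(** Fields with constant components have zero bracket, and their covariant derivatives reduce to
    Christoffel terms. *)
Lemma curvature_opE x y z u : U u ->
  curvature_op g (cst x) (cst y) (cst z) u = curvature_mx g x y u *m z.
Proof.
move=> Uu; rewrite /curvature_op.
have lc a b v : U v ->
    levi_civita g (cst a) (cst b) v = christoffel_mx g a v *m b.
  move=> Uv; rewrite /levi_civita derive_cst add0r christoffel_mxE//.
  by rewrite connection.unlock.
have lc2 a b c : levi_civita g (cst a) (levi_civita g (cst b) (cst c)) u =
    dchristoffel a b u *m c + christoffel_mx g a u *m (christoffel_mx g b u *m
      c).
  rewrite {1}/levi_civita lc//; congr (_ + _); last first.
    by rewrite (christoffel_mxE a _ Uu) connection.unlock.
  rewrite (derive_on_ext _ oU (fun v Uv => lc b c v Uv) Uu) -dirderE.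
  rewrite (dirder_eq (is_derive_mulmx (is_derive_christoffel_mx a b Uu)
    (is_derive_const c u a))).
  by rewrite mulmx0 addr0.
have -> : levi_civita g (lie_bracket (cst x) (cst y)) (cst z) u = 0.
  rewrite /levi_civita /lie_bracket !derive_cst subrr add0r.
  by have := christoffel0l z Uu; rewrite connection.unlock.
rewrite !lc2 subr0 curvature_mx.unlock mulmxDl !mulmxBl !mulmxA.
by matrix_sum_ring.
Qed.

Lemma riemannE u x y z w : U u ->
  riemann_form g u x y z w = bil (g u) (curvature_mx g x y u *m z) w.
Proof. by move=> Uu; rewrite riemann_form.unlock /riemann curvature_opE. Qed.

Lemma curvature_mxC x y u : curvature_mx g x y u = - curvature_mx g y x u.
Proof. by rewrite curvature_mx.unlock opprD !opprB. Qed.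

Lemma curvature_mx_linearl a x y z u : U u ->
  curvature_mx g (a *: x + y) z u = a *: curvature_mx g x z u + curvature_mx g
    y z u.
Proof.
move=> Uu; rewrite curvature_mx.unlock dchristoffel_linearl//
  dchristoffel_linearr//.
rewrite christoffel_mx_linear// !(mulmxDl, mulmxDr) -scalemxAl -scalemxAr.
by matrix_sum_ring.
Qed.

(** The terms cancel in pairs, by symmetry of the Christoffel symbols in their lower indices and the
    same symmetry of their derivatives. *)
Lemma bianchi x y z u : U u ->
  curvature_mx g x y u *m z + curvature_mx g y z u *m x + curvature_mx g z x u
    *m y = 0.
Proof.
move=> Uu; rewrite curvature_mx.unlock !mulmxDl !mulNmx -!mulmxA.
rewrite (dchristoffelC x y z Uu) (dchristoffelC y x z Uu) (dchristoffelC z y x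
  Uu).
rewrite (christoffel_mxC y z Uu) (christoffel_mxC x z Uu) (christoffel_mxC y x
  Uu).
by matrix_sum_ring.
Qed.

Lemma dmetricE x u : U u ->
  dmetric x u = (christoffel_mx g x u)^T *m g u + g u *m christoffel_mx g x u.
Proof.
move=> Uu; apply/matrixP => i j.
have := christoffel_metric x (delta_mx i 0) (delta_mx j 0) Uu.
rewrite -!christoffel_mxE// bil_mull bil_mulr -bil_mxD /bil.
by rewrite -!colE !trmx_delta -!rowE !mxE.
Qed.

(** The second derivatives of [g] are computed from [nabla g = 0] in both orders; their equality
    leaves exactly the curvature terms. *)
Lemma curvature_mx_skew x y u : U u ->
  (curvature_mx g x y u)^T *m g u + g u *m curvature_mx g x y u = 0.
Proof.
move=> Uu.
have dd a b : dirder (dmetric b) a u =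
    (dchristoffel a b u)^T *m g u + (christoffel_mx g b u)^T *m dmetric a u
    + (dmetric a u *m christoffel_mx g b u + g u *m dchristoffel a b u).
  rewrite (dirder_ext oU _ (fun v Uv => dmetricE b Uv) Uu).
  apply: dirder_eq; exact: is_derive_add
    (is_derive_mulmx (is_derive_trmx (is_derive_christoffel_mx a b Uu))
      (is_derive_metric a Uu))
    (is_derive_mulmx (is_derive_metric a Uu) (is_derive_christoffel_mx a b Uu)).
have := dirderC oU gs y x Uu.
rewrite !dd => /eqP; rewrite -subr_eq0 => /eqP => H.
rewrite -[RHS]H curvature_mx.unlock !dmetricE//.
rewrite !(trmx_add, trmx_opp) !trmx_mul !(mulmxDl, mulmxDr, mulmxBl, mulmxBr).
rewrite !(mulNmx, mulmxN) !mulmxA.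
by matrix_sum_ring.
Qed.

Lemma riemann_skewl u x y z w : U u ->
  riemann_form g u x y z w = - riemann_form g u y x z w.
Proof. by move=> Uu; rewrite !riemannE// curvature_mxC mulNmx bilNl. Qed.

Lemma riemann_skewr u x y z w : U u ->
  riemann_form g u x y z w = - riemann_form g u x y w z.
Proof.
move=> Uu; rewrite !riemannE// [X in - X]metricC// bil_mull bil_mulr.
have /eqP := curvature_mx_skew x y Uu; rewrite addr_eq0 => /eqP ->.
by rewrite bil_mxN.
Qed.

Lemma riemann_bianchi u x y z w : U u ->
  riemann_form g u x y z w + riemann_form g u y z x w + riemann_form g u z x y
    w = 0.
Proof. by move=> Uu; rewrite !riemannE// -!bilDl bianchi// bil0l. Qed.

(** The octahedron argument: four instances of the Bianchi identity combined linearly with the two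
    skew symmetries. *)
Lemma riemann_pairC u x y z w : U u ->
  riemann_form g u x y z w = riemann_form g u z w x y.
Proof.
move=> Uu.
have s1 a b c d := riemann_skewl a b c d Uu.
have s2 a b c d := riemann_skewr a b c d Uu.
have B a b c d := riemann_bianchi a b c d Uu.
have := B x y z w; have := B y z w x; have := B z w x y; have := B w x y z.
have := s2 y z w x; have := s2 z w x y; have := s2 x y w z.
have := s1 x z w y; have := s2 z x w y; have := s1 w x y z.
have := s2 w x y z; have := s1 y w x z; have := s2 w y x z.
by lra.
Qed.

Lemma riemann_linear1 u a x x' y z w : U u ->
  riemann_form g u (a *: x + x') y z w = a * riemann_form g u x y z w +
    riemann_form g u x' y z w.
Proof.
by move=> Uu; rewrite !riemannE// curvature_mx_linearl// mulmxDl -scalemxAl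
  bilDl bilZl.
Qed.

Lemma riemann_linear3 u a x y z z' w : U u ->
  riemann_form g u x y (a *: z + z') w = a * riemann_form g u x y z w +
    riemann_form g u x y z' w.
Proof. by move=> Uu; rewrite !riemannE// mulmxDr -scalemxAr bilDl bilZl. Qed.

Lemma riemann_linear2 u a x y y' z w : U u ->
  riemann_form g u x (a *: y + y') z w = a * riemann_form g u x y z w +
    riemann_form g u x y' z w.
Proof.
move=> Uu; rewrite riemann_skewl// riemann_linear1// (riemann_skewl x y)//.
by rewrite (riemann_skewl x y')//; ring.
Qed.

Lemma riemann_linear4 u a x y z w w' : U u ->
  riemann_form g u x y z (a *: w + w') = a * riemann_form g u x y z w +
    riemann_form g u x y z w'.
Proof. by move=> Uu; rewrite !riemannE// bilDr bilZr. Qed.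

End LocalGeometry.

(** * Metrics of constant curvature 1 are conformally flat *)

Section BlockDerivatives.
Context {R : realType} {E : normedModType R} {p1 p2 q1 q2 : nat}.

Lemma is_derive_block_mx (A : E -> 'M[R]_(p1, q1)) (B : E -> 'M[R]_(p1, q2))
    (C : E -> 'M[R]_(p2, q1)) (D : E -> 'M[R]_(p2, q2)) u v dA dB dC dD :
  is_derive u v A dA -> is_derive u v B dB -> is_derive u v C dC ->
  is_derive u v D dD ->
  is_derive u v (fun u => block_mx (A u) (B u) (C u) (D u))
    (block_mx dA dB dC dD).
Proof.
move=> /is_derive_mxP hA /is_derive_mxP hB /is_derive_mxP hC /is_derive_mxP hD.
apply/is_derive_mxP => i j; rewrite -(splitK i) -(splitK j).
case: (fintype.split i) => a; case: (fintype.split j) => b; rewrite /unsplit.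
- rewrite block_mxEul; apply: is_derive_fun_eq (hA a b) => w.
  by rewrite block_mxEul.
- rewrite block_mxEur; apply: is_derive_fun_eq (hB a b) => w.
  by rewrite block_mxEur.
- rewrite block_mxEdl; apply: is_derive_fun_eq (hC a b) => w.
  by rewrite block_mxEdl.
- rewrite block_mxEdr; apply: is_derive_fun_eq (hD a b) => w.
  by rewrite block_mxEdr.
Qed.

Lemma Ck_on_block_mx k (U : set E) (A : E -> 'M[R]_(p1, q1))
    (B : E -> 'M[R]_(p1, q2)) (C : E -> 'M[R]_(p2, q1)) (D : E -> 'M[R]_(p2,
      q2)) :
  open U -> Ck_on k U A -> Ck_on k U B -> Ck_on k U C -> Ck_on k U D ->
  Ck_on k U (fun u => block_mx (A u) (B u) (C u) (D u)).
Proof.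
move=> oU /Ck_on_mxP hA /Ck_on_mxP hB /Ck_on_mxP hC /Ck_on_mxP hD.
apply/Ck_on_mxP => // i j; rewrite -(splitK i) -(splitK j).
case: (fintype.split i) => a; case: (fintype.split j) => b; rewrite /unsplit.
- apply: Ck_on_ext (hA oU a b) => // w _; by rewrite block_mxEul.
- apply: Ck_on_ext (hB oU a b) => // w _; by rewrite block_mxEur.
- apply: Ck_on_ext (hC oU a b) => // w _; by rewrite block_mxEdl.
- apply: Ck_on_ext (hD oU a b) => // w _; by rewrite block_mxEdr.
Qed.

End BlockDerivatives.

Lemma mx11_mulE (R : realType) (m : nat) (A : 'M[R]_m) (x y : 'cV[R]_m) :
  x^T *m A *m y = (bil A x y)%:M.
Proof. by rewrite /bil -mx11_scalar. Qed.

Section ConstantCurvature.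
Context {R : realType} {m : nat}.
Local Notation E := 'cV[R]_m.
Variables (U : set E) (g : E -> 'M[R]_m).
Hypothesis oU : open U.
Hypothesis gs : smooth_on U g.
Hypothesis gsym : forall u, U u -> (g u)^T = g u.
Hypothesis gpos : forall u, U u -> forall v : E, v != 0 -> 0 < bil (g u) v v.
Hypothesis curv1 : forall u x y z, U u ->
  curvature_mx g x y u *m z = bil (g u) y z *: x - bil (g u) x z *: y.

(* Parallel sections (V, h) of the flat cone connection on TM + R are the pairs
   with h a solution of Hess h = - h g and V its gradient. *)
Definition cone_connection (x u : E) : 'M[R]_(m + 1) :=
  block_mx (- christoffel_mx g x u) (- x) (x^T *m g u) 0.

Lemma cone_connection_smooth x : smooth_on U (cone_connection x).
Proof.
move=> k; apply: Ck_on_block_mx => //.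
- by apply: Ck_on_opp => //; exact: christoffel_mx_smooth.
- exact: Ck_on_cst.
- by apply: Ck_on_mulmx => //; exact: Ck_on_cst.
- exact: Ck_on_cst.
Qed.

Lemma cone_connection_linear a x y u : U u ->
  cone_connection (a *: x + y) u =
  a *: cone_connection x u + cone_connection y u.
Proof.
move=> Uu; rewrite /cone_connection.
rewrite (christoffel_mx_linear oU gs gsym gpos a x y Uu).
rewrite scale_block_mx add_block_mx; congr block_mx.
- by rewrite opprD scalerN.
- by rewrite opprD scalerN.
- rewrite trmx_add mulmxDl scalemxAl; congr (_ *m _ + _).
  by apply/matrixP => i j; rewrite !mxE.
- by rewrite scaler0 addr0.
Qed.

(** The four blocks express in turn that the curvature is that of the unit sphere, that the
    Christoffel symbols are symmetric, the same symmetry together with [nabla g = 0], and that [g]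
    is symmetric. *)
Lemma cone_connection_flat x y u : U u ->
  'D_x (cone_connection y) u + cone_connection y u *m cone_connection x u =
  'D_y (cone_connection x) u + cone_connection x u *m cone_connection y u.
Proof.
move=> Uu.
have dA a b : 'D_a (cone_connection b) u =
    block_mx (- dirder (christoffel_mx g b) a u) 0 (b^T *m dirder g a u) 0.
  have dl := is_derive_mulmx (is_derive_const b^T u a)
    (is_derive_metric gs a Uu).
  rewrite mul0mx add0r in dl.
  by have [_ ->] := is_derive_block_mx
    (is_derive_opp (is_derive_christoffel_mx oU gs gsym gpos a b Uu))
    (is_derive_const (- b) u a) dl (is_derive_const (0 : 'M[R]_1) u a).
rewrite !dA /cone_connection !mulmx_block !add_block_mx.
congr block_mx.
- have R0 : curvature_mx g x y u = x *m (y^T *m g u) - y *m (x^T *m g u).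
    have mx_ext (P Q : 'M[R]_m) : (forall z : E, P *m z = Q *m z) -> P = Q.
      move=> PQ; apply/matrixP => i j; have := PQ (delta_mx j 0).
      by rewrite -!colE => /matrixP/(_ i 0); rewrite !mxE.
    apply: mx_ext => z; rewrite (curv1 x y z Uu) mulmxBl -!mulmxA.
    by rewrite !(mulmxA _ (g u) z) !mx11_mulE !mul_mx_scalar.
  move: R0; rewrite curvature_mx.unlock !(mulNmx, mulmxN, opprK).
  move: (dirder _ _ _) (dirder _ _ _) => P Q /eqP.
  rewrite -subr_eq0 => /eqP H; apply/eqP; rewrite -subr_eq0 -oppr_eq0 -H.
  by apply/eqP; matrix_sum_ring.
- rewrite !mulmx0 !addr0 !add0r mulNmx mulmxN opprK mulNmx mulmxN opprK.
  exact: christoffel_mxC oU gs gsym gpos _ _ _ Uu.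
- rewrite !mul0mx !addr0 !(dmetricE oU gs gsym gpos)// !mulmxN -!mulmxA.
  rewrite !mulmxDr !mulmxA addrK addrK -!trmx_mul.
  by rewrite (christoffel_mxC oU gs gsym gpos _ _ Uu).
- rewrite !mulmx0 !addr0 !add0r !mulmxN !mx11_mulE.
  by rewrite (metricC gsym _ _ Uu).
Qed.

Lemma exists_parallel_section p : U p ->
  exists (r : R) (V : E -> E) (h : E -> R),
  [/\ 0 < r, forall u, `|u - p| < r -> U u, V p = 0 /\ h p = 1,
      smooth_on [set u | `|u - p| < r] h /\
      smooth_on [set u | `|u - p| < r] V &
      forall u x, `|u - p| < r ->
        is_derive u x V (- (christoffel_mx g x u *m V u) - h u *: x) /\
        is_derive u x h (bil (g u) x (V u))].
Proof.
move=> Up.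
have [r [r0 rU [Y [Yp Ys Yd]]]] := frobenius_smooth oU Up
  cone_connection_smooth cone_connection_linear
  (fun h k x Ux => cone_connection_flat h k Ux).
have oB := open_norm_ball p r.
pose Z0 : 'cV[R]_(m + 1) := col_mx 0 1.
pose Z u := Y u *m Z0.
exists r, (fun u => usubmx (Z u)), (fun u => dsubmx (Z u) 0 0); split=> //.
- by rewrite /Z Yp mul1mx col_mxKu col_mxKd mxE eqxx.
- have Zs : smooth_on [set u | `|u - p| < r] Z.
    by move=> k; apply: Ck_on_mulmx => //; exact: Ck_on_cst.
  split.
    apply: (@smooth_on_ext _ _ _ _ (fun u => Z u (rshift m 0) 0)) => //.
      by move=> u _; rewrite [RHS]mxE.
    exact: smooth_on_coord.
  move=> k; apply/Ck_on_mxP => // i j.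
  apply: (@Ck_on_ext _ _ _ _ _ (fun u => Z u (lshift 1 i) j)) => //.
    by move=> u _; rewrite [RHS]mxE.
  exact: (smooth_on_coord (lshift 1 i) j oB Zs k).
- move=> u x ur.
  have dZ : is_derive u x Z (cone_connection x u *m Z u).
    have := is_derive_mulmx (Yd u x ur) (is_derive_const Z0 u x).
    by rewrite mulmx0 addr0 -mulmxA.
  have ZE : cone_connection x u *m Z u =
      col_mx (- (christoffel_mx g x u *m usubmx (Z u)) - dsubmx (Z u) 0 0 *: x)
        (bil (g u) x (usubmx (Z u)))%:M.
    rewrite -{1}(vsubmxK (Z u)) /cone_connection mul_block_col mul0mx addr0.
    rewrite mx11_mulE mulNmx; congr (col_mx (_ + _) _).
    by rewrite {1}[dsubmx (Z u)]mx11_scalar mul_mx_scalar scalerN.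
  rewrite ZE in dZ; move/is_derive_mxP: dZ => dZ; split.
    apply/is_derive_mxP => i j.
    have := dZ (lshift 1 i) j; rewrite col_mxEu.
    by apply: is_derive_fun_eq => w; rewrite [RHS]mxE.
  have := dZ (rshift m 0) 0; rewrite col_mxEd mxE eqxx mulr1n.
  by apply: is_derive_fun_eq => w; rewrite [RHS]mxE.
Qed.

End ConstantCurvature.

(** * Conformal change to a flat metric *)

Section ConformalChange.
Context {R : realType} {m : nat}.
Local Notation E := 'cV[R]_m.
Variables (W : set E) (g : E -> 'M[R]_m) (V : E -> E) (h : E -> R).
Hypothesis oW : open W.
Hypothesis gs : smooth_on W g.
Hypothesis gsym : forall u, W u -> (g u)^T = g u.
Hypothesis gpos : forall u, W u -> forall v : E, v != 0 -> 0 < bil (g u) v v.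
Hypothesis curv1 : forall u x y z, W u ->
  curvature_mx g x y u *m z = bil (g u) y z *: x - bil (g u) x z *: y.
Hypothesis hs : smooth_on W h.
Hypothesis dV : forall u x, W u ->
  is_derive u x V (- (christoffel_mx g x u *m V u) - h u *: x).
Hypothesis dh : forall u x, W u -> is_derive u x h (bil (g u) x (V u)).
Hypothesis h_gt : forall u, W u -> 0 < 1 + h u.
Hypothesis hV : forall u, W u -> h u ^+ 2 + bil (g u) (V u) (V u) = 1.

Let w (u : E) : R := (1 + h u)^-1.
Let gt (u : E) : 'M[R]_m := (w u ^+ 2) *: g u.

Let w_gt0 u : W u -> 0 < w u.
Proof. by move=> Wu; rewrite invr_gt0 h_gt. Qed.

Lemma conformal_factor_smooth : smooth_on W (fun u => (1 + h u)^-1 ^+ 2).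
Proof.
have ws k : Ck_on k W w.
  apply: Ck_on_inv => // [u Wu|]; first by rewrite lt0r_neq0 ?h_gt.
  by apply: Ck_on_add => //; exact: Ck_on_cst.
move=> k; apply: (@Ck_on_ext _ _ _ _ _ (fun u => w u * w u)) => //.
exact: Ck_on_mul.
Qed.

Let gts : smooth_on W gt.
Proof. by move=> k; apply: Ck_on_scale => //; exact: conformal_factor_smooth.
  Qed.

Let gtsym u : W u -> (gt u)^T = gt u.
Proof.
by move=> Wu; apply/matrixP => i j; rewrite /gt !mxE -[in RHS](gsym Wu) mxE.
Qed.

Let gtpos u : W u -> forall v : E, v != 0 -> 0 < bil (gt u) v v.
Proof.
by move=> Wu v v0; rewrite bil_mxZ mulr_gt0 ?gpos// exprn_gt0// w_gt0.
Qed.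

Let is_derive_w u x : W u ->
  is_derive u x w (- w u ^+ 2 * bil (g u) x (V u)).
Proof.
move=> Wu; have := is_derive_add (is_derive_const (1 : R) u x) (dh x Wu).
rewrite add0r => D; have h0 : 1 + h u != 0 by rewrite lt0r_neq0 ?h_gt.
by have := @is_derive_inv _ _ (fun u => 1 + h u) u x _ h0 D; rewrite /w exprVn.
Qed.

Let bil_dg u x y z : W u -> bil (dirder g x u) y z =
  bil (g u) (christoffel_mx g x u *m y) z + bil (g u) y (christoffel_mx g x u
    *m z).
Proof.
by move=> Wu; rewrite (dmetricE oW gs gsym gpos)// bil_mxD -bil_mull -bil_mulr.
Qed.

(* The Christoffel symbols of e^(2 s) g with s = - ln (1 + h), grad h = V. *)
Definition conformal_christoffel (y z v : E) : E :=
  christoffel_mx g y v *m z - w v *: (bil (g v) y (V v) *: z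
    + bil (g v) z (V v) *: y - bil (g v) y z *: V v).

Lemma conformal_christoffelE y z v : W v ->
  christoffel_mx gt y v *m z = conformal_christoffel y z v.
Proof.
move=> Wv; rewrite (christoffel_mxE oW gts gtsym gtpos)//.
apply: (metric_inj gtsym gtpos Wv) => t.
rewrite (christoffelP oW gts gtsym gtpos)// /koszul.
have dgt x : dirder gt x v =
    (- 2 * w v ^+ 3 * bil (g v) x (V v)) *: g v + w v ^+ 2 *: dirder g x v.
  have D := is_derive_mul (is_derive_w x Wv) (is_derive_w x Wv).
  rewrite (dirder_eq (is_derive_scale D (is_derive_metric gs x Wv))).
  by congr (_ *: _ + _); ring.
rewrite !dgt !bil_mxD !bil_mxZ !bil_dg// /conformal_christoffel.
rewrite !(bilBl, bilDl, bilZl).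
rewrite (christoffel_mxC oW gs gsym gpos z y Wv).
rewrite (christoffel_mxC oW gs gsym gpos t y Wv).
rewrite (christoffel_mxC oW gs gsym gpos t z Wv).
rewrite (metricC gsym (christoffel_mx g y v *m t) z Wv).
rewrite (metricC gsym t (V v) Wv).
by field.
Qed.

Let is_derive_conformal_christoffel x y z u : W u ->
  is_derive u x (conformal_christoffel y z)
    (dirder (christoffel_mx g y) x u *m z
     + (w u ^+ 2 * bil (g u) x (V u)) *: (bil (g u) y (V u) *: z
       + bil (g u) z (V u) *: y - bil (g u) y z *: V u)
     - w u *: ((bil (g u) (christoffel_mx g x u *m y) (V u)
                - h u * bil (g u) y x) *: z
       + (bil (g u) (christoffel_mx g x u *m z) (V u)
          - h u * bil (g u) z x) *: y
       - (bil (g u) (christoffel_mx g x u *m y) z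
          + bil (g u) y (christoffel_mx g x u *m z)) *: V u
       + bil (g u) y z *: (christoffel_mx g x u *m V u + h u *: x))).
Proof.
move=> Wu.
have dg := is_derive_metric gs x Wu.
have dyV t : is_derive u x (fun v => bil (g v) t (V v))
    (bil (g u) (christoffel_mx g x u *m t) (V u) - h u * bil (g u) t x).
  apply: (is_derive_eq (is_derive_bil dg (is_derive_const t u x) (dV x Wu))).
  by rewrite bil0l bil_dg// bilBr bilNr bilZr; ring.
have dyz := is_derive_bil dg (is_derive_const y u x) (is_derive_const z u x).
have dscale (t : E) (f : E -> R) df : is_derive u x f df ->
    is_derive u x (fun v => f v *: t) (df *: t).
  move=> D; have := is_derive_scale D (is_derive_const t u x).
  by rewrite scaler0 addr0.
have D1 := is_derive_add (dscale z _ _ (dyV y)) (dscale y _ _ (dyV z)).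
have D2 := is_derive_scale (is_derive_w x Wu)
  (is_derive_sub D1 (is_derive_scale dyz (dV x Wu))).
have D3 := is_derive_mulmx (is_derive_christoffel_mx oW gs gsym gpos x y Wu)
  (is_derive_const z u x).
apply: (is_derive_eq (is_derive_sub D3 D2)).
rewrite mulmx0 addr0 bil0l bil0r !addr0 bil_dg//.
move: (christoffel_mx g x u *m V u) (dirder _ _ _ *m z) => GV dG.
apply/matrixP => i j; rewrite !mxE; ring.
Qed.

(** Derivatives of [V] are eliminated by the parallel equation and [|V|^2] by [1 - h^2]. What
    remains is the curvature of [g] minus [2 w h + w^2 (1 - h^2)] times that of the unit sphere, and
    this coefficient is 1 because [w (1 + h) = 1]. *)
Lemma conformal_curvature0 x y (z : E) u : W u -> curvature_mx gt x y u *m z =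
  0.
Proof.
move=> Wu.
have dd a b : dirder (christoffel_mx gt b) a u *m z =
    dirder (conformal_christoffel b z) a u.
  have := is_derive_mulmx (is_derive_christoffel_mx oW gts gtsym gtpos a b Wu)
    (is_derive_const z u a).
  rewrite mulmx0 addr0 => /dirder_eq <-.
  by apply: (dirder_ext oW _ _ Wu) => v Wv; exact: conformal_christoffelE.
have R0 := curv1 x y z Wu; rewrite curvature_mx.unlock in R0.
rewrite curvature_mx.unlock mulmxDl !mulmxBl -!mulmxA !dd.
rewrite !(conformal_christoffelE _ _ Wu).
rewrite !(dirder_eq (is_derive_conformal_christoffel _ _ _ Wu)).
rewrite /conformal_christoffel.
have VV : bil (g u) (V u) (V u) = 1 - h u ^+ 2 by rewrite -(hV Wu); ring.
have wh : w u * (1 + h u) = 1 by rewrite mulVf// lt0r_neq0 ?h_gt.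
have Gxy := christoffel_mxC oW gs gsym gpos y x Wu.
have c1 : 2 * (w u * h u) + w u ^+ 2 * (1 - h u ^+ 2) = 1.
  have -> : w u * h u = 1 - w u by rewrite -[in RHS]wh; ring.
  have -> : w u ^+ 2 * (1 - h u ^+ 2) = w u ^+ 2 - (w u * h u) ^+ 2 by ring.
  have -> : w u * h u = 1 - w u by rewrite -[in RHS]wh; ring.
  ring.
move: R0; rewrite mulmxDl !mulmxBl -!mulmxA.
rewrite !(mulmxDr, mulmxN) -!scalemxAr !(mulmxDr, mulmxN) -!scalemxAr Gxy.
rewrite !(bilBl, bilDl, bilZl, bilBr, bilDr, bilZr) VV.
rewrite (metricC gsym z x Wu) (metricC gsym z y Wu) (metricC gsym y x Wu).
move: c1; move: (w u) (h u) => w1 h1 c1.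
move: (dirder _ _ _ *m z) (dirder _ _ _ *m z) => P Q.
move: (christoffel_mx g x u *m (christoffel_mx g y u *m z)) => XYz.
move: (christoffel_mx g y u *m (christoffel_mx g x u *m z)) => YXz.
move: (bil _ _ (V u)) (bil _ _ (V u)) (bil _ _ (V u)) (bil _ _ (V u))
  (bil _ _ (V u)) (bil _ _ (V u)) => s1 s2 s3 s4 s5 s6.
move: (V u) (christoffel_mx g x u *m y) (christoffel_mx g x u *m z)
  (christoffel_mx g y u *m z) => v xy xz yz.
move: (christoffel_mx g x u *m v) (christoffel_mx g y u *m v) => xv yv.
move: (bil _ y z) (bil _ x z) (bil _ x y) (bil _ xy z) (bil _ y xz) (bil _ x yz)
  => t1 t2 t3 t4 t5 t6 R0.
apply/matrixP => i j; rewrite ord1 {j}.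
have := congr1 (fun A : E => A i 0) R0; rewrite /= !mxE => r0.
transitivity (Q i 0 - P i 0 + (XYz i 0 - YXz i 0) -
  (2 * (w1 * h1) + w1 ^+ 2 * (1 - h1 ^+ 2)) * (t1 * x i 0 - t2 * y i 0)).
  by ring.
by rewrite c1 r0; ring.
Qed.

Lemma conformal_flat x y z t u : W u ->
  riemann (fun v => (1 + h v)^-1 ^+ 2 *: g v) u x y z t = 0.
Proof.
move=> Wu; have := riemannE oW gts gtsym gtpos x y z t Wu.
rewrite riemann_form.unlock conformal_curvature0// bil0l; exact.
Qed.

End ConformalChange.

(** * Norm of the curvature tensor *)

Section CurvatureNorm.
Context {R : realFieldType} {m : nat}.
Implicit Types r : 'I_m -> 'I_m -> 'I_m -> 'I_m -> R.

Lemma sum_delta (i : 'I_m) (F : 'I_m -> R) : \sum_j (i == j)%:R * F j = F i.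
Proof.
rewrite (bigD1 i)//= eqxx mul1r big1 ?addr0// => j /negbTE ji.
by rewrite eq_sym ji mul0r.
Qed.

(* Components of the curvature tensor of the unit sphere in an orthonormal
   frame. *)
Definition unit_curvature (i j k l : 'I_m) : R :=
  (i == l)%:R * (j == k)%:R - (i == k)%:R * (j == l)%:R.

Lemma sum_unit_curvature r :
  \sum_i \sum_j \sum_k \sum_l r i j k l * unit_curvature i j k l =
  \sum_i \sum_j r i j j i - \sum_i \sum_j r i j i j.
Proof.
rewrite -sumrB; apply: eq_bigr => i _; rewrite -sumrB; apply: eq_bigr => j _.
have S1 : \sum_k \sum_l r i j k l * ((i == l)%:R * (j == k)%:R) = r i j j i.
  under eq_bigr => k _.
    under eq_bigr do rewrite mulrC -mulrA.
    rewrite sum_delta; over.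
  by rewrite /= sum_delta.
have S2 : \sum_k \sum_l r i j k l * ((i == k)%:R * (j == l)%:R) = r i j i j.
  under eq_bigr => k _.
    under eq_bigr do rewrite mulrC -mulrA mulrCA.
    rewrite sum_delta; over.
  by rewrite /= sum_delta.
rewrite -S1 -S2 -sumrB; apply: eq_bigr => k _; rewrite -sumrB.
by apply: eq_bigr => l _; rewrite mulrBr.
Qed.

Lemma unit_curvature_norm :
  \sum_i \sum_j \sum_k \sum_l unit_curvature i j k l ^+ 2 =
  2 * (m%:R * (m%:R - 1)).
Proof.
under eq_bigr do under eq_bigr do under eq_bigr do under eq_bigr do rewrite
  expr2.
rewrite sum_unit_curvature.
have S1 : \sum_i \sum_j unit_curvature i j j i = m%:R * (m%:R - 1).
  transitivity (\sum_(i < m) (m%:R - 1 : R)); last first.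
    by rewrite sumr_const card_ord mulr_natl.
  apply: eq_bigr => i _; rewrite /unit_curvature.
  under eq_bigr do rewrite !eqxx mulr1.
  by rewrite sumrB sumr_const card_ord sum_delta eqxx.
have S2 : \sum_i \sum_j unit_curvature i j i j = - (m%:R * (m%:R - 1)).
  rewrite -S1 -sumrN; apply: eq_bigr => i _; rewrite -sumrN.
  apply: eq_bigr => j _; rewrite /unit_curvature opprB !eqxx.
  by rewrite (eq_sym j i) mulrC.
by rewrite S1 S2 opprK mulr2n mulrDl mul1r.
Qed.

(** Expansion of the square; by skewness in the first pair, the contraction of [r] with the unit
    curvature is twice the sum of the [r i j j i]. *)
Lemma curvature_defect r (c : R) : (forall i j k l, r i j k l = - r j i k l) ->
  \sum_i \sum_j \sum_k \sum_l (r i j k l - c * unit_curvature i j k l) ^+ 2 =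
  \sum_i \sum_j \sum_k \sum_l r i j k l ^+ 2
  - 4 * c * \sum_i \sum_j r i j j i + 2 * c ^+ 2 * (m%:R * (m%:R - 1)).
Proof.
move=> rC; have S : \sum_i \sum_j r i j i j = - \sum_i \sum_j r i j j i.
  rewrite exchange_big -sumrN; apply: eq_bigr => i _ /=.
  by rewrite -sumrN; apply: eq_bigr => j _; exact: rC.
rewrite -mulrA [X in _ - 4 * (c * X)](_ : _ =
  2^-1 * \sum_i \sum_j \sum_k \sum_l r i j k l * unit_curvature i j k l); last
    first.
  by rewrite sum_unit_curvature S; field.
rewrite [2 * _]mulrC -mulrA -unit_curvature_norm.
rewrite [4 * _](_ : _ = (2 * c) * \sum_i \sum_j \sum_k \sum_l
  r i j k l * unit_curvature i j k l); last by field.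
rewrite !mulr_sumr -sumrB -big_split; apply: eq_bigr => i _ /=.
rewrite !mulr_sumr -sumrB -big_split; apply: eq_bigr => j _ /=.
rewrite !mulr_sumr -sumrB -big_split; apply: eq_bigr => k _ /=.
rewrite !mulr_sumr -sumrB -big_split; apply: eq_bigr => l _ /=.
ring.
Qed.

Lemma sum4_sqr_ge0 r : 0 <= \sum_i \sum_j \sum_k \sum_l r i j k l ^+ 2.
Proof. by do 4!(apply: sumr_ge0 => ? _); exact: sqr_ge0. Qed.

Lemma sum4_sqr_eq0 r : \sum_i \sum_j \sum_k \sum_l r i j k l ^+ 2 = 0 ->
  forall i j k l, r i j k l = 0.
Proof.
have H (F : 'I_m -> R) : (forall i, 0 <= F i) -> \sum_i F i = 0 ->
    forall i, F i = 0.
  by move=> F0 SF i; exact: (psumr_eq0P (fun i _ => F0 i) SF).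
move=> r0 i j k l.
have ge3 i' j' k' : 0 <= \sum_l r i' j' k' l ^+ 2.
  by apply: sumr_ge0 => ? _; exact: sqr_ge0.
have ge2 i' j' : 0 <= \sum_k \sum_l r i' j' k l ^+ 2 by exact: sumr_ge0.
have ge1 i' : 0 <= \sum_j \sum_k \sum_l r i' j k l ^+ 2 by exact: sumr_ge0.
have r1 := H _ (ge1) r0 i.
have r2 := H _ (ge2 i) r1 j.
have r3 := H _ (ge3 i j) r2 k.
have /eqP := H _ (fun l => sqr_ge0 (r i j k l)) r3 l.
by rewrite sqrf_eq0 => /eqP.
Qed.

Lemma scalar_bounds r : (forall i j k l, r i j k l = - r j i k l) ->
  \sum_i \sum_j \sum_k \sum_l r i j k l ^+ 2 = 2 * (m%:R * (m%:R - 1)) ->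
  - (m%:R * (m%:R - 1)) <= \sum_i \sum_j r i j j i <= m%:R * (m%:R - 1).
Proof.
move=> rC rN.
have := sum4_sqr_ge0 (fun i j k l => r i j k l - 1 * unit_curvature i j k l).
have := sum4_sqr_ge0 (fun i j k l => r i j k l - (- 1) * unit_curvature i j k
  l).
rewrite !(curvature_defect _ rC) rN sqrrN expr1n.
by move: (\sum_i _) (m%:R * _) => s K h1 h2; apply/andP; split; lra.
Qed.

Lemma scalar_max r : (forall i j k l, r i j k l = - r j i k l) ->
  \sum_i \sum_j \sum_k \sum_l r i j k l ^+ 2 = 2 * (m%:R * (m%:R - 1)) ->
  \sum_i \sum_j r i j j i = m%:R * (m%:R - 1) ->
  forall i j k l, r i j k l = unit_curvature i j k l.
Proof.
move=> rC rN rs i j k l; apply/eqP; rewrite -subr_eq0 -[X in _ - X]mul1r.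
apply/eqP; move: i j k l; apply: sum4_sqr_eq0.
by rewrite (curvature_defect _ rC) rN rs expr1n; ring.
Qed.

End CurvatureNorm.

(** * Orthonormal frames *)

Section OrthonormalBasis.
Context {R : realType} {m : nat}.
Local Notation E := 'cV[R]_m.
Variables (A : 'M[R]_m).
Hypothesis Asym : A^T = A.
Hypothesis Apos : forall v : E, v != 0 -> 0 < bil A v v.

(** The matrix of the [k] functionals [bil A _ (e j)] has rank at most [k < m], so its left kernel
    contains a nonzero vector, orthogonal to all [e j]; it remains to normalize it. *)
Lemma orthonormal_extend (k : nat) (e : 'I_k -> E) : (k < m)%N ->
  (forall i j, bil A (e i) (e j) = (i == j)%:R) ->
  exists e' : 'I_k.+1 -> E, forall i j, bil A (e' i) (e' j) = (i == j)%:R.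
Proof.
move=> km eO.
pose M : 'M[R]_(m, k) := A *m \matrix_(i, j) e j i 0.
have : kermx M != 0.
  rewrite -mxrank_eq0 -lt0n mxrank_ker subn_gt0.
  by apply: leq_ltn_trans km; exact: rank_leq_col.
case/rowV0Pn => v /sub_kermxP vM v0.
have vx : v^T != 0 by rewrite -trmx0 (inj_eq trmx_inj).
have vo j : bil A v^T (e j) = 0.
  move/matrixP/(_ 0 j): vM; rewrite mxE [RHS]mxE => vM.
  rewrite /bil trmxK -mulmxA mxE -[RHS]vM; apply: eq_bigr => i _.
  by rewrite !mxE; congr (_ * _); apply: eq_bigr => l _; rewrite mxE.
pose q := bil A v^T v^T.
have q0 : 0 < q by exact: Apos.
pose x := (Num.sqrt q)^-1 *: v^T.
have s0 : Num.sqrt q != 0 by rewrite gt_eqF ?sqrtr_gt0.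
have xx : bil A x x = 1.
  by rewrite bilZl bilZr -/q -[X in _ * (_ * X)]sqr_sqrtr ?ltW// expr2 mulKf//
    mulVf.
have xo j : bil A x (e j) = 0 by rewrite bilZl vo mulr0.
pose e' (i : 'I_k.+1) := if unlift ord0 i is Some j then e j else x.
exists e' => i j; rewrite /e'.
case: (unliftP ord0 i) => [i' ->|->]; case: (unliftP ord0 j) => [j' ->|->].
- by rewrite eO (inj_eq lift_inj).
- by rewrite bilC// xo eq_sym (negbTE (neq_lift _ _)).
- by rewrite xo (negbTE (neq_lift _ _)).
- by rewrite xx eqxx.
Qed.

Lemma orthonormal_exists :
  exists e : 'I_m -> E, forall i j, bil A (e i) (e j) = (i == j)%:R.
Proof.
suff H k : (k <= m)%N ->
    exists e : 'I_k -> E, forall i j, bil A (e i) (e j) = (i == j)%:R.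
  exact: H.
elim: k => [_|k IH km]; first by exists (fun=> 0) => -[].
have [e eO] := IH (ltnW km).
exact: orthonormal_extend km eO.
Qed.

Variable e : 'I_m -> E.
Hypothesis eO : forall i j, bil A (e i) (e j) = (i == j)%:R.

Let P : 'M[R]_m := \matrix_(i, j) e j i 0.

(** Orthonormality reads [P^T A P = 1] in matrix form. The formula turns contractions with the
    inverse metric into sums over a frame. *)
Lemma orthonormal_invmx : invmx A = P *m P^T.
Proof.
have PAP : P^T *m (A *m P) = 1%:M.
  apply/matrixP => i j; rewrite [RHS]mxE -eO /bil -mulmxA !mxE.
  apply: eq_bigr => k _; rewrite !mxE; congr (_ * _).
  by apply: eq_bigr => l _; rewrite mxE.
have := mulmx1C PAP; rewrite -mulmxA => /(congr1 (mulmx (invmx A))).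
by rewrite mulmx1 mulKmx// posdef_unitmx.
Qed.

Lemma trace_orthonormal (B : E -> E -> R) :
  (forall a x y z, B (a *: x + y) z = a * B x z + B y z) ->
  (forall a x y z, B z (a *: x + y) = a * B z x + B z y) ->
  \sum_i \sum_l invmx A i l * B (delta_mx i 0) (delta_mx l 0) =
  \sum_a B (e a) (e a).
Proof.
move=> Bl Br; rewrite orthonormal_invmx.
transitivity (\sum_a \sum_i \sum_l
    e a i 0 * (e a l 0 * B (delta_mx i 0) (delta_mx l 0))).
  rewrite [RHS]exchange_big; apply: eq_bigr => i _ /=.
  rewrite [RHS]exchange_big; apply: eq_bigr => l _ /=.
  rewrite mxE mulr_suml; apply: eq_bigr => a _.
  by rewrite !mxE mulrA.
apply: eq_bigr => a _.
rewrite (@linear_sum_basis _ _ R^o (fun x => B x (e a)) (e a))//.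
apply: eq_bigr => i _.
rewrite (@linear_sum_basis _ _ R^o (fun x => B (delta_mx i 0) x) (e a))//.
by rewrite scaler_sumr.
Qed.

Lemma orthonormal_expand (x : E) : x = \sum_a bil A x (e a) *: e a.
Proof.
apply: (@bil_nondeg _ _ A); first exact: posdef_unitmx.
have all_e (y : E) : y = \sum_a (P^T *m A *m y) a 0 *: e a.
  have -> : \sum_a (P^T *m A *m y) a 0 *: e a = P *m (P^T *m A *m y).
    apply/matrixP => i j; rewrite ord1 mxE summxE; apply: eq_bigr => a _.
    by rewrite [LHS]mxE [P i a]mxE mulrC.
  by rewrite !mulmxA -orthonormal_invmx mulVmx ?mul1mx ?posdef_unitmx.
move=> z; rewrite [z]all_e !bil_sumr; apply: eq_bigr => b _.
rewrite !bilZr; congr (_ * _); rewrite bil_suml.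
under eq_bigr do rewrite bilZl eO mulrC eq_sym.
by rewrite sum_delta.
Qed.

Lemma parseval (x y : E) : bil A x y = \sum_a bil A x (e a) * bil A y (e a).
Proof.
rewrite {1}(orthonormal_expand x) bil_suml; apply: eq_bigr => a _.
by rewrite bilZl (bilC (e a) y Asym).
Qed.

End OrthonormalBasis.

(** * Sasakian structures *)

(* [B x] stands for nabla_x xi and [A x y] for (nabla_x phi) y. *)
Section SasakianAlgebra.
Context {R : realType} {m : nat}.
Local Notation E := 'cV[R]_m.
Variables (G phi : 'M[R]_m) (xi : E) (B : E -> E) (A : E -> E -> E).
Local Notation "<< x , y >>" :=
  (bil G x y) (at level 0, x at level 99, y at level 99).
Hypothesis Gs : G^T = G.
Hypothesis Gu : G \in unitmx.
Hypothesis phi2 : forall x, phi *m (phi *m x) = - x + <<x, xi>> *: xi.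
Hypothesis phi_xi : phi *m xi = 0.
Hypothesis phi_skew : forall x y, <<phi *m x, y>> = - <<x, phi *m y>>.
Hypothesis B_contact : forall x y, <<B x, y>> - <<B y, x>> = 2 * <<x, phi *m
  y>>.
Hypothesis B_xi : forall x, <<B x, xi>> = 0.
Hypothesis A_xil : forall x, A xi x = B (phi *m x) - phi *m B x.
Hypothesis A_skew : forall x y z, <<A x y, z>> = - <<A x z, y>>.
Hypothesis A_phi : forall x y,
  A x (phi *m y) + phi *m A x y = <<y, xi>> *: B x + <<B x, y>> *: xi.
Hypothesis A_xir : forall x, A x xi = - (phi *m B x).
Hypothesis A_cyclic : forall x y z, <<A x y, z>> + <<A y z, x>> + <<A z x, y>>
  = 0.
Hypothesis A_normal : forall x y,
  A (phi *m x) y - A (phi *m y) x + phi *m A y x - phi *m A x y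
  + (2 * <<x, phi *m y>>) *: xi = 0.

Let C x y : <<x, y>> = <<y, x>>. Proof. exact: bilC. Qed.

Let decomp x : x = - (phi *m (phi *m x)) + <<x, xi>> *: xi.
Proof. by rewrite phi2 opprD opprK subrK. Qed.

(* [B + phi] is symmetric by [B_contact], and vanishes because it both commutes
   and anticommutes with [phi]. *)
Lemma nabla_xi x : B x = - (phi *m x).
Proof.
(* The form is skew by [A_skew], and symmetric by two instances of [B_contact]. Its vanishing means
   that [B] commutes with [phi]. *)
have A0 y z : <<A xi y, z>> = 0.
  have := A_skew xi y z; rewrite !A_xil !bilBl !phi_skew.
  have := B_contact (phi *m y) z; have := B_contact (phi *m z) y.
  by rewrite (C (phi *m z)) (C (B y)) (C (B z)); lra.
have Bphi y z : <<B (phi *m y), z>> = <<phi *m B y, z>>.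
  by have /eqP := A0 y z; rewrite A_xil bilBl subr_eq0 => /eqP.
have sym y z : <<B z, phi *m y>> = <<B y, phi *m z>>.
  have := A_cyclic xi y z; rewrite A0 (A_skew y) !A_xir !bilNl !phi_skew.
  by lra.
have perp y z : <<B z + phi *m z, phi *m y>> = 0.
  have := B_contact z (phi *m y); rewrite Bphi phi_skew (sym y z) bilDl
    phi_skew.
  by have := sym y z; lra.
apply/eqP; rewrite -addr_eq0; apply/eqP; apply: (bil_nondeg Gu) => z.
rewrite bil0l [z]decomp bilDr bilNr bilZr perp bilDl B_xi phi_skew phi_xi bil0r.
by rewrite oppr0 addr0 mulr0 addr0.
Qed.

(** Normality paired with [z], four instances of [A_phi], the skew symmetries and the cyclic
    identity form a linear system that determines [A z u] against the image of [phi] ([key]). Its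
    component along [xi] comes from [A_xir], and [decomp] splits every vector accordingly. *)
Lemma nabla_phi x y : A x y = <<x, y>> *: xi - <<y, xi>> *: x.
Proof.
have phi_xi0 u : <<phi *m u, xi>> = 0 by rewrite phi_skew phi_xi bil0r oppr0.
have F3 u v z : <<A u (phi *m v), z>> - <<A u v, phi *m z>> =
    - <<v, xi>> * <<phi *m u, z>> - <<phi *m u, v>> * <<z, xi>>.
  have := congr1 (fun f => <<f, z>>) (A_phi u v).
  rewrite /= !bilDl !bilZl phi_skew nabla_xi !bilNl (C xi z) => ->; ring.
have key u v z : <<A z u, phi *m v>> = - <<u, xi>> * <<z, phi *m v>>.
  have := congr1 (fun f => <<f, z>>) (A_normal u v).
  rewrite /= !(bilDl, bilBl, bilNl, bilZl) bil0l !(phi_skew (A _ _)) (C xi z).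
  have := A_cyclic (phi *m u) v z; have := A_cyclic (phi *m v) u z.
  have := F3 v u z; have := F3 u v z; have := F3 z u v; have := F3 z v u.
  have := A_skew v z (phi *m u); have := A_skew u z (phi *m v).
  have := A_skew z u (phi *m v); have := A_skew z v (phi *m u).
  rewrite !(phi_skew z) !(phi_skew u) !(phi_skew v).
  rewrite (C v (phi *m u)) (C z (phi *m u)) (C z (phi *m v)) !phi_skew.
  by lra.
apply: (bil_nondeg Gu) => z; rewrite [z]decomp !bilDr !bilNr !bilZr key.
have -> : <<A x y, xi>> = <<x, y>> - <<x, xi>> * <<y, xi>>.
  rewrite A_skew A_xir nabla_xi mulmxN opprK phi2 bilDl bilNl bilZl (C xi y).
  by ring.
rewrite !bilBl !bilZl !phi2 !bilDr !bilNr !bilZr (C xi z).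
by ring.
Qed.

End SasakianAlgebra.

(** * Covariant derivatives of the structure tensors in a chart *)

Section SasakianChart.
Context {R : realType} {m : nat}.
Local Notation E := 'cV[R]_m.
Variables (U : set E) (phi : E -> 'M[R]_m) (xi : E -> 'cV[R]_m).
Variables (eta : E -> 'rV[R]_m) (g : E -> 'M[R]_m).
Hypothesis oU : open U.
Hypothesis phis : smooth_on U phi.
Hypothesis xis : smooth_on U xi.
Hypothesis etas : smooth_on U eta.
Hypothesis gs : smooth_on U g.
Hypothesis gsym : forall u, U u -> (g u)^T = g u.
Hypothesis gpos : forall u, U u -> forall v : E, v != 0 -> 0 < bil (g u) v v.
Hypothesis phi2 : forall u, U u ->
  phi u *m phi u = - 1%:M + xi u *m eta u.
Hypothesis eta_phi : forall u, U u -> eta u *m phi u = 0.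
Hypothesis phi_xi : forall u, U u -> phi u *m xi u = 0.
Hypothesis xi_unit : forall u, U u -> bil (g u) (xi u) (xi u) = 1.
Hypothesis phi_metric : forall u (x y : E), U u ->
  bil (g u) (phi u *m x) (phi u *m y) =
  bil (g u) x y - (eta u *m x) 0 0 * (eta u *m y) 0 0.
Hypothesis eta_metric : forall u (x : E), U u ->
  bil (g u) x (xi u) = (eta u *m x) 0 0.
Hypothesis contact : forall u (x y : E), U u ->
  (dirder eta x u *m y) 0 0 - (dirder eta y u *m x) 0 0 =
  2 * bil (g u) x (phi u *m y).
Hypothesis normal_phi : forall u (x y : E), U u ->
  dirder phi (phi u *m x) u *m y - dirder phi (phi u *m y) u *m x
  + phi u *m (dirder phi y u *m x) - (dirder eta y u *m x) 0 0 *: xi u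
  - phi u *m (dirder phi x u *m y) + (dirder eta x u *m y) 0 0 *: xi u = 0.
Hypothesis normal_xi : forall u (x : E), U u ->
  dirder phi (xi u) u *m x - dirder xi (phi u *m x) u
  + phi u *m dirder xi x u = 0.
Local Notation Gam := (christoffel_mx g).

Definition nabla_xi_field (x u : E) : E := dirder xi x u + Gam x u *m xi u.

Definition nabla_phi_field (x y u : E) : E :=
  dirder phi x u *m y + Gam x u *m (phi u *m y) - phi u *m (Gam x u *m y).

Lemma phi2E u x : U u ->
  phi u *m (phi u *m x) = - x + bil (g u) x (xi u) *: xi u.
Proof.
move=> Uu; rewrite mulmxA phi2// mulmxDl mulNmx mul1mx -mulmxA eta_metric//.
by rewrite [eta u *m x]mx11_scalar mul_mx_scalar [in RHS]mxE mulr1n.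
Qed.

Lemma phi_skewE u x y : U u ->
  bil (g u) (phi u *m x) y = - bil (g u) x (phi u *m y).
Proof.
move=> Uu.
have e0 (z : E) : (eta u *m (phi u *m z)) 0 0 = 0.
  by rewrite mulmxA eta_phi// mul0mx mxE.
have := phi_metric x (phi u *m y) Uu.
rewrite phi2E// (e0 y) mulr0 subr0 bilDr bilNr bilZr !eta_metric// e0 mulr0
  addr0.
by move=> <-; rewrite opprK.
Qed.

Lemma phi_skew_mx u : U u -> (phi u)^T *m g u = - (g u *m phi u).
Proof.
move=> Uu; apply/matrixP => i j.
have := phi_skewE (delta_mx i 0) (delta_mx j 0) Uu.
rewrite bil_mull bil_mulr /bil -!colE !trmx_delta -!rowE.
by rewrite !mxE.
Qed.

Lemma eta_mx u : U u -> eta u = (xi u)^T *m g u.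
Proof.
move=> Uu; apply/matrixP => i j; rewrite !ord1.
have := eta_metric (delta_mx j 0) Uu; rewrite bilC ?gsym// /bil -!colE.
by rewrite [LHS]mxE [RHS]mxE => ->.
Qed.

Section AtPoint.
Variable u : E.
Hypothesis Uu : U u.
Local Notation B := (nabla_xi_field ^~ u).
Local Notation A := (fun x y => nabla_phi_field x y u).
Local Notation "<< x , y >>" :=
  (bil (g u) x y) (at level 0, x at level 99, y at level 99).

Let GC x y : Gam x u *m y = Gam y u *m x.
Proof. exact: (christoffel_mxC oU gs gsym gpos). Qed.

Let gC x y : <<x, y>> = <<y, x>>. Proof. exact: (metricC gsym). Qed.

Let dgE x y z : bil (dirder g x u) y z =
  <<Gam x u *m y, z>> + <<y, Gam x u *m z>>.
Proof.
by rewrite (dmetricE oU gs gsym gpos)// bil_mxD -bil_mull -bil_mulr.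
Qed.

Let dgis x : is_derive u x g (dirder g x u).
Proof. exact: is_derive_dirder. Qed.
Let dphiis x : is_derive u x phi (dirder phi x u).
Proof. exact: is_derive_dirder. Qed.
Let dxiis x : is_derive u x xi (dirder xi x u).
Proof. exact: is_derive_dirder. Qed.
Let detais x : is_derive u x eta (dirder eta x u).
Proof. exact: is_derive_dirder. Qed.

Lemma deta_nabla x y : (dirder eta x u *m y) 0 0 =
  <<nabla_xi_field x u, y>> + <<xi u, Gam x u *m y>>.
Proof.
have := dirder_eq (is_derive_mulmx (is_derive_trmx (dxiis x)) (dgis x)).
rewrite -(dirder_ext oU x eta_mx Uu) => ->.
by rewrite mulmxDl mxE -![(_ *m _ *m y) 0 0]/(bil _ _ _) dgE addrA -bilDl.
Qed.

Lemma nabla_xi_contact x y :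
  <<nabla_xi_field x u, y>> - <<nabla_xi_field y u, x>> = 2 * <<x, phi u *m y>>.
Proof. by rewrite -contact// !deta_nabla (GC y x); ring. Qed.

Lemma nabla_xi_perp x : <<nabla_xi_field x u, xi u>> = 0.
Proof.
have D := is_derive_on_ext oU xi_unit Uu
  (is_derive_bil (dgis x) (dxiis x) (dxiis x)).
have := derive_val (f := (fun=> 1) : E -> R).
case: D => _; rewrite derive_cst dgE (gC (xi u) (dirder _ _ _)) => H.
rewrite /nabla_xi_field bilDl.
by move: H; rewrite (gC (xi u) (Gam x u *m _)); lra.
Qed.

(** Symmetry of the Christoffel symbols replaces the partial derivatives by covariant ones in the
    identity [L_xi phi = 0], which is [normal_xi]. *)
Lemma nabla_phi_xil x : nabla_phi_field (xi u) x u =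
  nabla_xi_field (phi u *m x) u - phi u *m nabla_xi_field x u.
Proof.
have := normal_xi x Uu; rewrite /nabla_phi_field /nabla_xi_field mulmxDr.
rewrite (GC (xi u) (phi u *m x)) (GC (xi u) x) => /eqP.
rewrite -addrA addr_eq0 => /eqP ->.
move: (phi u *m dirder xi x u) (phi u *m (Gam x u *m xi u)) => P Q.
by apply/matrixP => i j; rewrite !mxE; ring.
Qed.

Lemma nabla_phi_skew x y z :
  <<nabla_phi_field x y u, z>> = - <<nabla_phi_field x z u, y>>.
Proof.
have D1 := dirder_eq (is_derive_mulmx (is_derive_trmx (dphiis x)) (dgis x)).
have D2 := dirder_eq (is_derive_opp (is_derive_mulmx (dgis x) (dphiis x))).
have := dirder_ext oU x phi_skew_mx Uu; rewrite D1 D2.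
move/(congr1 (fun M => bil M y z)); rewrite !(bil_mxD, bil_mxN).
rewrite -!bil_mull -!bil_mulr !dgE /nabla_phi_field.
rewrite !(bilBl, bilDl) !phi_skewE//.
rewrite (gC (dirder phi x u *m z)) (gC (Gam x u *m (phi u *m z))).
rewrite (gC (Gam x u *m z) (phi u *m y)) phi_skewE//.
by lra.
Qed.

Lemma nabla_phi_phi x y :
  nabla_phi_field x (phi u *m y) u + phi u *m nabla_phi_field x y u =
  <<y, xi u>> *: nabla_xi_field x u + <<nabla_xi_field x u, y>> *: xi u.
Proof.
have D1 := dirder_eq (is_derive_mulmx (dphiis x) (dphiis x)).
have D2 := dirder_eq (is_derive_add (is_derive_const (- 1%:M) u x)
  (is_derive_mulmx (dxiis x) (detais x))).
have := dirder_ext oU x phi2 Uu; rewrite D1 D2 add0r.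
move/(congr1 (fun M => M *m y)); rewrite !mulmxDl -!mulmxA.
rewrite [eta u *m y]mx11_scalar [dirder eta x u *m y]mx11_scalar !mul_mx_scalar.
rewrite deta_nabla -eta_metric// => H.
rewrite /nabla_phi_field /nabla_xi_field !(mulmxDr, mulmxN) !phi2E//.
move: H; rewrite !(mulmxDr, mulmxN) -!scalemxAr (gC (xi u) (Gam x u *m y)).
rewrite !bilDl !scalerDl.
move: (dirder phi x u *m (phi u *m y)) (phi u *m (dirder phi x u *m y)).
move: (Gam x u *m xi u) (Gam x u *m y) (phi u *m (Gam x u *m (phi u *m y))).
move=> a b c d e /matrixP H; apply/matrixP => i j.
by have := H i j; rewrite !mxE; lra.
Qed.

Lemma nabla_phi_xir x :
  nabla_phi_field x (xi u) u = - (phi u *m nabla_xi_field x u).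
Proof.
have D := dirder_eq (is_derive_mulmx (dphiis x) (dxiis x)).
have := dirder_ext oU x phi_xi Uu.
rewrite D (dirder_eq (is_derive_const 0 u x)) => /eqP.
rewrite addr_eq0 => /eqP H.
by rewrite /nabla_phi_field /nabla_xi_field phi_xi// mulmx0 addr0 H mulmxDr
  opprD.
Qed.

(** The contact identity differentiated along [x], with [y] and [z] constant in the chart. *)
Lemma dcontact x y z :
  (dirder (dirder eta y) x u *m z) 0 0 - (dirder (dirder eta z) x u *m y) 0 0 =
  2 * (<<y, nabla_phi_field x z u>> + <<Gam x u *m y, phi u *m z>>
       + <<y, phi u *m (Gam x u *m z)>>).
Proof.
have Dm a (b : E) : is_derive u x (fun v => (dirder eta a v *m b) 0 0)
    ((dirder (dirder eta a) x u *m b) 0 0).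
  have /is_derive_mxP/(_ 0 0) := is_derive_mulmx
    (is_derive_dirder (dirder_smooth etas a) x Uu) (is_derive_const b u x).
  by rewrite mulmx0 addr0.
have D1 := is_derive_sub (Dm y z) (Dm z y).
have D2 := is_derive_bil (dgis x) (is_derive_const y u x)
  (is_derive_mulmx (dphiis x) (is_derive_const z u x)).
have D3 := is_derive_mul (is_derive_const (2 : R) u x) D2.
have [_ <-] := is_derive_on_ext oU (fun v Uv => contact y z Uv) Uu D1.
case: D3 => _ ->; rewrite mul0r add0r mulmx0 addr0 bil0l addr0 dgE.
by rewrite /nabla_phi_field bilBr bilDr; ring.
Qed.

(** The fundamental 2-form [g(x, phi y)] is closed because it is [d eta]: in the cyclic sum of
    [dcontact] the second derivatives of [eta] cancel by symmetry. *)
Lemma nabla_phi_cyclic x y z : <<nabla_phi_field x y u, z>>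
  + <<nabla_phi_field y z u, x>> + <<nabla_phi_field z x u, y>> = 0.
Proof.
have := dcontact x y z; have := dcontact y z x; have := dcontact z x y.
rewrite (dirderC oU etas x y Uu) (dirderC oU etas y z Uu) (dirderC oU etas z x
  Uu).
rewrite (GC y x) (GC z y) (GC z x).
have sk a b c : <<a, nabla_phi_field b c u>> = - <<nabla_phi_field b a u, c>>.
  by rewrite gC nabla_phi_skew.
have sp a b c : <<a, phi u *m (Gam b u *m c)>> = - <<Gam b u *m c, phi u *m a>>.
  by rewrite gC phi_skewE.
by rewrite !sk !sp; lra.
Qed.

(** In [normal_phi] covariant derivatives may replace partial ones, since the Christoffel terms
    cancel by symmetry; the [eta] terms combine by the contact condition. *)
Lemma nabla_phi_normal x y :
  nabla_phi_field (phi u *m x) y u - nabla_phi_field (phi u *m y) x u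
  + phi u *m nabla_phi_field y x u - phi u *m nabla_phi_field x y u
  + (2 * <<x, phi u *m y>>) *: xi u = 0.
Proof.
rewrite -contact// -[RHS](normal_phi x y Uu) scalerBl /nabla_phi_field.
rewrite !(mulmxBr, mulmxDr) (GC (phi u *m x) y) (GC (phi u *m y) x).
rewrite (GC (phi u *m x) (phi u *m y)) (GC y x).
by matrix_sum_ring.
Qed.

Lemma nabla_xiE x : nabla_xi_field x u = - (phi u *m x).
Proof.
apply: (@nabla_xi _ _ (g u) (phi u) (xi u) B A) => //.
- exact: gsym.
- exact: (metric_unit gsym gpos Uu).
- by move=> y; exact: phi2E.
- exact: phi_xi.
- by move=> y z; exact: phi_skewE.
- exact: nabla_xi_contact.
- exact: nabla_xi_perp.
- exact: nabla_phi_xil.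
- exact: nabla_phi_skew.
- exact: nabla_phi_xir.
- exact: nabla_phi_cyclic.
Qed.

Lemma nabla_phiE x y :
  nabla_phi_field x y u = <<x, y>> *: xi u - <<y, xi u>> *: x.
Proof.
apply: (@nabla_phi _ _ (g u) (phi u) (xi u) B A) => //.
- exact: gsym.
- exact: (metric_unit gsym gpos Uu).
- by move=> z; exact: phi2E.
- exact: phi_xi.
- by move=> z w; exact: phi_skewE.
- exact: nabla_xi_contact.
- exact: nabla_xi_perp.
- exact: nabla_phi_xil.
- exact: nabla_phi_skew.
- exact: nabla_phi_phi.
- exact: nabla_phi_xir.
- exact: nabla_phi_cyclic.
- exact: nabla_phi_normal.
Qed.

End AtPoint.

(** Differentiating [nabla xi = - phi] once more gives [R(x, y) xi = (nabla_y phi) x - (nabla_x phi)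
    y], which [nabla_phiE] evaluates. *)
Lemma sasakian_curvature x y u : U u ->
  curvature_mx g x y u *m xi u =
  bil (g u) y (xi u) *: x - bil (g u) x (xi u) *: y.
Proof.
move=> Uu.
have dd a b : dirder (dirder xi b) a u + dirder (Gam b) a u *m xi u
    + Gam b u *m dirder xi a u = - (dirder phi a u *m b).
  have D1 := dirder_eq (is_derive_add
    (is_derive_dirder (dirder_smooth xis b) a Uu)
    (is_derive_mulmx (is_derive_christoffel_mx oU gs gsym gpos a b Uu)
      (is_derive_dirder xis a Uu))).
  have D2 := dirder_eq (is_derive_opp (is_derive_mulmx
    (is_derive_dirder phis a Uu) (is_derive_const b u a))).
  have := dirder_ext oU a (fun v Uv => nabla_xiE Uv b) Uu.
  by rewrite D1 D2 mulmx0 addr0 addrA.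
have dxi a : dirder xi a u = - (phi u *m a) - Gam a u *m xi u.
  by have := nabla_xiE Uu a; rewrite /nabla_xi_field => <-; rewrite addrK.
have Ax := nabla_phiE Uu x y; have Ay := nabla_phiE Uu y x.
have := dd x y; have := dd y x; rewrite (dirderC oU xis y x Uu) !dxi.
rewrite !(mulmxBr, mulmxN); move: Ax Ay; rewrite /nabla_phi_field.
rewrite (metricC gsym y x Uu) (christoffel_mxC oU gs gsym gpos y x Uu).
rewrite curvature_mx.unlock mulmxDl !mulmxBl -!mulmxA.
move: (bil _ _ _) (bil _ _ _) (bil _ _ _) => a b c.
move: (dirder _ _ _) (dirder phi x u *m y) (dirder phi y u *m x) => P Q S.
move: (dirder _ _ _ *m _) (dirder _ _ _ *m _) => P1 P2.
move: (Gam x u *m (phi u *m y)) (Gam y u *m (phi u *m x)) => X1 X2.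
move: (phi u *m (Gam x u *m y)) => X3.
move: (Gam x u *m (Gam y u *m xi u)) (Gam y u *m (Gam x u *m xi u)) => X4 X5.
move: (xi u) => v H1 H2 H3 H4; apply/matrixP => i j; rewrite ord1 {j}.
have := congr1 (fun M : E => M i 0) H1; have := congr1 (fun M : E => M i 0) H2.
have := congr1 (fun M : E => M i 0) H3; have := congr1 (fun M : E => M i 0) H4.
by rewrite /= !mxE; lra.
Qed.

(** Pair symmetry moves [xi] to the third slot, where [sasakian_curvature] applies. *)
Lemma sasakian_riemann x y z u : U u ->
  riemann_form g u (xi u) x y z =
  bil (g u) x y * bil (g u) (xi u) z - bil (g u) (xi u) y * bil (g u) x z.
Proof.
move=> Uu; rewrite (riemann_pairC oU gs gsym gpos)//.
rewrite (riemannE oU gs gsym gpos)// sasakian_curvature// bilBl !bilZl.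
rewrite !(metricC gsym (xi u))// (metricC gsym x y)// (metricC gsym x z)//.
by ring.
Qed.

End SasakianChart.

(** * Normality on the product with the real line *)

Section ProductDerivatives.
Context {R : realType} {E : normedModType R} {p q : nat}.

(** The components of [J] depend on the point of [M] alone, so a derivative on the product is one
    along the first factor. *)
Lemma is_derive_pair_fst (F1 : E -> 'M[R]_(p, q)) (F2 : E -> R) (u v : E)
    (t b : R) d1 d2 : is_derive u v F1 d1 -> is_derive u v F2 d2 ->
  is_derive ((u, t) : E * R) ((v, b) : E * R) (fun w => (F1 w.1, F2 w.1)) (d1,
    d2).
Proof.
move=> [D1 E1] [D2 E2].
have l1 : h^-1 *: (F1 (h *: v + u) - F1 u) @[h --> 0^'] --> d1.
  by rewrite -E1; exact: D1.
have l2 : h^-1 *: (F2 (h *: v + u) - F2 u) @[h --> 0^'] --> d2.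
  by rewrite -E2; exact: D2.
have lim := cvg_pair l1 l2.
have L : (fun h : R => h^-1 *: ((F1 (h *: (v, b) + (u, t)).1,
    F2 (h *: (v, b) + (u, t)).1) - (F1 u, F2 u))) @ 0^' --> (d1, d2).
  exact: lim.
split; first by apply/cvg_ex; exists (d1, d2).
exact/cvg_lim.
Qed.

End ProductDerivatives.

Section NormalStructure.
Context {R : realType} {m : nat} (M : smooth_manifold R m).
Variables (phi : components M 'M[R]_m) (xi : components M 'cV[R]_m).
Variables (eta : components M 'rV[R]_m).
Hypothesis phis : smooth_components phi.
Hypothesis xis : smooth_components xi.
Hypothesis etas : smooth_components eta.
Hypothesis N : normal_structure phi xi eta.
Variables (i : chart_idx M) (u : 'cV[R]_m).
Hypothesis Uu : chart_cod i u.
Local Notation E := 'cV[R]_m.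
Local Notation J Z := (fun q => product_J phi xi eta i q (Z q)).

Let oU : open (chart_cod i) := @chart_cod_open _ _ _ i.

Lemma is_derive_product_J (x v : E) (a b t : R) :
  is_derive ((u, t) : E * R) ((v, b) : E * R) (J (cst ((x, a) : E * R)))
    (dirder (phi i) v u *m x - a *: dirder (xi i) v u,
     (dirder (eta i) v u *m x) 0 0).
Proof.
have D1 := is_derive_mulmx (is_derive_dirder (phis i) v Uu)
  (is_derive_const x u v).
have D2 := is_derive_scale (is_derive_const a u v)
  (is_derive_dirder (xis i) v Uu).
have D3 := is_derive_mulmx (is_derive_dirder (etas i) v Uu)
  (is_derive_const x u v).
rewrite mulmx0 addr0 in D1; rewrite scale0r add0r in D2.
rewrite mulmx0 addr0 in D3; move/is_derive_mxP/(_ 0 0) : D3 => D3.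
exact: is_derive_pair_fst (is_derive_sub D1 D2) D3.
Qed.

Let lie_const (X Y : E * R) (q : E * R) : lie_bracket (cst X) (cst Y) q = 0.
Proof. by rewrite /lie_bracket !derive_cst subrr. Qed.

Let product_J0 (q : E * R) : product_J phi xi eta i q 0 = 0.
Proof. by rewrite /product_J /= !mulmx0 scale0r subrr mxE. Qed.

(** The torsion of [J] on constant fields: their bracket vanishes, the other brackets reduce to
    derivatives of the components of [J], and the component tangent to [M] is extracted. *)
Lemma normal_const (x y : E) (a b : R) :
  let v := phi i u *m x - a *: xi i u in
  let w := phi i u *m y - b *: xi i u in
  dirder (phi i) v u *m y - b *: dirder (xi i) v u
  - (dirder (phi i) w u *m x - a *: dirder (xi i) w u)
  + (phi i u *m (dirder (phi i) y u *m x - a *: dirder (xi i) y u)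
     - (dirder (eta i) y u *m x) 0 0 *: xi i u)
  - (phi i u *m (dirder (phi i) x u *m y - b *: dirder (xi i) x u)
     - (dirder (eta i) x u *m y) 0 0 *: xi i u) = 0.
Proof.
move=> v w; pose X : E * R := (x, a); pose Y : E * R := (y, b).
pose q : E * R := (u, 0).
have cs (Z : E * R) : smooth_on (chart_cod i `*` [set: R]) (cst Z).
  by move=> k; exact: Ck_on_cst.
have := N (cs X) (cs Y) (q := q) (conj Uu I).
have der Z' Z : 'D_Z' (J (cst Z)) q =
    (dirder (phi i) Z'.1 u *m Z.1 - Z.2 *: dirder (xi i) Z'.1 u,
     (dirder (eta i) Z'.1 u *m Z.1) 0 0).
  by case: (is_derive_product_J Z.1 Z'.1 Z.2 Z'.2 0) => _; rewrite
    -!surjective_pairing.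
have -> : lie_bracket (J (cst X)) (cst Y) q = - 'D_Y (J (cst X)) q.
  by rewrite /lie_bracket derive_cst add0r.
have -> : lie_bracket (cst X) (J (cst Y)) q = 'D_X (J (cst Y)) q.
  by rewrite /lie_bracket derive_cst subr0.
rewrite lie_const !product_J0 add0r /lie_bracket !der /product_J /=.
move=> /(congr1 fst) /= <-.
rewrite -/v -/w !mulmxN !scaleNr.
by matrix_sum_ring.
Qed.

Lemma normal_structure_phi (x y : E) :
  dirder (phi i) (phi i u *m x) u *m y - dirder (phi i) (phi i u *m y) u *m x
  + phi i u *m (dirder (phi i) y u *m x) - (dirder (eta i) y u *m x) 0 0 *: xi
    i u
  - phi i u *m (dirder (phi i) x u *m y)
  + (dirder (eta i) x u *m y) 0 0 *: xi i u = 0.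
Proof.
have := normal_const x y 0 0; rewrite /= !scale0r !subr0 => <-.
by matrix_sum_ring.
Qed.

(** The torsion evaluated on [x] and [d/dt]; for constant [x] the result says that the Lie
    derivative of [phi] along [xi] vanishes. *)
Lemma normal_structure_xi (x : E) :
  dirder (phi i) (xi i u) u *m x - dirder (xi i) (phi i u *m x) u
  + phi i u *m dirder (xi i) x u = 0.
Proof.
have := normal_const x 0 0 1.
have d0 (p q : nat) (F : E -> 'M[R]_(p, q)) : dirder F 0 u = 0.
  by rewrite dirderE derive0.
have dN v : dirder (phi i) (- v) u = - dirder (phi i) v u.
  have := dirder_linear oU (phis i) (-1) v 0 Uu.
  by rewrite d0 !scaleN1r !addr0.
rewrite /= !scale0r !scale1r !subr0 !mulmx0 !sub0r dN !d0 !mul0mx !mulmx0.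
have z00 : (0 : 'M[R]_1) 0 0 = 0 by rewrite mxE.
rewrite !z00 !scale0r !subr0 addr0 mulmxN mulNmx => <-.
by matrix_sum_ring.
Qed.

End NormalStructure.

Section SealedCurvature.
Context {R : realType} {m : nat}.
Variables (g : 'cV[R]_m -> 'M[R]_m) (u : 'cV[R]_m) (e : 'I_m -> 'cV[R]_m).
Implicit Types x y : 'cV[R]_m.

Lemma ricciE x y : ricci g u x y = \sum_i \sum_l
  invmx (g u) i l * riemann_form g u (delta_mx i 0) x y (delta_mx l 0).
Proof. by rewrite riemann_form.unlock. Qed.

Lemma breve_riemannE x y : breve_riemann g u e x y = \sum_i \sum_j \sum_k
  riemann_form g u x (e i) (e j) (e k) * riemann_form g u y (e i) (e j) (e k).
Proof. by rewrite riemann_form.unlock. Qed.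

Lemma riemann_norm2E : riemann_norm2 g u e = \sum_i \sum_j \sum_k \sum_l
  riemann_form g u (e i) (e j) (e k) (e l) ^+ 2.
Proof. by rewrite riemann_form.unlock. Qed.

End SealedCurvature.

(** * Curvature in an orthonormal frame *)

Section OrthonormalCurvature.
Context {R : realType} {m : nat}.
Local Notation E := 'cV[R]_m.
Variables (U : set E) (g : E -> 'M[R]_m).
Hypothesis oU : open U.
Hypothesis gs : smooth_on U g.
Hypothesis gsym : forall u, U u -> (g u)^T = g u.
Hypothesis gpos : forall u, U u -> forall v : E, v != 0 -> 0 < bil (g u) v v.
Variables (u : E) (e : 'I_m -> E).
Hypothesis Uu : U u.
Hypothesis eO : orthonormal_basis g u e.
Local Notation riem := (riemann_form g u).

Let tr (B : E -> E -> R) :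
  (forall a x y z, B (a *: x + y) z = a * B x z + B y z) ->
  (forall a x y z, B z (a *: x + y) = a * B z x + B z y) ->
  \sum_i \sum_l invmx (g u) i l * B (delta_mx i 0) (delta_mx l 0) =
  \sum_a B (e a) (e a).
Proof. exact: (trace_orthonormal (gsym Uu) (gpos Uu) eO). Qed.

Lemma ricci_orthonormal x y : ricci g u x y = \sum_a riem (e a) x y (e a).
Proof.
rewrite ricciE.
apply: (tr (B := fun v w => riem v x y w)) => a v w z.
- exact: (riemann_linear1 oU gs gsym gpos).
- exact: (riemann_linear4 oU gs gsym gpos).
Qed.

Lemma scalar_orthonormal :
  Defs.scalar g u = \sum_a \sum_b riem (e a) (e b) (e b) (e a).
Proof.
rewrite exchange_big /Defs.scalar (tr (B := fun x y => ricci g u x y)).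
- by apply: eq_bigr => b _; exact: ricci_orthonormal.
- move=> a x y z; rewrite !ricci_orthonormal mulr_sumr -big_split.
  apply: eq_bigr => b _ /=.
  exact: (riemann_linear2 oU gs gsym gpos).
- move=> a x y z; rewrite !ricci_orthonormal mulr_sumr -big_split.
  apply: eq_bigr => b _ /=.
  exact: (riemann_linear3 oU gs gsym gpos).
Qed.

(** The difference [D] from the curvature tensor of the unit sphere is multilinear and vanishes on
    the frame; its arguments are freed one slot at a time. *)
Lemma curvature_mx_unit :
  (forall i j k l, riem (e i) (e j) (e k) (e l) = unit_curvature i j k l) ->
  forall x y z, curvature_mx g x y u *m z = bil (g u) y z *: x - bil (g u) x z
    *: y.
Proof.
move=> eR x y z.
have expand := orthonormal_expand (gsym Uu) (gpos Uu) eO.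
pose D x y z w := riem x y z w - (bil (g u) y z * bil (g u) x w
  - bil (g u) x z * bil (g u) y w).
have D0 i j k l : D (e i) (e j) (e k) (e l) = 0.
  by rewrite /D eR !eO /unit_curvature; ring.
have vanish (L : E -> R) : (forall a v w, L (a *: v + w) = a * L v + L w) ->
    (forall i, L (e i) = 0) -> forall v, L v = 0.
  move=> Llin L0 v; rewrite [v]expand.
  have L00 : L 0 = 0.
    by have := Llin 1 0 0; rewrite scale1r addr0 mul1r => /eqP;
       rewrite eq_sym -subr_eq0 addrK => /eqP.
  elim: (index_enum _) => [|i s IH]; first by rewrite big_nil.
  by rewrite big_cons Llin L0 mulr0 add0r.
have D1 j k l v : D v (e j) (e k) (e l) = 0.
  move: v; apply: vanish => // a v w; rewrite /D.
  rewrite (riemann_linear1 oU gs gsym gpos)// !(bilDl, bilZl); ring.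
have D2 k l v w : D v w (e k) (e l) = 0.
  move: w; apply: vanish => // a w w'; rewrite /D.
  rewrite (riemann_linear2 oU gs gsym gpos)// !(bilDl, bilZl); ring.
have D3 l v w t : D v w t (e l) = 0.
  move: t; apply: vanish => // a t t'; rewrite /D.
  rewrite (riemann_linear3 oU gs gsym gpos)// !(bilDr, bilZr); ring.
have D4 v w t s : D v w t s = 0.
  move: s; apply: vanish => // a s s'; rewrite /D.
  rewrite (riemann_linear4 oU gs gsym gpos)// !(bilDr, bilZr); ring.
apply: (metric_inj gsym gpos Uu) => w; rewrite bilBl !bilZl.
have /eqP := D4 x y z w; rewrite /D subr_eq0 => /eqP <-.
by rewrite (riemannE oU gs gsym gpos).
Qed.

End OrthonormalCurvature.

(** * Weakly Einstein Sasakian manifolds *)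

Section SasakianManifold.
Context {R : realType} {m : nat} (M : smooth_manifold R m).
Variables (phi : components M 'M[R]_m) (xi : components M 'cV[R]_m).
Variables (eta : components M 'rV[R]_m) (g : components M 'M[R]_m).
Hypothesis S : sasakian phi xi eta g.

Let oU i : open (chart_cod i) := @chart_cod_open _ _ M i.

Lemma sasakian_metric i :
  [/\ smooth_on (chart_cod i) (g i),
      forall u, chart_cod i u -> (g i u)^T = g i u &
      forall u, chart_cod i u -> forall v, v != 0 -> 0 < bil (g i u) v v].
Proof.
by case: S => -[] [_ _ _ [gs _ gsym gpos] _] _ _; split; [exact: gs|exact:
  gsym|exact: gpos].
Qed.

Lemma sasakian_xi_unit i u : chart_cod i u ->
  bil (g i u) (xi i u) (xi i u) = 1.
Proof. by case: S => -[] [_ _ _ _ H] _ _ /H[]. Qed.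

(** The contact condition is tested on constant fields, whose bracket is 0; the factor 2 undoes the
    1/2 in the convention for [d eta]. *)
Lemma contact_dirder i u x y : chart_cod i u ->
  (dirder (eta i) x u *m y) 0 0 - (dirder (eta i) y u *m x) 0 0 =
  2 * bil (g i u) x (phi i u *m y).
Proof.
case: S => -[] [_ _ [etas _] _ _] C _ Uu.
have cs z : smooth_on (chart_cod i) (cst z : 'cV[R]_m -> 'cV[R]_m).
  by move=> k; exact: Ck_on_cst.
have := C i _ _ (cs x) (cs y) u Uu; rewrite /exterior_derivative /=.
have dE a b : 'D_a (fun v => (eta i v *m b) 0 0) u =
    (dirder (eta i) a u *m b) 0 0.
  have /is_derive_mxP/(_ 0 0)[_ ->] := is_derive_mulmx
    (is_derive_dirder (etas i) a Uu) (is_derive_const b u a).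
  by rewrite mulmx0 addr0.
rewrite !dE /lie_bracket !derive_cst subrr mulmx0 [X in _ - X]mxE subr0 => <-.
by rewrite mulrA mulfV ?mul1r// pnatr_eq0.
Qed.

Lemma sasakian_manifold_riemann i u x y z : chart_cod i u ->
  riemann_form (g i) u (xi i u) x y z =
  bil (g i u) x y * bil (g i u) (xi i u) z
  - bil (g i u) (xi i u) y * bil (g i u) x z.
Proof.
have [gs gsym gpos] := sasakian_metric i.
case: (S) => -[] [[phis _] [xis _] [etas _] _ P] _ N Uu.
refine (sasakian_riemann (@oU i) (phis i) (xis i) (etas i) gs gsym gpos
  _ _ _ _ _ _ _ _ _ _ _ _ Uu).
- by move=> v /P[].
- by move=> v /P[].
- by move=> v /P[].
- by move=> v /P[].
- by move=> v a b /P[_ _ _ _ /(_ a b)[]].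
- by move=> v a /P[_ _ _ _ /(_ a a)[]].
- by move=> v a b; exact: contact_dirder.
- by move=> v a b Uv; exact: (normal_structure_phi phis xis etas N).
- by move=> v a Uv; exact: (normal_structure_xi phis xis etas N).
Qed.

Lemma sasakian_ricci_xi i u : chart_cod i u ->
  ricci (g i) u (xi i u) (xi i u) = m%:R - 1.
Proof.
move=> Uu; have [gs gsym gpos] := sasakian_metric i.
have [e eO] := orthonormal_exists (gsym u Uu) (gpos u Uu).
rewrite (ricci_orthonormal (@oU i) gs gsym gpos Uu eO).
under eq_bigr do rewrite (riemann_skewl (@oU i) gs gsym gpos)//
  sasakian_manifold_riemann// sasakian_xi_unit// mul1r opprB eO eqxx.
rewrite sumrB sumr_const card_ord; congr (_ - _).
rewrite -(sasakian_xi_unit Uu) [RHS](parseval (gsym u Uu) (gpos u Uu) eO).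
by apply: eq_bigr => a _; rewrite (metricC gsym (e a)).
Qed.

(** With [h k = eta(e_k)] the summand is the square of [R(xi, e_i, e_j, e_k)], so the sum is the
    value of [breve_riemann] at [(xi, xi)]. *)
Lemma sum_xi_curvature (h : 'I_m -> R) : \sum_k h k * h k = 1 ->
  \sum_i \sum_j \sum_k ((i == j)%:R * h k - h j * (i == k)%:R) ^+ 2 =
  2 * (m%:R - 1).
Proof.
move=> h1.
have inner i : \sum_j \sum_k ((i == j)%:R * h k - h j * (i == k)%:R) ^+ 2 =
    2 - 2 * (h i * h i).
  transitivity (\sum_j ((i == j)%:R * 1 - (i == j)%:R * (2 * (h i * h j))
      + h j * h j)).
    apply: eq_bigr => j _.
    transitivity (\sum_k ((i == j)%:R * (h k * h k)
        - (i == k)%:R * (2 * (i == j)%:R * (h k * h j))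
        + (i == k)%:R * (h j * h j))).
      apply: eq_bigr => k _; have b2 (b : bool) : b%:R * b%:R = b%:R :> R.
        by case: b; rewrite ?mul1r ?mul0r.
      rewrite -[in X in _ = X * _ - _ + _](b2 (i == j)).
      by rewrite -[in X in _ = _ - _ + X * _](b2 (i == k)); ring.
    by rewrite !big_split /= sumrN -mulr_sumr h1 !sum_delta; ring.
  by rewrite !big_split /= sumrN h1 !sum_delta; ring.
under eq_bigr do rewrite inner.
rewrite sumrB -mulr_sumr h1 sumr_const card_ord mulr1.
by rewrite mulrBr mulr1 mulr_natr.
Qed.

Hypothesis W : weakly_einstein g.

Lemma sasakian_norm2 i u e : chart_cod i u -> orthonormal_basis (g i) u e ->
  \sum_a \sum_b \sum_c \sum_d
    riemann_form (g i) u (e a) (e b) (e c) (e d) ^+ 2 =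
  2 * (m%:R * (m%:R - 1)).
Proof.
move=> Uu eO; have [gs gsym gpos] := sasakian_metric i.
(* In dimension 0 the expansion of [xi] in the frame would be an empty sum, against its unit
   length. *)
have m0 : m%:R != 0 :> R.
  rewrite pnatr_eq0; apply/eqP => m0; have := sasakian_xi_unit Uu.
  rewrite [xi i u](orthonormal_expand (gsym u Uu) (gpos u Uu) eO).
  rewrite bil_suml big1 ?bil0l => [/eqP|j _]; first by rewrite eq_sym oner_eq0.
  by exfalso; case: j => j; rewrite m0.
have := W Uu eO (xi i u) (xi i u).
rewrite sasakian_xi_unit// mulr1 riemann_norm2E breve_riemannE => WE.
rewrite -[LHS](divfK m0) -WE.
rewrite (_ : \sum_a _ = 2 * (m%:R - 1)); first by ring.
have h1 : \sum_k bil (g i u) (xi i u) (e k) * bil (g i u) (xi i u) (e k) = 1.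
  by rewrite -(parseval (gsym u Uu) (gpos u Uu) eO) sasakian_xi_unit.
rewrite -(sum_xi_curvature h1).
apply: eq_bigr => a _; apply: eq_bigr => b _; apply: eq_bigr => c _.
by rewrite sasakian_manifold_riemann// !eO expr2.
Qed.

Lemma sasakian_scalar_bounds i p : chart_dom i p ->
  - (m%:R * (m%:R - 1)) <= scalar_curvature g i p <= m%:R * (m%:R - 1).
Proof.
move=> /chart_in Uu; have [gs gsym gpos] := sasakian_metric i.
have [e eO] := orthonormal_exists (gsym _ Uu) (gpos _ Uu).
rewrite /scalar_curvature (scalar_orthonormal (@oU i) gs gsym gpos Uu eO).
apply: scalar_bounds (sasakian_norm2 Uu eO) => a b c d.
exact: (riemann_skewl (@oU i) gs gsym gpos).
Qed.

Lemma sasakian_scalar_max i u : chart_cod i u ->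
  Defs.scalar (g i) u = m%:R * (m%:R - 1) -> forall x y z,
  curvature_mx (g i) x y u *m z =
  bil (g i u) y z *: x - bil (g i u) x z *: y.
Proof.
move=> Uu; have [gs gsym gpos] := sasakian_metric i.
have [e eO] := orthonormal_exists (gsym _ Uu) (gpos _ Uu).
rewrite (scalar_orthonormal (@oU i) gs gsym gpos Uu eO) => smax.
apply: (curvature_mx_unit (@oU i) gs gsym gpos Uu eO).
apply: scalar_max (sasakian_norm2 Uu eO) smax => a b c d.
exact: (riemann_skewl (@oU i) gs gsym gpos).
Qed.

Lemma unit_curvature_conformally_flat :
  (forall i u x y z, chart_cod i u -> curvature_mx (g i) x y u *m z =
     bil (g i u) y z *: x - bil (g i u) x z *: y) ->
  conformally_flat g.
Proof.
move=> curv1 p; have [i ip] := chart_cover p.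
have Up := chart_in ip; have [gs gsym gpos] := sasakian_metric i.
set p0 := chart i p in Up *.
have [r [V [h [r0 rU [Vp hp] [hs Vs] d]]]] :=
  exists_parallel_section (@oU i) gs gsym gpos (curv1 i) Up.
have hc : {for p0, continuous h}.
  by apply: smooth_on_continuous hs _; rewrite /= subrr normr0.
(* The ball is shrunk so that [h] stays within 1 of its value 1 at the centre, which keeps [1 + h]
   positive. *)
move/continuous_normBP: hc => /(_ 1 ltr01)[r1 r10 hr1].
pose r2 := Num.min r r1.
pose B := [set u | `|u - p0| < r2].
have BP u : B u -> `|u - p0| < r /\ `|u - p0| < r1.
  by rewrite /B /= lt_min => /andP[].
have BU u : B u -> chart_cod i u by case/BP => /rU.
have r20 : 0 < r2 by rewrite lt_min r0.
have oB : open B := open_norm_ball p0 r2.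
have sB (V' : normedModType R) (f : 'cV[R]_m -> V') :
    smooth_on [set u | `|u - p0| < r] f -> smooth_on B f.
  by move=> fs k; apply: Ck_on_sub (fs k) => v /BP[].
have gsB : smooth_on B (g i).
  by move=> k; apply: Ck_on_sub (gs k) => v /BU.
have gsymB v : B v -> (g i v)^T = g i v by move/BU; exact: gsym.
have gposB v : B v -> forall w, w != 0 -> 0 < bil (g i v) w w.
  by move/BU; exact: gpos.
have curvB v x y z (Bv : B v) := curv1 i v x y z (BU v Bv).
have h_gt v : B v -> 0 < 1 + h v.
  by move=> /BP[_ /hr1]; rewrite hp ltr_norml => /andP[+ _]; lra.
have dV v x : B v ->
    is_derive v x V (- (christoffel_mx (g i) x v *m V v) - h v *: x).
  by move=> /BP[/(d v x)[]].
have dh v x : B v -> is_derive v x h (bil (g i v) x (V v)).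
  by move=> /BP[/(d v x)[]].
(* A first integral: the derivative of [h^2 + |V|^2] vanishes by the parallel equations and
   [nabla g = 0]. It is put in a 1 by 1 matrix to fit [derive_eq0_ball]. *)
have hV v : B v -> h v ^+ 2 + bil (g i v) (V v) (V v) = 1.
  pose F v : 'M[R]_1 := (h v ^+ 2 + bil (g i v) (V v) (V v))%:M.
  have F0 w x : `|w - p0| < r2 -> is_derive w x F 0.
    move=> Bw; have Uw := BU w Bw; apply/is_derive_mxP => a b; rewrite !ord1
      mxE.
    apply: (@is_derive_fun_eq _ _ _ (fun v => h v * h v + bil (g i v) (V v) (V
      v))).
      by move=> v'; rewrite mxE eqxx mulr1n expr2.
    have D := is_derive_add (is_derive_mul (dh w x Bw) (dh w x Bw))
      (is_derive_bil (is_derive_metric gs x Uw) (dV w x Bw) (dV w x Bw)).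
    apply: (is_derive_eq D).
    rewrite (dmetricE (@oU i) gs gsym gpos)// bil_mxD -bil_mull -bil_mulr.
    rewrite !(bilBl, bilBr, bilNl, bilNr, bilZl, bilZr).
    by rewrite (metricC gsym (V w) x Uw); ring.
  move=> Bv; have := derive_eq0_ball F0 Bv.
  move/matrixP/(_ 0 0); rewrite !mxE eqxx !mulr1n => ->.
  by rewrite Vp hp bil0l addr0 expr1n.
exists i, B, (fun u => (1 + h u)^-1 ^+ 2); split => //.
- by split=> //; rewrite /B /= subrr normr0.
- by split=> [|v /h_gt v0]; [exact: conformal_factor_smooth (sB _ _ hs) h_gt|
    rewrite exprn_gt0// invr_gt0].
- move=> v Bv x y z w.
  exact: conformal_flat oB gsB gsymB gposB curvB (sB _ _ hs) dV dh h_gt hV _ _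
    _ _ _ Bv.
Qed.

Lemma sasakian_scalar_max_iff :
  (forall i p, chart_dom i p -> scalar_curvature g i p = m%:R * (m%:R - 1)) <->
  conformally_flat g /\ einstein g.
Proof.
split=> [smax|[_ [l El]] i p /chart_in Uu].
  have curv1 i u x y z : chart_cod i u -> curvature_mx (g i) x y u *m z =
      bil (g i u) y z *: x - bil (g i u) x z *: y.
    move=> Uu; apply: sasakian_scalar_max => //.
    by have := smax i _ (chart_inv_in Uu); rewrite /scalar_curvature chart_invK.
  split; first exact: unit_curvature_conformally_flat.
  exists (m%:R - 1) => i u Uu x y; have [gs gsym gpos] := sasakian_metric i.
  have [e eO] := orthonormal_exists (gsym _ Uu) (gpos _ Uu).
  rewrite (ricci_orthonormal (@oU i) gs gsym gpos Uu eO).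
  under eq_bigr do rewrite (riemannE (@oU i) gs gsym gpos)// curv1// bilBl
    !bilZl
    eO eqxx mulr1.
  rewrite sumrB sumr_const card_ord mulrBl mul1r mulr_natl; congr (_ - _).
  rewrite (metricC gsym x y Uu) [RHS](parseval (gsym _ Uu) (gpos _ Uu) eO).
  by apply: eq_bigr => a _; rewrite (metricC gsym (e a) y Uu) mulrC.
have [gs gsym gpos] := sasakian_metric i.
have [e eO] := orthonormal_exists (gsym _ Uu) (gpos _ Uu).
have lE : l = m%:R - 1.
  by rewrite -(sasakian_ricci_xi Uu) El// sasakian_xi_unit// mulr1.
rewrite /scalar_curvature (scalar_orthonormal (@oU i) gs gsym gpos Uu eO).
rewrite exchange_big /=.
under eq_bigr do rewrite -(ricci_orthonormal (@oU i) gs gsym gpos Uu eO) El//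
  eO eqxx mulr1.
by rewrite sumr_const card_ord lE mulr_natl.
Qed.

End SasakianManifold.

Theorem theorem1p1 (R : realType) (n : nat) (hn : (1 <= n)%N)
    (M : smooth_manifold R (2 * n).+1)
    (phi : components M 'M[R]_((2 * n).+1))
    (xi : components M 'cV[R]_((2 * n).+1))
    (eta : components M 'rV[R]_((2 * n).+1))
    (g : components M 'M[R]_((2 * n).+1))
    (hS : sasakian phi xi eta g) (hW : weakly_einstein g) :
  let N : R := n%:R in
  (n = 1%N ->
     (forall i p, chart_dom i p -> -6 <= scalar_curvature g i p <= 6) /\
     ((forall i p, chart_dom i p -> scalar_curvature g i p = 6) <->
      conformally_flat g /\ einstein g)) /\
  ((2 <= n)%N ->
     (forall i p, chart_dom i p ->
        - (2 * N * (2 * N + 1)) *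
          ((4 * N ^+ 2 - 4 * N + 3) / (4 * N ^+ 2 - 4 * N - 1))
        <= scalar_curvature g i p <= 2 * N * (2 * N + 1)) /\
     ((forall i p, chart_dom i p ->
         scalar_curvature g i p = 2 * N * (2 * N + 1)) <->
      conformally_flat g /\ einstein g)).
Proof.
move=> N.
have bounds := sasakian_scalar_bounds hS hW.
have max_iff := sasakian_scalar_max_iff hS hW.
have KE : (2 * n).+1%:R * ((2 * n).+1%:R - 1) = 2 * N * (2 * N + 1) :> R.
  by rewrite -natr1 natrM addrK mulrC.
rewrite KE in bounds max_iff.
split=> [n1|n2].
  have K6 : 2 * N * (2 * N + 1) = 6 by rewrite /N n1; ring.
  by rewrite K6 in bounds max_iff.
split=> // i p /bounds /andP[lo ->]; rewrite andbT; apply: le_trans lo.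
have N2 : 2 <= N by rewrite /N ler_nat.
have K0 : 0 <= 2 * N * (2 * N + 1) by nra.
(* The numerator exceeds the denominator by 4, so a positive denominator makes the quotient larger
   than 1. At [n = 1] the denominator would be -1. *)
have d0 : 0 < 4 * N ^+ 2 - 4 * N - 1 by nra.
rewrite mulNr lerN2 ler_peMr// ler_pdivlMr// mul1r.
by lra.
Qed.
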